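(* Let $k\geq 1$ be an integer. There exist two positive constants $\alpha_k$ and $\gamma_k$, depending only on $k$, such that the following holds. Let $\lambda\in(0,1)$, let $I$ be a subarc of $\mathbb T$ of length $2\pi\lambda$, and let $f\in H^{k,2}$ with $\|f\|_{k,2}\leq 1$ satisfy $\|f\|_{2,I}\leq e^{-\gamma_k/\lambda}$. Then $$\|f\|_2\leq \frac{\alpha_k}{\left(\lambda\log(1/\|f\|_{2,I})\right)^k}.$$
   Context: $\mathbb D$ is the open unit disk and $\mathbb T$ the unit circle. $H^2$ is the Hardy space of analytic functions in $\mathbb D$ with bounded $L^2$ means on circles of radius $r\to1$, with $\|f\|_2=\left(\frac{1}{2\pi}\int_0^{2\pi}|f(e^{i\theta})|^2d\theta\right)^{1/2}$ computed on boundary values. For an integer $k\ge1$, the Hardy–Sobolev space is $H^{k,2}=\{f\in H^2: f^{(j)}\in H^2,\ j=1,\dots,k\}$ with norm $\|f\|_{k,2}^2=\sum_{j=0}^k\|f^{(j)}\|_2^2$ (derivatives with respect to the complex variable $z$). For a subarc $I\subset\mathbb T$ of length $2\pi\lambda$, $\|f\|_{2,I}=\left(\frac{1}{2\pi\lambda}\int_I|f(e^{i\theta})|^2d\theta\right)^{1/2}$. *)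

(* Defs.v *)
From Stdlib Require Import Reals.
From mathcomp Require Import all_boot all_algebra.
From mathcomp Require Import all_classical all_reals all_analysis.
From mathcomp Require Import Rstruct Rstruct_topology.
From Coquelicot Require Import Coquelicot.

Set Implicit Arguments.
Unset Strict Implicit.
Unset Printing Implicit Defensive.

Local Open Scope classical_set_scope.

Definition polarC (r t : R) : C := (Rmult r (cos t), Rmult r (sin t)).

Definition holo_disk (f : C -> C) : Prop :=
  forall z : C, Rlt (Cmod z) 1 ->
    ex_derive (K := C_AbsRing) (V := C_NormedModule) f z.

Definition sq_int (h : R -> C) (a b : R) : \bar R :=
  (\int[@lebesgue_measure R]_(t in `[a, b]) (EFin (Rsqr (Cmod (h t)))))%E.

Definition circ_int (f : C -> C) (r : R) : \bar R :=
  sq_int (fun t => f (polarC r t)) 0 (Rmult 2 PI).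

Definition in_H2 (f : C -> C) : Prop :=
  holo_disk f /\
  exists B : R, forall r : R, Rle 0 r -> Rlt r 1 ->
    (circ_int f r <= EFin B)%E.

Definition radial_limit (f : C -> C) (t : R) (w : C) : Prop :=
  forall eps : R, Rlt 0 eps -> exists delta : R, Rlt 0 delta /\
    forall r : R, Rlt (Rminus 1 delta) r -> Rlt r 1 ->
      Rlt (Cmod (Cminus (f (polarC r t)) w)) eps.

Definition boundary_fun (f : C -> C) (g : R -> C) : Prop :=
  measurable_fun [set: measurableTypeR R]
    (fun t : measurableTypeR R => (fst (g t) : measurableTypeR R)) /\
  measurable_fun [set: measurableTypeR R]
    (fun t : measurableTypeR R => (snd (g t) : measurableTypeR R)) /\
  {ae @lebesgue_measure R, forall t : R, radial_limit f t (g t)}.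

(* ||f||_2 computed on the boundary values g *)
Definition H2_norm (g : R -> C) : R :=
  sqrt (Rdiv (fine (sq_int g 0 (Rmult 2 PI))) (Rmult 2 PI)).

(* ||f||_{2,I} for the arc I = { e^{i theta} : a <= theta <= a + 2 pi lambda } *)
Definition arc_norm (g : R -> C) (a lam : R) : R :=
  sqrt (Rdiv (fine (sq_int g a (Rplus a (Rmult (Rmult 2 PI) lam))))
             (Rmult (Rmult 2 PI) lam)).

(* ||f||_{k,2} = (sum_{j=0}^k ||f^(j)||_2^2)^{1/2}, gs j = boundary fn of f^(j) *)
Definition Hk2_norm (k : nat) (gs : nat -> R -> C) : R :=
  sqrt (sum_f_R0 (fun j => Rsqr (H2_norm (gs j))) k).

(* Main.v *)
(** Write f = sum a_n z^n. The Taylor coefficients of f^(k) are square summable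
    with sum at most 1, so the coefficients of index at least N + k contribute
    at most N^(-2k) to |f|_2^2. For the low coefficients, let s be analytic in
    the disk with Re s = |s|^2 on the circle, concentrated on the arc I, and
    put Q = 1 + s + 2 s^2. Then |Q| <= 4 on the closed disk, |Q| <= 1 on the
    circle off I, and |Q| >= 1 + lambda/32 for |z| <= 1/5. Cauchy's formula for
    f Q^M, with M such that 4^M |f|_{2,I} <= 1, bounds |f| by
    (8/3) (1 + lambda/32)^(-M) on |z| <= 1/5, which is exponentially small in
    X = lambda log(1/|f|_{2,I}). Hence |a_n| is at most 5^n times this bound,
    and taking N to be a small multiple of X gives |f|_2 <= alpha X^(-k).

    Only f^(0), ..., f^(k-1) are known to have continuous derivatives, which is
    why Cauchy's formula is proved for C^1 functions and the coefficients of
    f^(k) are obtained by integration by parts on circles. *)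

Require Import Defs.
From Stdlib Require Import Reals ZArith Arith Lra Lia Psatz.
From Coquelicot Require Import Coquelicot.

Local Open Scope R_scope.

(** * Complex differentiability *)

(** Seen from |z| <= 1/5 the arc has harmonic measure comparable to lambda, so the two-constants
    theorem predicts log |f| <= C - c X there. The powers Q^M stand in for the outer function of
    that argument: Q is rational with its pole outside the closed disk, hence continuous up to the
    circle, and only f itself needs boundary limits.

    The obstacle is that these limits are radial and hold only almost everywhere. Fatou's lemma
    bounds boundary norms by norms on circles |z| = r, which settles |f|_2 in terms of the
    coefficients. The coefficients and the values of f, however, must be bounded by integrals of
    boundary values, against the direction of Fatou. These bounds are therefore kept linear in |f|:
    since the means of |f|^2 are bounded uniformly in r, integrals of |f| against bounded weights
    lose nothing in the limit. Products are then split pointwise by the arithmetic-geometric mean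
    inequality, in place of Cauchy-Schwarz. *)

Lemma continuous_C_pair {U : UniformSpace} (h : U -> C) (x : U) :
  continuous (fun u => fst (h u)) x -> continuous (fun u => snd (h u)) x ->
  continuous h x.
Proof.
intros H1 H2 P [e He].
assert (L1 := H1 _ (locally_ball (fst (h x)) e)).
assert (L2 := H2 _ (locally_ball (snd (h x)) e)).
unfold filtermap in *.
generalize (filter_and _ _ L1 L2); apply filter_imp.
intros u [A B]; apply He; split; assumption.
Qed.

Lemma continuous_Re {U : UniformSpace} (h : U -> C) (x : U) :
  continuous h x -> continuous (fun u => fst (h u)) x.
Proof. intros H; apply (continuous_comp h fst); [exact H | apply continuous_fst]. Qed.

Lemma continuous_Im {U : UniformSpace} (h : U -> C) (x : U) :
  continuous h x -> continuous (fun u => snd (h u)) x.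
Proof. intros H; apply (continuous_comp h snd); [exact H | apply continuous_snd]. Qed.

Lemma continuous_Cplus {U : UniformSpace} (f g : U -> C) (x : U) :
  continuous f x -> continuous g x -> continuous (fun u => f u + g u)%C x.
Proof.
intros Hf Hg; apply continuous_C_pair; simpl.
- apply (continuous_plus (V := R_NormedModule)); now apply continuous_Re.
- apply (continuous_plus (V := R_NormedModule)); now apply continuous_Im.
Qed.

Lemma continuous_Copp {U : UniformSpace} (f : U -> C) (x : U) :
  continuous f x -> continuous (fun u => - f u)%C x.
Proof.
intros Hf; apply continuous_C_pair; simpl.
- apply (continuous_opp (V := R_NormedModule)); now apply continuous_Re.
- apply (continuous_opp (V := R_NormedModule)); now apply continuous_Im.
Qed.

Lemma continuous_Cminus {U : UniformSpace} (f g : U -> C) (x : U) :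
  continuous f x -> continuous g x -> continuous (fun u => f u - g u)%C x.
Proof.
intros Hf Hg; apply continuous_Cplus; [assumption | now apply continuous_Copp].
Qed.

Lemma continuous_Rmult {U : UniformSpace} (f g : U -> R) (x : U) :
  continuous f x -> continuous g x -> continuous (fun u => f u * g u) x.
Proof. intros; now apply (continuous_mult (K := R_AbsRing)). Qed.

Lemma continuous_Cmult {U : UniformSpace} (f g : U -> C) (x : U) :
  continuous f x -> continuous g x -> continuous (fun u => f u * g u)%C x.
Proof.
intros Hf Hg.
assert (f1 := continuous_Re _ _ Hf); assert (f2 := continuous_Im _ _ Hf).
assert (g1 := continuous_Re _ _ Hg); assert (g2 := continuous_Im _ _ Hg).
apply continuous_C_pair; simpl.
- apply (continuous_minus (V := R_NormedModule)); now apply continuous_Rmult.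
- apply (continuous_plus (V := R_NormedModule)); now apply continuous_Rmult.
Qed.

Lemma continuous_Cconj {U : UniformSpace} (f : U -> C) (x : U) :
  continuous f x -> continuous (fun u => Cconj (f u)) x.
Proof.
intros Hf; apply continuous_C_pair; simpl.
- now apply continuous_Re.
- apply (continuous_opp (V := R_NormedModule)); now apply continuous_Im.
Qed.

Lemma continuous_RtoC {U : UniformSpace} (f : U -> R) (x : U) :
  continuous f x -> continuous (fun u => RtoC (f u)) x.
Proof.
intros Hf; apply continuous_C_pair; simpl; [exact Hf | apply continuous_const].
Qed.

Lemma continuous_Cpow {U : UniformSpace} (f : U -> C) (n : nat) (x : U) :
  continuous f x -> continuous (fun u => f u ^ n)%C x.
Proof.
intros Hf; induction n; simpl.
- apply continuous_const.
- now apply continuous_Cmult.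
Qed.

Lemma continuous_R_sqrt {U : UniformSpace} (f : U -> R) (x : U) :
  continuous f x -> continuous (fun u => sqrt (f u)) x.
Proof.
intros Hf; apply (continuous_comp f sqrt); [exact Hf |].
apply continuous_sqrt.
Qed.

Lemma continuous_sq_norm {U : UniformSpace} (f : U -> C) (x : U) :
  continuous f x -> continuous (fun u => fst (f u) ^ 2 + snd (f u) ^ 2) x.
Proof.
intros Hf.
assert (f1 := continuous_Re _ _ Hf); assert (f2 := continuous_Im _ _ Hf).
apply (continuous_ext (fun u => fst (f u) * fst (f u) + snd (f u) * snd (f u))).
{ intros u; simpl; ring. }
apply (continuous_plus (V := R_NormedModule)); now apply continuous_Rmult.
Qed.

Lemma continuous_Cmod {U : UniformSpace} (f : U -> C) (x : U) :
  continuous f x -> continuous (fun u => Cmod (f u)) x.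
Proof.
intros Hf; unfold Cmod; apply continuous_R_sqrt; now apply continuous_sq_norm.
Qed.

Lemma continuous_Cinv {U : UniformSpace} (f : U -> C) (x : U) :
  f x <> 0%C -> continuous f x -> continuous (fun u => / f u)%C x.
Proof.
intros H0 Hf.
assert (f1 := continuous_Re _ _ Hf); assert (f2 := continuous_Im _ _ Hf).
assert (D : fst (f x) ^ 2 + snd (f x) ^ 2 <> 0).
{ intros E; apply H0; destruct (f x) as [p q]; simpl in *.
  assert (p = 0) by nra; assert (q = 0) by nra; subst; reflexivity. }
assert (I : continuous (fun u => / (fst (f u) ^ 2 + snd (f u) ^ 2)) x).
{ apply (continuous_comp (fun u => fst (f u) ^ 2 + snd (f u) ^ 2) Rinv).
  - now apply continuous_sq_norm.
  - now apply continuous_Rinv. }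
apply continuous_C_pair; simpl; unfold Rdiv; apply continuous_Rmult; try assumption.
now apply (continuous_opp (V := R_NormedModule)).
Qed.

(** The basic neighbourhoods of [C] are squares, since it is a product of two real lines; the factor
    sqrt 2 converts them to discs. *)
Lemma continuous_C_eps (f : C -> C) (z : C) :
  continuous f z <->
  (forall eps, 0 < eps -> exists d, 0 < d /\
     forall h : C, Cmod h < d -> Cmod (f (z + h) - f z)%C < eps).
Proof.
split.
- intros H eps Heps.
  assert (He : 0 < eps / sqrt 2).
  { apply Rdiv_lt_0_compat; [assumption | apply sqrt_lt_R0; lra]. }
  destruct (H _ (locally_ball (f z) (mkposreal _ He))) as [d Hd].
  exists d; split; [apply cond_pos |].
  intros h Hh.
  assert (B : ball z d (z + h)%C).
  { apply (C_NormedModule_mixin_compat1 z (z + h)%C).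
    replace (minus (z + h)%C z) with h; [exact Hh |].
    unfold minus; simpl; unfold plus, opp; simpl; ring. }
  specialize (Hd _ B).
  apply C_NormedModule_mixin_compat2 in Hd.
  simpl in Hd.
  replace (sqrt 2 * (eps / sqrt 2)) with eps in Hd.
  2: { field; apply Rgt_not_eq, sqrt_lt_R0; lra. }
  exact Hd.
- intros H P [e He].
  destruct (H e (cond_pos e)) as [d [d0 Hd]].
  assert (Hd2 : 0 < d / sqrt 2).
  { apply Rdiv_lt_0_compat; [assumption | apply sqrt_lt_R0; lra]. }
  exists (mkposreal _ Hd2).
  intros y0 By; change C in y0.
  apply He, C_NormedModule_mixin_compat1.
  apply C_NormedModule_mixin_compat2 in By; simpl in By.
  replace (sqrt 2 * (d / sqrt 2)) with d in By.
  2: { field; apply Rgt_not_eq, sqrt_lt_R0; lra. }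
  specialize (Hd (y0 - z)%C By).
  replace (z + (y0 - z))%C with y0 in Hd by ring; exact Hd.
Qed.

(** [is_derive] without its filter and its linearity clause. The non-strict bound covers h = 0, and
    multiplying by |h| avoids quotients in the product and inversion rules. *)
Definition cdiff (f : C -> C) (z l : C) : Prop :=
  forall eps, 0 < eps -> exists d, 0 < d /\
    forall h : C, Cmod h < d ->
      Cmod (f (z + h) - f z - l * h)%C <= eps * Cmod h.

Lemma is_derive_cdiff (f : C -> C) (z l : C) :
  is_derive (K := C_AbsRing) (V := C_NormedModule) f z l -> cdiff f z l.
Proof.
intros [_ H] eps Heps.
specialize (H z (fun P H => H) (mkposreal _ Heps)).
destruct H as [d Hd].
exists d; split; [apply cond_pos |].
intros h Hh.
assert (B : @ball (AbsRing_UniformSpace C_AbsRing) z d (z + h)%C).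
{ change (Cmod (minus (z + h)%C z) < d).
  replace (minus (z + h)%C z) with h; [exact Hh |].
  unfold minus; simpl; unfold plus, opp; simpl; ring. }
specialize (Hd _ B).
change (Cmod (f (z + h) - f z - (z + h - z) * l)%C <= eps * Cmod (z + h - z)%C) in Hd.
replace (z + h - z)%C with h in Hd by ring.
rewrite (Cmult_comm l h); exact Hd.
Qed.

Lemma cdiff_continuous (f : C -> C) (z l : C) : cdiff f z l -> continuous f z.
Proof.
intros H; apply continuous_C_eps; intros eps Heps.
destruct (H 1 Rlt_0_1) as [d [d0 Hd]].
assert (L := Cmod_ge_0 l).
assert (P : 0 < eps / (2 + Cmod l)) by (apply Rdiv_lt_0_compat; lra).
exists (Rmin d (eps / (2 + Cmod l))); split; [now apply Rmin_pos |].
intros h Hh.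
assert (Hh1 := Rlt_le_trans _ _ _ Hh (Rmin_l _ _)).
assert (Hh2 := Rlt_le_trans _ _ _ Hh (Rmin_r _ _)).
specialize (Hd h Hh1).
replace (f (z + h) - f z)%C with ((f (z + h) - f z - l * h) + l * h)%C by ring.
eapply Rle_lt_trans; [apply Cmod_triangle |].
rewrite Cmod_mult.
assert (Cmod h * (2 + Cmod l) < eps).
{ apply (Rmult_lt_reg_r (/ (2 + Cmod l))); [apply Rinv_0_lt_compat; lra|].
  rewrite Rmult_assoc, Rinv_r, Rmult_1_r by lra. exact Hh2. }
assert (N := Cmod_ge_0 h). nra.
Qed.

Lemma cdiff_mult (f g : C -> C) (z l m : C) :
  cdiff f z l -> cdiff g z m -> cdiff (fun w => f w * g w)%C z (l * g z + f z * m)%C.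
Proof.
intros Hf Hg eps Heps.
assert (Cg := cdiff_continuous _ _ _ Hg).
rewrite continuous_C_eps in Cg.
assert (Gz := Cmod_ge_0 (g z)); assert (Fz := Cmod_ge_0 (f z)).
assert (L := Cmod_ge_0 l).
assert (e1 : 0 < eps / 3 / (1 + Cmod (g z))) by (apply Rdiv_lt_0_compat; lra).
assert (e2 : 0 < eps / 3 / (1 + Cmod (f z))) by (apply Rdiv_lt_0_compat; lra).
assert (e3 : 0 < Rmin 1 (eps / 3 / (1 + Cmod l))).
{ apply Rmin_pos; [lra | apply Rdiv_lt_0_compat; lra]. }
destruct (Hf _ e1) as [d1 [p1 H1]].
destruct (Hg _ e2) as [d2 [p2 H2]].
destruct (Cg _ e3) as [d3 [p3 H3]].
exists (Rmin d1 (Rmin d2 d3)); split; [repeat apply Rmin_pos; assumption |].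
intros h Hh.
assert (Hh1 := Rlt_le_trans _ _ _ Hh (Rmin_l _ _)).
assert (Hh' := Rlt_le_trans _ _ _ Hh (Rmin_r _ _)).
assert (Hh2 := Rlt_le_trans _ _ _ Hh' (Rmin_l _ _)).
assert (Hh3 := Rlt_le_trans _ _ _ Hh' (Rmin_r _ _)).
specialize (H1 h Hh1); specialize (H2 h Hh2); specialize (H3 h Hh3).
set (gh := g (z + h)%C) in *. set (fh := f (z + h)%C) in *.
(* Each of the three terms gets eps / 3; the first needs |g(z + h)| bounded, hence the 1 inside
   [e3]. *)
replace (fh * gh - f z * g z - (l * g z + f z * m) * h)%C
  with ((fh - f z - l * h) * gh + (f z * (gh - g z - m * h) + (l * h) * (gh - g z)))%C by ring.
eapply Rle_trans; [apply Cmod_triangle |].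
eapply Rle_trans; [apply Rplus_le_compat_l, Cmod_triangle |].
rewrite !Cmod_mult.
assert (G : Cmod gh <= 1 + Cmod (g z)).
{ replace gh with ((gh - g z) + g z)%C by ring.
  eapply Rle_trans; [apply Cmod_triangle |].
  assert (X := Rmin_l 1 (eps / 3 / (1 + Cmod l))); lra. }
assert (N := Cmod_ge_0 h).
assert (A1 : Cmod (fh - f z - l * h) * Cmod gh <= eps / 3 * Cmod h).
{ eapply Rle_trans; [apply Rmult_le_compat; try apply Cmod_ge_0; [exact H1 | exact G] |].
  right; field; lra. }
assert (A2 : Cmod (f z) * Cmod (gh - g z - m * h) <= eps / 3 * Cmod h).
{ eapply Rle_trans; [apply Rmult_le_compat; try apply Cmod_ge_0; [| exact H2];
    instantiate (1 := 1 + Cmod (f z)); lra |].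
  right; field; lra. }
assert (A3 : Cmod l * Cmod h * Cmod (gh - g z) <= eps / 3 * Cmod h).
{ assert (X := Rmin_r 1 (eps / 3 / (1 + Cmod l))).
  apply Rle_trans with ((1 + Cmod l) * Cmod h * (eps / 3 / (1 + Cmod l))).
  - apply Rmult_le_compat; [apply Rmult_le_pos; lra | apply Cmod_ge_0 | | lra].
    apply Rmult_le_compat_r; lra.
  - right; field; lra. }
lra.
Qed.

Lemma cdiff_const (c z : C) : cdiff (fun _ => c) z 0.
Proof.
intros eps Heps; exists 1; split; [lra |]; intros h _.
replace (c - c - 0 * h)%C with (RtoC 0) by ring.
rewrite Cmod_0; assert (N := Cmod_ge_0 h); nra.
Qed.

Lemma cdiff_plus (f g : C -> C) (z l m : C) :
  cdiff f z l -> cdiff g z m -> cdiff (fun w => f w + g w)%C z (l + m)%C.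
Proof.
intros Hf Hg eps Heps.
destruct (Hf (eps / 2)) as [d1 [p1 H1]]; [lra |].
destruct (Hg (eps / 2)) as [d2 [p2 H2]]; [lra |].
exists (Rmin d1 d2); split; [now apply Rmin_pos |].
intros h Hh.
assert (Hh1 := Rlt_le_trans _ _ _ Hh (Rmin_l _ _)).
assert (Hh2 := Rlt_le_trans _ _ _ Hh (Rmin_r _ _)).
specialize (H1 h Hh1); specialize (H2 h Hh2).
replace (f (z + h) + g (z + h) - (f z + g z) - (l + m) * h)%C
  with ((f (z + h) - f z - l * h) + (g (z + h) - g z - m * h))%C by ring.
eapply Rle_trans; [apply Cmod_triangle |]. lra.
Qed.

Lemma cdiff_affine (p q z : C) : cdiff (fun w => p + q * w)%C z q.
Proof.
intros eps Heps; exists 1; split; [lra |]; intros h _.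
replace (p + q * (z + h) - (p + q * z) - q * h)%C with (RtoC 0) by ring.
rewrite Cmod_0; assert (N := Cmod_ge_0 h); nra.
Qed.

Lemma cdiff_inv (f : C -> C) (z l : C) :
  f z <> 0%C -> cdiff f z l -> cdiff (fun w => / f w)%C z (- l * (/ f z * / f z))%C.
Proof.
intros H0 Hf eps Heps.
assert (Ci : continuous (fun w => / f w)%C z).
{ apply continuous_Cinv; [exact H0 | exact (cdiff_continuous _ _ _ Hf)]. }
assert (Cf := cdiff_continuous _ _ _ Hf).
rewrite continuous_C_eps in Ci, Cf.
set (I := Cmod (/ f z)%C).
assert (I0 : 0 <= I) by apply Cmod_ge_0.
assert (L := Cmod_ge_0 l).
assert (F0 : 0 < Cmod (f z)) by now apply Cmod_gt_0.
assert (e1 : 0 < eps / 2 / ((1 + I) * (1 + I))) by (apply Rdiv_lt_0_compat; nra).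
assert (e2 : 0 < Rmin 1 (eps / 2 / ((1 + Cmod l) * (1 + I)))).
{ apply Rmin_pos; [lra | apply Rdiv_lt_0_compat; nra]. }
destruct (Hf _ e1) as [d1 [p1 H1]].
destruct (Ci _ e2) as [d2 [p2 H2]].
destruct (Cf _ F0) as [d3 [p3 H3]].
exists (Rmin d1 (Rmin d2 d3)); split; [repeat apply Rmin_pos; assumption |].
intros h Hh.
assert (Hh1 := Rlt_le_trans _ _ _ Hh (Rmin_l _ _)).
assert (Hh' := Rlt_le_trans _ _ _ Hh (Rmin_r _ _)).
assert (Hh2 := Rlt_le_trans _ _ _ Hh' (Rmin_l _ _)).
assert (Hh3 := Rlt_le_trans _ _ _ Hh' (Rmin_r _ _)).
specialize (H1 h Hh1); specialize (H2 h Hh2); specialize (H3 h Hh3).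
set (fh := f (z + h)%C) in *.
assert (Fh : fh <> 0%C).
{ intros E; rewrite E in H3.
  replace (0 - f z)%C with (- f z)%C in H3 by ring.
  rewrite Cmod_opp in H3; lra. }
replace (/ fh - / f z - - l * (/ f z * / f z) * h)%C
  with (- ((fh - f z - l * h) * (/ fh * / f z)) - (l * h) * (/ f z * (/ fh - / f z)))%C
  by (field; split; assumption).
unfold Cminus at 1.
eapply Rle_trans; [apply Cmod_triangle |].
rewrite !Cmod_opp, !Cmod_mult.
fold I. set (J := Cmod (/ fh)%C) in *.
assert (HJ : J <= 1 + I).
{ unfold J; replace (/ fh)%C with ((/ fh - / f z) + / f z)%C by ring.
  eapply Rle_trans; [apply Cmod_triangle |]. fold I.
  assert (X := Rmin_l 1 (eps / 2 / ((1 + Cmod l) * (1 + I)))); lra. }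
assert (J0 : 0 <= J) by apply Cmod_ge_0.
assert (N := Cmod_ge_0 h).
assert (A1 : Cmod (fh - f z - l * h) * (J * I) <= eps / 2 * Cmod h).
{ apply Rle_trans with (eps / 2 / ((1 + I) * (1 + I)) * Cmod h * ((1 + I) * (1 + I))).
  - apply Rmult_le_compat; try apply Cmod_ge_0; try assumption.
    + now apply Rmult_le_pos.
    + apply Rmult_le_compat; lra.
  - right; field; lra. }
assert (A2 : Cmod l * Cmod h * (I * Cmod (/ fh - / f z)) <= eps / 2 * Cmod h).
{ assert (X := Rmin_r 1 (eps / 2 / ((1 + Cmod l) * (1 + I)))).
  apply Rle_trans with ((1 + Cmod l) * Cmod h * ((1 + I) * (eps / 2 / ((1 + Cmod l) * (1 + I))))).
  - apply Rmult_le_compat.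
    + apply Rmult_le_pos; lra.
    + apply Rmult_le_pos; [lra | apply Cmod_ge_0].
    + apply Rmult_le_compat_r; lra.
    + apply Rmult_le_compat; [lra | apply Cmod_ge_0 | lra | lra].
  - right; field; lra. }
lra.
Qed.

(** * Curves in the complex plane *)

(** Componentwise, so that the fundamental theorem and differentiation under the integral sign apply
    to each real coordinate; [cderive_eps] restores the complex form for the chain rule. *)
Definition cderive (h : R -> C) (t : R) (l : C) : Prop :=
  is_derive (fun u => fst (h u)) t (fst l) /\
  is_derive (fun u => snd (h u)) t (snd l).

Lemma is_derive_eps (f : R -> R) (t l : R) :
  is_derive f t l <->
  (forall eps, 0 < eps -> exists d, 0 < d /\ forall u, Rabs u < d ->
     Rabs (f (t + u) - f t - l * u) <= eps * Rabs u).
Proof.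
split.
- intros H eps Heps.
  apply is_derive_Reals in H.
  destruct (H eps Heps) as [d Hd].
  exists d; split; [apply cond_pos |].
  intros u Hu; destruct (Req_dec u 0) as [-> | u0].
  { rewrite Rplus_0_r, Rmult_0_r, Rminus_diag, Rminus_0_r, Rabs_R0; lra. }
  specialize (Hd u u0 Hu).
  replace (f (t + u) - f t - l * u) with (((f (t + u) - f t) / u - l) * u) by (field; exact u0).
  rewrite Rabs_mult; apply Rmult_le_compat_r; [apply Rabs_pos | lra].
- intros H; apply is_derive_Reals; intros eps Heps.
  destruct (H (eps / 2)) as [d [d0 Hd]]; [lra |].
  exists (mkposreal d d0); intros u u0 Hu; simpl in Hu.
  specialize (Hd u Hu).
  replace ((f (t + u) - f t) / u - l) with ((f (t + u) - f t - l * u) / u) by (field; exact u0).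
  unfold Rdiv; rewrite Rabs_mult, Rabs_inv.
  assert (P := Rabs_pos_lt u u0).
  apply Rle_lt_trans with (eps / 2); [| lra].
  apply (Rmult_le_reg_r (Rabs u)); [exact P |].
  rewrite Rmult_assoc, Rinv_l by lra. lra.
Qed.

Lemma Cmod_le_abs (z : C) : Cmod z <= Rabs (fst z) + Rabs (snd z).
Proof.
replace z with (RtoC (fst z) + Ci * RtoC (snd z))%C.
2: { destruct z; unfold Ci; apply injective_projections; simpl; ring. }
eapply Rle_trans; [apply Cmod_triangle |].
rewrite Cmod_mult, Cmod_Ci, !Cmod_R; simpl. right; rewrite Rmult_1_l.
f_equal; f_equal; ring.
Qed.

Lemma abs_fst_le (z : C) : Rabs (fst z) <= Cmod z.
Proof. eapply Rle_trans; [apply Rmax_l | apply Rmax_Cmod]. Qed.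

Lemma abs_snd_le (z : C) : Rabs (snd z) <= Cmod z.
Proof. eapply Rle_trans; [apply Rmax_r | apply Rmax_Cmod]. Qed.

Lemma cderive_eps (h : R -> C) (t : R) (l : C) :
  cderive h t l <->
  (forall eps, 0 < eps -> exists d, 0 < d /\ forall u, Rabs u < d ->
     Cmod (h (t + u)%R - h t - l * u)%C <= eps * Rabs u).
Proof.
split.
- intros [H1 H2] eps Heps.
  rewrite is_derive_eps in H1, H2.
  destruct (H1 (eps / 2)) as [d1 [p1 K1]]; [lra |].
  destruct (H2 (eps / 2)) as [d2 [p2 K2]]; [lra |].
  exists (Rmin d1 d2); split; [now apply Rmin_pos |].
  intros u Hu.
  specialize (K1 u (Rlt_le_trans _ _ _ Hu (Rmin_l _ _))).
  specialize (K2 u (Rlt_le_trans _ _ _ Hu (Rmin_r _ _))).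
  eapply Rle_trans; [apply Cmod_le_abs |].
  simpl.
  match goal with |- Rabs ?x + Rabs ?y <= _ =>
    replace x with (fst (h (t + u)) - fst (h t) - fst l * u) by ring;
    replace y with (snd (h (t + u)) - snd (h t) - snd l * u) by ring end.
  lra.
- intros H; unfold cderive; rewrite !is_derive_eps.
  split; intros eps Heps; destruct (H eps Heps) as [d [d0 Hd]].
  + exists d; split; [exact d0 |]; intros u Hu.
    eapply Rle_trans; [eapply Rle_trans; [right | apply abs_fst_le] | exact (Hd u Hu)].
    f_equal; simpl; ring.
  + exists d; split; [exact d0 |]; intros u Hu.
    eapply Rle_trans; [eapply Rle_trans; [right | apply abs_snd_le] | exact (Hd u Hu)].
    f_equal; simpl; ring.
Qed.

Lemma cdiff_comp_curve (f : C -> C) (g : R -> C) (t : R) (l m : C) :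
  cdiff f (g t) l -> cderive g t m -> cderive (fun u => f (g u)) t (l * m)%C.
Proof.
intros Hf Hg; rewrite cderive_eps in Hg |- *; intros eps Heps.
assert (L := Cmod_ge_0 l); assert (M := Cmod_ge_0 m).
assert (e1 : 0 < eps / 2 / (1 + Cmod m)) by (apply Rdiv_lt_0_compat; lra).
assert (e2 : 0 < Rmin 1 (eps / 2 / (1 + Cmod l))).
{ apply Rmin_pos; [lra | apply Rdiv_lt_0_compat; lra]. }
destruct (Hf _ e1) as [d1 [p1 H1]].
destruct (Hg _ e2) as [d2 [p2 H2]].
assert (p3 : 0 < d1 / (1 + Cmod m)) by (apply Rdiv_lt_0_compat; lra).
exists (Rmin d2 (d1 / (1 + Cmod m))); split; [now apply Rmin_pos |].
intros u Hu.
assert (Hu2 := Rlt_le_trans _ _ _ Hu (Rmin_l _ _)).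
assert (Hu1 := Rlt_le_trans _ _ _ Hu (Rmin_r _ _)).
specialize (H2 u Hu2).
set (h := (g (t + u)%R - g t)%C) in *.
assert (Bh : Cmod h <= (1 + Cmod m) * Rabs u).
{ replace h with ((h - m * u) + m * u)%C by ring.
  eapply Rle_trans; [apply Cmod_triangle |].
  rewrite Cmod_mult, Cmod_R.
  assert (X := Rmin_l 1 (eps / 2 / (1 + Cmod l))).
  assert (P := Rabs_pos u). nra. }
assert (Sh : Cmod h < d1).
{ eapply Rle_lt_trans; [exact Bh |].
  apply (Rmult_lt_compat_l (1 + Cmod m)) in Hu1; [| lra].
  replace ((1 + Cmod m) * (d1 / (1 + Cmod m))) with d1 in Hu1 by (field; lra).
  exact Hu1. }
specialize (H1 h Sh).
replace (g t + h)%C with (g (t + u)%R) in H1 by (unfold h; ring).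
replace (f (g (t + u)%R) - f (g t) - l * m * u)%C
  with ((f (g (t + u)%R) - f (g t) - l * h) + l * (h - m * u))%C by ring.
eapply Rle_trans; [apply Cmod_triangle |].
rewrite Cmod_mult.
assert (P := Rabs_pos u).
assert (A1 : eps / 2 / (1 + Cmod m) * Cmod h <= eps / 2 * Rabs u).
{ apply Rle_trans with (eps / 2 / (1 + Cmod m) * ((1 + Cmod m) * Rabs u)).
  - apply Rmult_le_compat_l; lra.
  - right; field; lra. }
assert (A2 : Cmod l * Cmod (h - m * u) <= eps / 2 * Rabs u).
{ assert (X := Rmin_r 1 (eps / 2 / (1 + Cmod l))).
  apply Rle_trans with ((1 + Cmod l) * (eps / 2 / (1 + Cmod l) * Rabs u)).
  - apply Rmult_le_compat; [lra | apply Cmod_ge_0 | lra |].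
    eapply Rle_trans; [exact H2 |]; apply Rmult_le_compat_r; lra.
  - right; field; lra. }
lra.
Qed.

Lemma cderive_mult (f g : R -> C) (t : R) (l m : C) :
  cderive f t l -> cderive g t m ->
  cderive (fun u => f u * g u)%C t (l * g t + f t * m)%C.
Proof.
intros [f1 f2] [g1 g2]; split; simpl.
- replace (fst l * fst (g t) - snd l * snd (g t) + (fst (f t) * fst m - snd (f t) * snd m))
  with ((fst l * fst (g t) + fst (f t) * fst m) - (snd l * snd (g t) + snd (f t) * snd m)) by ring.
  apply (is_derive_minus (K := R_AbsRing) (V := R_NormedModule));
  apply (is_derive_mult (K := R_AbsRing)); try assumption; exact Rmult_comm.
- replace (fst l * snd (g t) + snd l * fst (g t) + (fst (f t) * snd m + snd (f t) * fst m))
  with ((fst l * snd (g t) + fst (f t) * snd m) + (snd l * fst (g t) + snd (f t) * fst m)) by ring.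
  apply (is_derive_plus (K := R_AbsRing) (V := R_NormedModule));
  apply (is_derive_mult (K := R_AbsRing)); try assumption; exact Rmult_comm.
Qed.

Lemma cderive_ext (f g : R -> C) (t : R) (l : C) :
  (forall u, f u = g u) -> cderive f t l -> cderive g t l.
Proof.
intros E [H1 H2]; split.
- apply (is_derive_ext (fun u => fst (f u))); [intros u; now rewrite E | exact H1].
- apply (is_derive_ext (fun u => snd (f u))); [intros u; now rewrite E | exact H2].
Qed.

Lemma cderive_const (c : C) (t : R) : cderive (fun _ => c) t 0.
Proof. split; apply (is_derive_const (K := R_AbsRing) (V := R_NormedModule)). Qed.

Lemma cderive_plus (f g : R -> C) (t : R) (l m : C) :
  cderive f t l -> cderive g t m -> cderive (fun u => f u + g u)%C t (l + m)%C.
Proof.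
intros [f1 f2] [g1 g2]; split; simpl;
apply (is_derive_plus (K := R_AbsRing) (V := R_NormedModule)); assumption.
Qed.

Lemma cderive_RtoC (t : R) : cderive (fun u => RtoC u) t 1.
Proof.
split; simpl; [apply (is_derive_id (K := R_AbsRing)) |
  apply (is_derive_const (K := R_AbsRing) (V := R_NormedModule))].
Qed.

Definition cis (t : R) : C := (cos t, sin t).

Lemma cis_plus (s t : R) : cis (s + t) = (cis s * cis t)%C.
Proof.
unfold cis; apply injective_projections; simpl; [apply cos_plus | rewrite sin_plus; ring].
Qed.

Lemma cis_0 : cis 0 = 1%C.
Proof. unfold cis; rewrite cos_0, sin_0; reflexivity. Qed.

Lemma Cmod_cis (t : R) : Cmod (cis t) = 1.
Proof.
unfold Cmod, cis; simpl.
replace (cos t * (cos t * 1) + sin t * (sin t * 1)) with 1; [apply sqrt_1 |].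
assert (H := sin2_cos2 t); unfold Rsqr in H; lra.
Qed.

Lemma cis_conj (t : R) : Cconj (cis t) = cis (- t).
Proof. unfold cis, Cconj; simpl; now rewrite cos_neg, sin_neg. Qed.

Lemma cis_2PI (n : nat) (t : R) : cis (t + INR n * (2 * PI)) = cis t.
Proof.
unfold cis; f_equal; replace (INR n * (2 * PI)) with (2 * INR n * PI) by ring.
- apply cos_period.
- apply sin_period.
Qed.

Lemma cis_inv (t : R) : (cis (- t) * cis t = 1)%C.
Proof. rewrite <- cis_plus, Rplus_opp_l; apply cis_0. Qed.

Lemma cderive_cis (k t : R) : cderive (fun u => cis (k * u)) t (Ci * k * cis (k * t))%C.
Proof.
split; unfold cis; simpl; auto_derive; auto; ring.
Qed.

Lemma continuous_cis (k t : R) : continuous (fun u => cis (k * u)) t.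
Proof.
apply continuous_C_pair; simpl;
apply (ex_derive_continuous (K := R_AbsRing) (V := R_NormedModule)); auto_derive; auto.
Qed.

(** * Means over a period *)

(** The starting point [a] stays free: the norms use the period from 0, while the splitting along
    the arc needs a period that opens at an end of the arc. *)
Definition rmean (a : R) (h : R -> R) : R := RInt h a (a + 2 * PI) / (2 * PI).

Definition cmean (a : R) (h : R -> C) : C :=
  (rmean a (fun t => fst (h t)), rmean a (fun t => snd (h t))).

Lemma ex_RInt_cont (h : R -> R) (a b : R) :
  (forall t, continuous h t) -> ex_RInt h a b.
Proof. intros H; apply (ex_RInt_continuous (V := R_CompleteNormedModule)); auto. Qed.

Lemma two_PI_pos : 0 < 2 * PI.
Proof. assert (H := PI_RGT_0); lra. Qed.

Lemma rmean_ext (a : R) (f g : R -> R) : (forall t, f t = g t) -> rmean a f = rmean a g.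
Proof. intros E; unfold rmean; f_equal; apply RInt_ext; auto. Qed.

Lemma rmean_plus (a : R) (f g : R -> R) :
  (forall t, continuous f t) -> (forall t, continuous g t) ->
  rmean a (fun t => f t + g t) = rmean a f + rmean a g.
Proof.
intros Hf Hg; unfold rmean.
assert (E : RInt (fun t => f t + g t) a (a + 2 * PI) = RInt f a (a + 2 * PI) + RInt g a (a + 2 * PI)).
{ apply (RInt_plus (V := R_CompleteNormedModule) f g); now apply ex_RInt_cont. }
rewrite E; unfold Rdiv; ring.
Qed.

Lemma rmean_scal (a c : R) (f : R -> R) :
  (forall t, continuous f t) -> rmean a (fun t => c * f t) = c * rmean a f.
Proof.
intros Hf; unfold rmean.
assert (E : RInt (fun t => c * f t) a (a + 2 * PI) = c * RInt f a (a + 2 * PI)).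
{ apply (RInt_scal (V := R_CompleteNormedModule) f); now apply ex_RInt_cont. }
rewrite E; unfold Rdiv; ring.
Qed.

Lemma rmean_const (a c : R) : rmean a (fun _ => c) = c.
Proof.
unfold rmean; rewrite RInt_const; unfold scal; simpl; unfold mult; simpl.
field. assert (H := two_PI_pos); lra.
Qed.

Lemma rmean_le (a : R) (f g : R -> R) :
  (forall t, continuous f t) -> (forall t, continuous g t) ->
  (forall t, f t <= g t) -> rmean a f <= rmean a g.
Proof.
intros Hf Hg Hle; assert (H := two_PI_pos); unfold rmean, Rdiv.
apply Rmult_le_compat_r; [left; now apply Rinv_0_lt_compat |].
apply RInt_le; try (now apply ex_RInt_cont); [lra | auto].
Qed.

Lemma cmean_ext (a : R) (f g : R -> C) : (forall t, f t = g t) -> cmean a f = cmean a g.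
Proof. intros E; unfold cmean; f_equal; apply rmean_ext; intros t; now rewrite E. Qed.

Lemma cmean_plus (a : R) (f g : R -> C) :
  (forall t, continuous f t) -> (forall t, continuous g t) ->
  cmean a (fun t => f t + g t)%C = (cmean a f + cmean a g)%C.
Proof.
intros Hf Hg; unfold cmean; apply injective_projections; simpl; apply rmean_plus; intros t;
  try (now apply continuous_Re); now apply continuous_Im.
Qed.

Lemma cmean_scal (a : R) (c : C) (f : R -> C) :
  (forall t, continuous f t) -> cmean a (fun t => c * f t)%C = (c * cmean a f)%C.
Proof.
intros Hf.
assert (f1 := fun t => continuous_Re f t (Hf t)).
assert (f2 := fun t => continuous_Im f t (Hf t)).
assert (K : forall c (h : R -> R), (forall t, continuous h t) -> forall t, continuous (fun t => c * h t) t).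
{ intros d h Hh t; apply continuous_Rmult; [apply continuous_const | apply Hh]. }
unfold cmean; apply injective_projections; simpl.
- rewrite (rmean_ext a _ (fun t => fst c * fst (f t) + (- snd c) * snd (f t))) by (intros; ring).
  rewrite rmean_plus, !rmean_scal; auto. ring.
- rewrite rmean_plus, !rmean_scal; auto.
Qed.

Lemma cmean_const (a : R) (c : C) : cmean a (fun _ => c) = c.
Proof. unfold cmean; apply injective_projections; simpl; apply rmean_const. Qed.

(** Multiplication by the conjugate of the mean m turns |m|^2 into the real part of a mean, to which
    monotonicity applies; cancelling |m| afterwards sets the case m = 0 apart. *)
Lemma Cmod_cmean (a : R) (h : R -> C) :
  (forall t, continuous h t) -> Cmod (cmean a h) <= rmean a (fun t => Cmod (h t)).
Proof.
intros Hh.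
set (m := cmean a h).
assert (Cm : forall t, continuous (fun t => Cmod (h t)) t) by (intros; now apply continuous_Cmod).
destruct (Req_dec (Cmod m) 0) as [E | N].
{ rewrite E, <- (rmean_const a 0); apply rmean_le; auto.
  - intros; apply continuous_const.
  - intros; apply Cmod_ge_0. }
assert (P : 0 < Cmod m) by (assert (X := Cmod_ge_0 m); lra).
apply (Rmult_le_reg_l (Cmod m)); [exact P |].
rewrite <- rmean_scal by exact Cm.
assert (E : Cmod m * Cmod m = fst (Cconj m * m)%C).
{ replace (Cmod m * Cmod m) with (Cmod m ^ 2) by ring.
  rewrite Cmod2_alt; unfold Re, Im; simpl; ring. }
rewrite E; unfold m at 2; rewrite <- cmean_scal by exact Hh.
unfold cmean; cbn [fst]; apply rmean_le.
- intros t; apply continuous_Re, continuous_Cmult; [apply continuous_const | apply Hh].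
- intros t; apply continuous_Rmult; [apply continuous_const | apply Cm].
- intros t; eapply Rle_trans; [apply Rle_abs |].
  eapply Rle_trans; [apply abs_fst_le |].
  rewrite Cmod_mult, Cmod_conj; lra.
Qed.

Lemma cmean_derive (a : R) (h h' : R -> C) :
  (forall t, cderive h t (h' t)) -> (forall t, continuous h' t) ->
  h (a + 2 * PI) = h a -> cmean a h' = 0%C.
Proof.
intros D K E; unfold cmean; apply injective_projections; simpl; unfold rmean.
- rewrite (is_RInt_unique _ _ _ _ (is_RInt_derive (V := R_CompleteNormedModule) (fun t => fst (h t)) (fun t => fst (h' t))
     a (a + 2 * PI) (fun t _ => proj1 (D t)) (fun t _ => continuous_Re _ _ (K t)))).
  rewrite E; unfold minus, plus, opp; simpl; field. assert (H := two_PI_pos); lra.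
- rewrite (is_RInt_unique _ _ _ _ (is_RInt_derive (V := R_CompleteNormedModule) (fun t => snd (h t)) (fun t => snd (h' t))
     a (a + 2 * PI) (fun t _ => proj2 (D t)) (fun t _ => continuous_Im _ _ (K t)))).
  rewrite E; unfold minus, plus, opp; simpl; field. assert (H := two_PI_pos); lra.
Qed.

(* The frequency is [m - n] with natural [m], [n], so that negative ones are covered. *)
Lemma cmean_cis (a : R) (m n : nat) :
  m <> n -> cmean a (fun t => cis (INR m * t) * cis (- INR n * t))%C = 0%C.
Proof.
intros N.
set (k := INR m - INR n).
assert (k0 : k <> 0) by (unfold k; intros E; apply N, INR_eq; lra).
assert (I0 : (Ci * k)%C <> 0%C).
{ intros E; apply (f_equal snd) in E; simpl in E; lra. }
rewrite (cmean_ext _ _ (fun t => (/ (Ci * k)) * (Ci * k * cis (k * t)))%C).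
2: { intros t; rewrite <- cis_plus.
     replace (INR m * t + - INR n * t) with (k * t) by (unfold k; ring).
     field; split; [now intros E; apply RtoC_inj in E |]. 
     intros E; apply (f_equal snd) in E; simpl in E; lra. }
assert (Cc : forall t, continuous (fun u => Ci * k * cis (k * u))%C t).
{ intros t; apply continuous_Cmult; [apply continuous_const | apply continuous_cis]. }
rewrite cmean_scal by exact Cc.
rewrite (cmean_derive a (fun u => cis (k * u)) (fun u => Ci * k * cis (k * u))%C).
- ring.
- intros t; apply cderive_cis.
- exact Cc.
- unfold k.
  replace ((INR m - INR n) * (a + 2 * PI))
    with (((INR m - INR n) * a - INR n * (2 * PI)) + INR m * (2 * PI)) by ring.
  rewrite cis_2PI, <- (cis_2PI n). f_equal; ring.
Qed.

(** * Cauchy formula *)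

(** Differentiation under the integral sign. The hypotheses are local in the parameter because the
    homotopy below stays in the disk only for parameters near [0, 1]. *)
Lemma is_derive_rmean_param (phi dphi : R -> R -> R) (a s : R) :
  locally s (fun u => forall t, is_derive (fun v => phi v t) u (dphi u t)) ->
  (forall t, continuous (fun p : R * R => dphi (fst p) (snd p)) (s, t)) ->
  locally s (fun u => forall t, continuous (phi u) t) ->
  is_derive (fun u => rmean a (phi u)) s (rmean a (dphi s)).
Proof.
intros D C0 C1.
assert (Ds : forall t, Derive (fun v => phi v t) s = dphi s t).
{ intros t; apply is_derive_unique.
  destruct D as [e He]; apply He; apply ball_center. }
unfold rmean, Rdiv.
apply (is_derive_ext (fun u => / (2 * PI) * RInt (phi u) a (a + 2 * PI))); [intros; apply Rmult_comm |].
rewrite (Rmult_comm (RInt (dphi s) a (a + 2 * PI))).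
apply (is_derive_scal (fun u => RInt (phi u) a (a + 2 * PI))).
rewrite (RInt_ext (dphi s) (fun t => Derive (fun v => phi v t) s)) by (intros; now rewrite Ds).
apply is_derive_RInt_param.
- revert D; apply filter_imp; intros u Hu t _; exists (dphi u t); apply Hu.
- intros t _.
  apply continuity_2d_pt_ext_loc with (f := dphi).
  + destruct D as [e He]; exists e; intros u v Hu _.
    symmetry; apply is_derive_unique, He, Hu.
  + apply continuity_2d_pt_filterlim, C0.
- revert C1; apply filter_imp; intros u Hu; now apply ex_RInt_cont.
Qed.

Definition holoC1 (f f' : C -> C) : Prop :=
  (forall z, Cmod z < 1 -> cdiff f z (f' z)) /\
  (forall z, Cmod z < 1 -> continuous f' z).

Lemma holoC1_continuous (f f' : C -> C) (z : C) :
  holoC1 f f' -> Cmod z < 1 -> continuous f z.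
Proof. intros [H _] Hz; exact (cdiff_continuous _ _ _ (H z Hz)). Qed.

Lemma Cmod_polar (r t : R) : 0 <= r -> Cmod (r * cis t)%C = r.
Proof. intros Hr; rewrite Cmod_mult, Cmod_cis, Cmod_R, Rabs_pos_eq by exact Hr; ring. Qed.

Lemma continuous_polar (r t : R) : continuous (fun u => r * cis u)%C t.
Proof.
apply continuous_Cmult; [apply continuous_const |].
apply (continuous_ext (fun u => cis (1 * u))); [intros; now rewrite Rmult_1_l |].
apply continuous_cis.
Qed.

Lemma cderive_polar (r t : R) : cderive (fun u => r * cis u)%C t (Ci * (r * cis t))%C.
Proof.
replace (Ci * (r * cis t))%C with (0 * cis (1 * t) + r * (Ci * RtoC 1 * cis (1 * t)))%C.
2: { rewrite Rmult_1_l; ring. }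
apply (cderive_ext (fun u => r * cis (1 * u))%C); [intros; now rewrite Rmult_1_l |].
apply (cderive_mult (fun _ => RtoC r) (fun u => cis (1 * u))); [apply cderive_const | apply cderive_cis].
Qed.

Lemma polar_2PI (r t : R) : (r * cis (t + 2 * PI) = r * cis t)%C.
Proof.
replace (2 * PI) with (INR 1 * (2 * PI)) by (simpl; ring); now rewrite cis_2PI.
Qed.

Lemma polar_neq (r t : R) (z : C) : Cmod z < r -> (r * cis t - z <> 0)%C.
Proof.
intros Hz E; assert (X := Cmod_ge_0 z).
assert (r0 : 0 <= r) by lra.
assert (E' : (r * cis t)%C = z) by (replace z with (0 + z)%C by ring; rewrite <- E; ring).
rewrite <- E', Cmod_polar in Hz; lra.
Qed.

Section Homotopy.

Variables (f f' : C -> C) (a r : R) (z : C).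
Hypothesis Hf : holoC1 f f'.
Hypotheses (Hz : Cmod z < r) (Hr : r < 1).

Let w (t : R) : C := (r * cis t)%C.
Let g (s t : R) : C := (z + s * (w t - z))%C.
Let K (t : R) : C := (w t / (w t - z))%C.

Let r0 : 0 <= r.
Proof. assert (X := Cmod_ge_0 z); lra. Qed.

(** The absolute values admit s slightly outside [0, 1], as two-sided derivatives at the end points
    require. *)
Let g_bound (s t : R) : Cmod (g s t) <= Rabs (1 - s) * Cmod z + Rabs s * r.
Proof.
unfold g; replace (z + s * (w t - z))%C with ((1 - s)%R * z + s * w t)%C.
2: { rewrite RtoC_minus; ring. }
eapply Rle_trans; [apply Cmod_triangle |].
rewrite !Cmod_mult, !Cmod_R.
replace (Cmod (w t)) with r; [lra |]. unfold w; now rewrite Cmod_polar.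
Qed.

Let near (s : R) : Rabs (1 - s) * Cmod z + Rabs s * r < 1 ->
  locally s (fun u => forall t, Cmod (g u t) < 1).
Proof.
intros Hs.
assert (Cs : continuous (fun u => Rabs (1 - u) * Cmod z + Rabs u * r) s).
{ apply (continuous_plus (V := R_NormedModule)); apply continuous_Rmult; try apply continuous_const.
  - apply (continuous_comp (fun u => 1 - u) Rabs); [| apply continuous_Rabs].
    apply (continuous_minus (V := R_NormedModule)); [apply continuous_const | apply continuous_id].
  - apply continuous_Rabs. }
assert (L := Cs (fun y => y < 1) (open_lt 1 _ Hs)).
unfold filtermap in L; revert L; apply filter_imp; intros u Hu t.
eapply Rle_lt_trans; [apply g_bound | exact Hu].
Qed.

Let inside (s : R) : 0 <= s <= 1 -> Rabs (1 - s) * Cmod z + Rabs s * r < 1.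
Proof.
intros Hs; rewrite !Rabs_pos_eq by lra.
assert (X := Cmod_ge_0 z). nra.
Qed.

Let continuous_w (t : R) : continuous w t := continuous_polar r t.

Let continuous_K (t : R) : continuous K t.
Proof.
apply continuous_Cmult; [apply continuous_w |].
apply continuous_Cinv; [now apply polar_neq |].
apply continuous_Cminus; [apply continuous_w | apply continuous_const].
Qed.

Let continuous_g (s t : R) : continuous (fun p : R * R => g (fst p) (snd p)) (s, t).
Proof.
assert (Cw : continuous (fun p : R * R => w (snd p)) (s, t)).
{ apply (continuous_comp (fun p : R * R => snd p) w); [apply continuous_snd | apply continuous_w]. }
unfold g; apply continuous_Cplus; [apply continuous_const |].
apply continuous_Cmult; [apply continuous_RtoC, continuous_fst |].
apply continuous_Cminus; [exact Cw | apply continuous_const].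
Qed.

Let continuous_g2 (s t : R) : continuous (g s) t.
Proof.
unfold g; apply continuous_Cplus; [apply continuous_const |].
apply continuous_Cmult; [apply continuous_const |].
apply continuous_Cminus; [apply continuous_w | apply continuous_const].
Qed.

(** The derivative in s of f(g) K: the chain rule produces the factor w - z, which cancels the
    denominator of K. *)
Let dH (s t : R) : C := (f' (g s t) * w t)%C.

(** For s nonzero, i s dH is the derivative in t of the periodic function f(g(s, t)), so its mean
    vanishes. At s = 0 this says nothing, but there dH is a constant multiple of w. *)
Let dH_mean (s : R) : 0 <= s <= 1 -> cmean a (dH s) = 0%C.
Proof.
intros Hs.
assert (L : forall t, Cmod (g s t) < 1).
{ intros t; eapply Rle_lt_trans; [apply g_bound | now apply inside]. }
assert (Cd : forall t, continuous (fun t => Ci * s * dH s t)%C t).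
{ intros t; apply continuous_Cmult; [apply continuous_const |].
  apply continuous_Cmult; [| apply continuous_w].
  apply (continuous_comp (g s) f'); [apply continuous_g2 | apply (proj2 Hf), L]. }
destruct (Req_dec s 0) as [-> | s0].
- unfold dH.
  rewrite (cmean_ext _ _ (fun t => (f' z * - Ci) * (Ci * w t))%C).
  2: { intros t; unfold g.
       replace (z + 0 * (w t - z))%C with z by ring.
       assert (I2 : (Ci * Ci = - (1))%C)
         by (unfold Ci; apply injective_projections; simpl; ring).
       replace (f' z * - Ci * (Ci * w t))%C with (- (Ci * Ci) * (f' z * w t))%C by ring.
       rewrite I2; ring. }
  rewrite cmean_scal.
  + rewrite (cmean_derive a w); [ring | intros; apply cderive_polar | |apply polar_2PI].
    intros t; apply continuous_Cmult; [apply continuous_const | apply continuous_w].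
  + intros t; apply continuous_Cmult; [apply continuous_const | apply continuous_w].
- assert (E : cmean a (fun t => Ci * s * dH s t)%C = 0%C).
  { apply (cmean_derive a (fun t => f (g s t))).
    - intros t; unfold dH.
      replace (Ci * s * (f' (g s t) * w t))%C with (f' (g s t) * (0 + (0 * (w t - z) + s * (Ci * w t + 0))))%C by ring.
      apply (cdiff_comp_curve f (g s)); [apply (proj1 Hf), L |].
      apply (cderive_plus (fun _ => z)); [apply cderive_const |].
      apply (cderive_mult (fun _ => RtoC s) (fun u => w u - z)%C); [apply cderive_const |].
      apply (cderive_plus w (fun _ => - z)%C); [apply cderive_polar |].
      apply (cderive_const (- z)%C).
    - exact Cd.
    - unfold g, w; now rewrite polar_2PI. }
  assert (I0 : (Ci * s)%C <> 0%C).
  { intros E0; apply (f_equal snd) in E0; simpl in E0; lra. }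
  rewrite (cmean_ext _ _ (fun t => / (Ci * s) * (Ci * s * dH s t))%C).
  + rewrite cmean_scal, E by exact Cd; ring.
  + intros t. rewrite Cmult_assoc, Cinv_l by exact I0; ring.
Qed.

Let H (s t : R) : C := (f (g s t) * K t)%C.

Let H_derive (s t : R) : Cmod (g s t) < 1 -> cderive (fun u => H u t) s (dH s t).
Proof.
intros L; unfold H, dH.
assert (N := polar_neq r t z Hz); fold (w t) in N.
replace (f' (g s t) * w t)%C
  with ((f' (g s t) * (0 + (1 * (w t - z) + s * 0))) * K t + f (g s t) * 0)%C.
2: { unfold K. field. exact N. }
apply (cderive_mult (fun u => f (g u t)) (fun _ => K t)); [| apply cderive_const].
apply (cdiff_comp_curve f (fun u => g u t)); [apply (proj1 Hf), L |].
apply (cderive_plus (fun _ => z)); [apply cderive_const |].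
apply (cderive_mult (fun u => RtoC u) (fun _ => w t - z)%C); [apply cderive_RtoC | apply cderive_const].
Qed.

Let dH_continuous (s t : R) : Cmod (g s t) < 1 ->
  continuous (fun p : R * R => dH (fst p) (snd p)) (s, t).
Proof.
intros L; unfold dH; apply continuous_Cmult.
- apply (continuous_comp (fun p : R * R => g (fst p) (snd p)) f');
    [apply continuous_g | apply (proj2 Hf), L].
- apply (continuous_comp (fun p : R * R => snd p) w); [apply continuous_snd | apply continuous_w].
Qed.

Let H_continuous (s t : R) : Cmod (g s t) < 1 -> continuous (H s) t.
Proof.
intros L; unfold H; apply continuous_Cmult; [| apply continuous_K].
apply (continuous_comp (g s) f); [apply continuous_g2 | exact (holoC1_continuous _ _ _ Hf L)].
Qed.

(* The circle is contracted to the point [z], [s] being the homotopy parameter. *)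
Lemma cauchy_homotopy :
  cmean a (fun t => f z * (r * cis t / (r * cis t - z)))%C =
  cmean a (fun t => f (r * cis t) * (r * cis t / (r * cis t - z)))%C.
Proof.
transitivity (cmean a (H 0)).
{ apply cmean_ext; intros t; unfold H, g. f_equal. f_equal. ring. }
transitivity (cmean a (H 1)).
2: { apply cmean_ext; intros t; unfold H, g. f_equal. f_equal. unfold w; ring. }
assert (D : forall s, 0 <= s <= 1 ->
  is_derive (fun u => rmean a (fun t => fst (H u t))) s (rmean a (fun t => fst (dH s t))) /\
  is_derive (fun u => rmean a (fun t => snd (H u t))) s (rmean a (fun t => snd (dH s t)))).
{ intros s Hs.
  assert (N := near s (inside s Hs)).
  assert (N1 : forall t, Cmod (g s t) < 1) by (destruct N as [e He]; apply He, ball_center).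
  split.
  - apply (is_derive_rmean_param (fun u t => fst (H u t)) (fun u t => fst (dH u t))).
    + revert N; apply filter_imp; intros u Hu t; apply (H_derive u t (Hu t)).
    + intros t; apply (continuous_Re (fun p : R * R => dH (fst p) (snd p))), dH_continuous, N1.
    + revert N; apply filter_imp; intros u Hu t; apply continuous_Re, H_continuous, Hu.
  - apply (is_derive_rmean_param (fun u t => snd (H u t)) (fun u t => snd (dH u t))).
    + revert N; apply filter_imp; intros u Hu t; apply (H_derive u t (Hu t)).
    + intros t; apply (continuous_Im (fun p : R * R => dH (fst p) (snd p))), dH_continuous, N1.
    + revert N; apply filter_imp; intros u Hu t; apply continuous_Im, H_continuous, Hu. }
unfold cmean; apply injective_projections; cbn [fst snd].
- apply (eq_is_derive (V := R_NormedModule) (fun u => rmean a (fun t => fst (H u t))) 0 1); [| lra].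
  intros s Hs; assert (E : rmean a (fun t => fst (dH s t)) = 0) by exact (f_equal fst (dH_mean s Hs)).
  assert (X := proj1 (D s Hs)); rewrite E in X; exact X.
- apply (eq_is_derive (V := R_NormedModule) (fun u => rmean a (fun t => snd (H u t))) 0 1); [| lra].
  intros s Hs; assert (E : rmean a (fun t => snd (dH s t)) = 0) by exact (f_equal snd (dH_mean s Hs)).
  assert (X := proj2 (D s Hs)); rewrite E in X; exact X.
Qed.

End Homotopy.

(** * Taylor coefficients *)

Fixpoint csum (u : nat -> C) (N : nat) : C :=
  match N with O => 0%C | S n => (csum u n + u n)%C end.

Fixpoint rsum (u : nat -> R) (N : nat) : R :=
  match N with O => 0 | S n => rsum u n + u n end.

Lemma csum_S (u : nat -> C) (N : nat) : csum u (S N) = (csum u N + u N)%C.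
Proof. reflexivity. Qed.

Lemma rsum_S (u : nat -> R) (N : nat) : rsum u (S N) = rsum u N + u N.
Proof. reflexivity. Qed.

Lemma rsum_le (u v : nat -> R) (N : nat) : (forall n, (n < N)%nat -> u n <= v n) -> rsum u N <= rsum v N.
Proof.
induction N as [| N IH]; intros H; simpl; [lra |].
assert (A := H N ltac:(lia)); assert (B := IH (fun n h => H n ltac:(lia))); lra.
Qed.

Lemma rsum_scal (c : R) (u : nat -> R) (N : nat) : rsum (fun n => c * u n) N = c * rsum u N.
Proof. induction N as [| N IH]; simpl; [ring | rewrite IH; ring]. Qed.

Lemma rsum_add (u : nat -> R) (M N : nat) :
  rsum u (M + N) = rsum u M + rsum (fun n => u (M + n)%nat) N.
Proof.
induction N as [| N IH]; [rewrite Nat.add_0_r; simpl; ring |].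
rewrite Nat.add_succ_r; simpl; rewrite IH; ring.
Qed.

Lemma rsum_mono (u : nat -> R) (M N : nat) :
  (forall n, 0 <= u n) -> (M <= N)%nat -> rsum u M <= rsum u N.
Proof.
intros Hu; induction 1 as [| N _ IH]; simpl; [lra |]. assert (A := Hu N); lra.
Qed.

Lemma div_lt_1 (x y : R) : 0 < y -> x < y -> x / y < 1.
Proof.
intros Hy Hx; apply (Rmult_lt_reg_r y); [exact Hy |].
unfold Rdiv; rewrite Rmult_assoc, Rinv_l; lra.
Qed.

Lemma pow_small (q B eps : R) : 0 <= q < 1 -> 0 < eps -> exists N, forall n, (N <= n)%nat -> B * q ^ n < eps.
Proof.
intros Hq Heps.
assert (P : 0 < eps / (1 + Rabs B)) by (apply Rdiv_lt_0_compat; [|assert (X := Rabs_pos B)]; lra).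
destruct (pow_lt_1_zero q (ltac:(rewrite Rabs_pos_eq; lra)) _ P) as [N HN].
exists N; intros n Hn.
specialize (HN n Hn).
assert (Q := pow_le q n (proj1 Hq)).
rewrite Rabs_pos_eq in HN by exact Q.
assert (X := Rabs_pos B); assert (Y := Rle_abs B).
apply Rle_lt_trans with (Rabs B * q ^ n); [now apply Rmult_le_compat_r |].
apply Rle_lt_trans with ((1 + Rabs B) * q ^ n); [nra |].
apply (Rmult_lt_compat_l (1 + Rabs B)) in HN; [| lra].
replace ((1 + Rabs B) * (eps / (1 + Rabs B))) with eps in HN by (field; lra).
exact HN.
Qed.

(** Taylor series enter only through partial sums with a geometric error; this lemma removes the
    error at the end, so that no infinite sum is formed. *)
Lemma le_pow_limit (x y q B : R) (N0 : nat) : 0 <= q < 1 ->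
  (forall N, (N0 <= N)%nat -> x <= y + B * q ^ N) -> x <= y.
Proof.
intros Hq H; apply le_epsilon; intros eps Heps.
destruct (pow_small q B eps Hq Heps) as [N HN].
specialize (HN (max N N0) ltac:(lia)); specialize (H (max N N0) ltac:(lia)); lra.
Qed.

Definition fcoef (a : R) (u : R -> C) (n : nat) : C :=
  cmean a (fun t => u t * cis (- INR n * t))%C.

Lemma continuous_mul_cis (u : R -> C) (k : R) :
  (forall t, continuous u t) -> forall t, continuous (fun t => u t * cis (k * t))%C t.
Proof. intros H t; apply continuous_Cmult; [apply H | apply continuous_cis]. Qed.

Lemma fcoef_plus (a : R) (u v : R -> C) (n : nat) :
  (forall t, continuous u t) -> (forall t, continuous v t) ->
  fcoef a (fun t => u t + v t)%C n = (fcoef a u n + fcoef a v n)%C.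
Proof.
intros Hu Hv; unfold fcoef; rewrite <- cmean_plus by (now apply continuous_mul_cis).
apply cmean_ext; intros; ring.
Qed.

Lemma fcoef_scal (a : R) (c : C) (u : R -> C) (n : nat) :
  (forall t, continuous u t) -> fcoef a (fun t => c * u t)%C n = (c * fcoef a u n)%C.
Proof.
intros Hu; unfold fcoef; rewrite <- cmean_scal by (now apply continuous_mul_cis).
apply cmean_ext; intros; ring.
Qed.

Lemma fcoef_cis (a : R) (m n : nat) :
  fcoef a (fun t => cis (INR m * t)) n = if Nat.eq_dec m n then 1%C else 0%C.
Proof.
unfold fcoef; destruct (Nat.eq_dec m n) as [-> | N]; [| now apply cmean_cis].
rewrite (cmean_ext _ _ (fun _ => 1%C)); [apply cmean_const |].
intros t; rewrite <- cis_plus; replace (INR n * t + - INR n * t) with 0 by ring; apply cis_0.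
Qed.

Lemma Cmod_fcoef (a B : R) (u : R -> C) (n : nat) :
  (forall t, continuous u t) -> (forall t, Cmod (u t) <= B) -> Cmod (fcoef a u n) <= B.
Proof.
intros Hu HB; unfold fcoef.
assert (Cc := continuous_mul_cis u (- INR n) Hu).
eapply Rle_trans; [now apply Cmod_cmean |].
rewrite <- (rmean_const a B); apply rmean_le.
- intros t; now apply continuous_Cmod.
- intros t; apply continuous_const.
- intros t; rewrite Cmod_mult, Cmod_cis, Rmult_1_r; apply HB.
Qed.

(** * Trigonometric polynomials and Parseval's identity *)

Definition tpoly (d : nat -> C) (N : nat) (t : R) : C :=
  csum (fun m => d m * cis (INR m * t))%C N.

Lemma continuous_tpoly (d : nat -> C) (N : nat) (t : R) : continuous (tpoly d N) t.
Proof.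
induction N as [| N IH]; unfold tpoly; simpl.
- apply continuous_const.
- apply continuous_Cplus; [exact IH |].
  apply continuous_Cmult; [apply continuous_const | apply continuous_cis].
Qed.

Lemma fcoef_tpoly (a : R) (d : nat -> C) (N n : nat) :
  fcoef a (tpoly d N) n = if lt_dec n N then d n else 0%C.
Proof.
assert (Cc : forall m t, continuous (fun u => cis (INR m * u)) t) by (intros; apply continuous_cis).
induction N as [| N IH].
- unfold fcoef, tpoly; simpl.
  rewrite (cmean_ext _ _ (fun _ => 0%C)) by (intros; ring). rewrite cmean_const.
  destruct (lt_dec n 0); [lia | reflexivity].
- unfold tpoly; simpl.
  rewrite (fcoef_plus a (tpoly d N) (fun t => d N * cis (INR N * t))%C).
  + rewrite IH, fcoef_scal, fcoef_cis by auto.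
    destruct (lt_dec n N), (lt_dec n (S N)), (Nat.eq_dec N n); try lia; subst; ring.
  + intros; apply continuous_tpoly.
  + intros; apply continuous_Cmult; [apply continuous_const | auto].
Qed.

Lemma Cmod_sq_plus (p x : C) :
  Cmod (p + x)%C ^ 2 = Cmod p ^ 2 + Cmod x ^ 2 + 2 * fst (p * Cconj x)%C.
Proof. rewrite !Cmod2_alt; unfold Re, Im; destruct p, x; simpl; ring. Qed.

Lemma continuous_Cmod_sq (u : R -> C) :
  (forall t, continuous u t) -> forall t, continuous (fun t => Cmod (u t) ^ 2) t.
Proof.
intros H t; apply (continuous_ext (fun t => Cmod (u t) * Cmod (u t))); [intros; simpl; ring |].
apply continuous_Rmult; now apply continuous_Cmod.
Qed.

(** By induction: the cross term of the new summand is a multiple of the coefficient of index N of a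
    polynomial whose indices are below N, hence zero. *)
Lemma tpoly_parseval (a : R) (d : nat -> C) (N : nat) :
  rmean a (fun t => Cmod (tpoly d N t) ^ 2) = rsum (fun n => Cmod (d n) ^ 2) N.
Proof.
induction N as [| N IH].
- simpl; rewrite (rmean_ext _ _ (fun _ => 0)); [apply rmean_const |].
  intros t; unfold tpoly; simpl; rewrite Cmod_0; ring.
- rewrite rsum_S; cbv beta; rewrite <- IH.
  assert (Cp : forall t, continuous (tpoly d N) t) by (intros; apply continuous_tpoly).
  assert (Cx : forall t, continuous (fun t => tpoly d N t * cis (- INR N * t))%C t)
    by (now apply continuous_mul_cis).
  assert (Cy : forall t, continuous (fun t => Cconj (d N) * (tpoly d N t * cis (- INR N * t)))%C t)
    by (intros; apply continuous_Cmult; [apply continuous_const | apply Cx]).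
  assert (E : forall t, Cmod (tpoly d (S N) t) ^ 2 =
     Cmod (tpoly d N t) ^ 2 +
     (Cmod (d N) ^ 2 + 2 * fst (Cconj (d N) * (tpoly d N t * cis (- INR N * t)))%C)).
  { intros t; unfold tpoly at 1; rewrite csum_S; cbv beta; fold (tpoly d N t).
    rewrite Cmod_sq_plus, Cmod_mult, Cmod_cis, Cmult_conj, cis_conj, Rmult_1_r.
    replace (- (INR N * t)) with (- INR N * t) by ring.
    replace (tpoly d N t * (Cconj (d N) * cis (- INR N * t)))%C
      with (Cconj (d N) * (tpoly d N t * cis (- INR N * t)))%C by ring.
    ring. }
  rewrite (rmean_ext _ _ _ E).
  assert (C2 : forall t, continuous (fun t => 2 * fst (Cconj (d N) * (tpoly d N t * cis (- INR N * t)))%C) t).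
  { intros t; apply continuous_Rmult; [apply continuous_const | apply (continuous_Re (fun t => Cconj (d N) * (tpoly d N t * cis (- INR N * t)))%C), Cy]. }
  rewrite rmean_plus; [| now apply continuous_Cmod_sq |].
  2: { intros t; apply (continuous_plus (V := R_NormedModule)); [apply continuous_const | apply C2]. }
  rewrite rmean_plus; [| intros; apply continuous_const | exact C2].
  rewrite rmean_const, rmean_scal.
  2: { intros t; apply (continuous_Re (fun t => Cconj (d N) * (tpoly d N t * cis (- INR N * t)))%C), Cy. }
  assert (Z : cmean a (fun t => Cconj (d N) * (tpoly d N t * cis (- INR N * t)))%C = 0%C).
  { rewrite cmean_scal by exact Cx.
    assert (F := fcoef_tpoly a d N N); unfold fcoef in F; rewrite F.
    destruct (lt_dec N N); [lia | ring]. }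
  apply (f_equal fst) in Z; unfold cmean in Z; cbn [fst] in Z; rewrite Z; simpl; ring.
Qed.

(** * Geometric expansion of the Cauchy kernel *)

Section Kernel.

Variables (a r : R) (z : C).
Hypotheses (Hz : Cmod z < r).

Let K (t : R) : C := (r * cis t / (r * cis t - z))%C.

Let r0 : 0 < r.
Proof. assert (X := Cmod_ge_0 z); lra. Qed.

Lemma continuous_cauchy_kernel (t : R) :
  continuous (fun t => r * cis t / (r * cis t - z))%C t.
Proof.
apply continuous_Cmult; [apply continuous_polar |].
apply continuous_Cinv; [now apply polar_neq |].
apply continuous_Cminus; [apply continuous_polar | apply continuous_const].
Qed.

Lemma Cmod_cauchy_kernel (t : R) :
  Cmod (r * cis t / (r * cis t - z))%C <= r / (r - Cmod z).
Proof.
assert (N := polar_neq r t z Hz).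
rewrite Cmod_div, Cmod_polar by (assumption || lra).
apply Rmult_le_compat_l; [lra |].
apply Rinv_le_contravar; [lra |].
assert (T := Cmod_triangle (r * cis t - z)%C z).
replace (r * cis t - z + z)%C with (r * cis t)%C in T by ring.
rewrite Cmod_polar in T; lra.
Qed.

(** The kernel is 1 / (1 - q) with q = (z / r) e^(-it), and this is its equation K = 1 + q K.
    Iterated N times it gives the geometric expansion with an exact remainder, so nothing has to be
    integrated term by term. *)
Lemma kernel_step (t : R) : (K t = 1 + z / r * (cis (- t) * K t))%C.
Proof.
unfold K; assert (N := polar_neq r t z Hz).
assert (R0 : RtoC r <> 0%C) by (intros E; apply RtoC_inj in E; lra).
replace (z / r * (cis (- t) * (r * cis t / (r * cis t - z))))%C
  with (z / (r * cis t - z) * (cis (- t) * cis t))%C by (field; split; assumption).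
rewrite cis_inv; field; assumption.
Qed.

Lemma kernel_sum (u : R -> C) (N : nat) : (forall t, continuous u t) ->
  cmean a (fun t => u t * K t)%C =
  (csum (fun n => fcoef a u n * (z / r) ^ n)%C N +
   (z / r) ^ N * cmean a (fun t => u t * cis (- INR N * t) * K t)%C)%C.
Proof.
intros Hu; induction N as [| N IH].
- simpl. rewrite Cmult_1_l, Cplus_0_l; apply cmean_ext; intros t.
  replace (- 0 * t) with 0 by ring; rewrite cis_0; ring.
- rewrite IH, (csum_S _ N); cbv beta; rewrite Cpow_S.
  rewrite (cmean_ext a (fun t => u t * cis (- INR N * t) * K t)%C
    (fun t => u t * cis (- INR N * t) + z / r * (u t * cis (- INR (S N) * t) * K t))%C).
  2: { intros t.
       replace (cis (- INR (S N) * t)) with (cis (- INR N * t) * cis (- t))%C.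
       2: { rewrite <- cis_plus; f_equal; rewrite S_INR; ring. }
       rewrite (kernel_step t) at 1; ring. }
  assert (CK : forall t, continuous (fun t => u t * cis (- INR (S N) * t) * K t)%C t).
  { intros t; apply continuous_Cmult; [now apply continuous_mul_cis | apply continuous_cauchy_kernel]. }
  rewrite cmean_plus, cmean_scal.
  + fold (fcoef a u N); ring.
  + exact CK.
  + now apply continuous_mul_cis.
  + intros t; apply continuous_Cmult; [apply continuous_const | apply CK].
Qed.

Lemma kernel_tail (u : R -> C) (B : R) (N : nat) :
  (forall t, continuous u t) -> (forall t, Cmod (u t) <= B) ->
  Cmod (cmean a (fun t => u t * K t) - csum (fun n => fcoef a u n * (z / r) ^ n) N)%C
  <= B * (r / (r - Cmod z)) * (Cmod z / r) ^ N.
Proof.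
intros Hu HB.
rewrite (kernel_sum u N Hu).
match goal with |- Cmod (?s + ?x - ?s)%C <= _ => replace (s + x - s)%C with x by ring end.
rewrite Cmod_mult, Cmod_pow, Cmod_div, Cmod_R, Rabs_pos_eq; try lra.
2: { intros E; apply RtoC_inj in E; lra. }
rewrite Rmult_comm; apply Rmult_le_compat_r.
{ apply pow_le, Rdiv_le_0_compat; [apply Cmod_ge_0 | exact r0]. }
assert (CK : forall t, continuous (fun t => u t * cis (- INR N * t) * K t)%C t).
{ intros t; apply continuous_Cmult; [now apply continuous_mul_cis | apply continuous_cauchy_kernel]. }
eapply Rle_trans; [apply Cmod_cmean, CK |].
rewrite <- (rmean_const a (B * (r / (r - Cmod z)))); apply rmean_le.
- intros t; apply continuous_Cmod, CK.
- intros t; apply continuous_const.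
- intros t; rewrite !Cmod_mult, Cmod_cis, Rmult_1_r.
  apply Rmult_le_compat; try apply Cmod_ge_0; [apply HB | apply Cmod_cauchy_kernel].
Qed.

Lemma ratio_lt_1 : 0 <= Cmod z / r < 1.
Proof.
split; [apply Rdiv_le_0_compat; [apply Cmod_ge_0 | exact r0] |].
apply div_lt_1; lra.
Qed.

(** The expansion of the kernel against the constant 1, of which only the coefficient of index 0
    survives; partial sums are taken of length at least one so as to contain it. *)
Lemma cmean_cauchy_kernel : cmean a K = 1%C.
Proof.
assert (E : forall N, csum (fun n => fcoef a (fun _ => 1%C) n * (z / r) ^ n)%C (S N) = 1%C).
{ assert (F : forall n, fcoef a (fun _ => 1%C) n = if Nat.eq_dec 0 n then 1%C else 0%C).
  { intros n; rewrite <- (fcoef_cis a 0 n); apply cmean_ext; intros t.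
    simpl (INR 0); rewrite Rmult_0_l, cis_0; reflexivity. }
  induction N as [| N IH].
  - simpl; rewrite F; simpl; ring.
  - change (csum (fun n => fcoef a (fun _ => 1%C) n * (z / r) ^ n)%C (S N)
       + fcoef a (fun _ => 1%C) (S N) * (z / r) ^ (S N) = 1)%C.
    rewrite IH, F; destruct (Nat.eq_dec 0 (S N)); [lia | ring]. }
assert (L : Cmod (cmean a K - 1)%C <= 0).
{ apply (le_pow_limit _ _ (Cmod z / r) (1 * (r / (r - Cmod z))) 1 ratio_lt_1).
  intros N HN; rewrite Rplus_0_l.
  destruct N as [| N]; [lia |].
  assert (T := kernel_tail (fun _ => 1%C) 1 (S N)).
  rewrite E, (cmean_ext a _ K) in T by (intros; ring).
  apply T; [intros; apply continuous_const | intros; rewrite Cmod_1; lra]. }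
assert (P := Cmod_ge_0 (cmean a K - 1)%C).
assert (Z : (cmean a K - 1)%C = 0%C) by (apply Cmod_eq_0; lra).
replace (cmean a K) with ((cmean a K - 1) + 1)%C by ring; rewrite Z; ring.
Qed.

End Kernel.

(** * Cauchy's formula and expansions on circles *)

Lemma circle_continuous (f : C -> C) (r : R) :
  (forall z, Cmod z < 1 -> continuous f z) -> 0 <= r < 1 ->
  forall t, continuous (fun t => f (r * cis t)%C) t.
Proof.
intros Hf Hr t; apply (continuous_comp (fun t => r * cis t)%C f); [apply continuous_polar |].
apply Hf; rewrite Cmod_polar; lra.
Qed.

Lemma cauchy_formula (f f' : C -> C) (a r : R) (z : C) :
  holoC1 f f' -> Cmod z < r -> r < 1 ->
  f z = cmean a (fun t => f (r * cis t) * (r * cis t / (r * cis t - z)))%C.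
Proof.
intros Hf Hz Hr.
rewrite <- (cauchy_homotopy f f' a r z Hf Hz Hr), cmean_scal.
- rewrite cmean_cauchy_kernel by exact Hz; ring.
- intros t; now apply continuous_cauchy_kernel.
Qed.

Lemma periodic_bounded (u : R -> R) :
  (forall t, continuous u t) -> (forall t, u (t + 2 * PI) = u t) ->
  exists B, 0 <= B /\ forall t, u t <= B.
Proof.
intros Hu Hp; assert (P := two_PI_pos).
destruct (continuity_ab_maj u 0 (2 * PI)) as [M [HM _]]; [lra | |].
{ intros t _; apply continuity_pt_filterlim, Hu. }
exists (Rmax 0 (u M)); split; [apply Rmax_l |].
intros t.
assert (E : forall n t, u (t + INR n * (2 * PI)) = u t).
{ induction n as [| n IH]; intros s; [simpl; f_equal; ring |].
  rewrite S_INR; replace (s + (INR n + 1) * (2 * PI)) with (s + INR n * (2 * PI) + 2 * PI) by ring.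
  now rewrite Hp. }
assert (Ez : forall (k : Z) s, u (s + IZR k * (2 * PI)) = u s).
{ intros k s; destruct (Z.le_gt_cases 0 k).
  - rewrite <- (E (Z.to_nat k) s), INR_IZR_INZ, Z2Nat.id by lia; reflexivity.
  - rewrite <- (E (Z.to_nat (- k)) (s + IZR k * (2 * PI))), INR_IZR_INZ, Z2Nat.id, opp_IZR by lia.
    f_equal; ring. }
destruct (archimed (t / (2 * PI))) as [A1 A2].
set (k := up (t / (2 * PI))) in *.
(* [up] exceeds its argument by at most 1, so a shift by 1 - k periods brings t into [0, 2 PI]. *)
rewrite <- (Ez (1 - k)%Z t).
eapply Rle_trans; [apply HM | apply Rmax_r].
rewrite minus_IZR.
assert (T : t = t / (2 * PI) * (2 * PI)) by (field; lra).
set (x := t / (2 * PI)) in *. rewrite T. split; nra.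
Qed.

Lemma circle_bounded (f : C -> C) (r : R) :
  (forall z, Cmod z < 1 -> continuous f z) -> 0 <= r < 1 ->
  exists B, 0 <= B /\ forall t, Cmod (f (r * cis t)%C) <= B.
Proof.
intros Hf Hr; apply (periodic_bounded (fun t => Cmod (f (r * cis t)%C))).
- intros t; apply continuous_Cmod, (circle_continuous f r Hf Hr).
- intros t; now rewrite polar_2PI.
Qed.

(** Taylor coefficients expressed by Fourier coefficients on every circle about 0, for every choice
    of period; no power series is involved. *)
Definition has_coef (f : C -> C) (b : nat -> C) : Prop :=
  forall a r n, 0 < r < 1 -> fcoef a (fun t => f (r * cis t)%C) n = (b n * r ^ n)%C.

Lemma cis_pow (n : nat) (t : R) : (cis t ^ n)%C = cis (INR n * t).
Proof.
induction n as [| n IH].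
- simpl; rewrite Rmult_0_l, cis_0; reflexivity.
- rewrite Cpow_S, IH, <- cis_plus, S_INR; f_equal; ring.
Qed.

(** Cauchy's formula over the circle of radius r, with its kernel expanded, approximates f uniformly
    on the smaller circle of radius s. *)
Lemma circle_expansion (f f' : C -> C) (a r s : R) :
  holoC1 f f' -> 0 < s < r -> r < 1 -> exists B, forall N t,
  Cmod (f (s * cis t) - tpoly (fun n => fcoef a (fun t => f (r * cis t)%C) n * (s / r)%R ^ n) N t)%C
  <= B * (s / r) ^ N.
Proof.
intros Hf Hs Hr.
assert (Cf : forall z, Cmod z < 1 -> continuous f z) by (intros; now apply (holoC1_continuous f f')).
destruct (circle_bounded f r Cf ltac:(lra)) as [B [B0 HB]].
exists (B * (r / (r - s))); intros N t.
assert (Hz : Cmod (s * cis t)%C < r) by (rewrite Cmod_polar; lra).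
assert (T := kernel_tail a r (s * cis t)%C Hz (fun t => f (r * cis t)%C) B N
   (circle_continuous f r Cf ltac:(lra)) HB).
cbv beta in T; rewrite <- (cauchy_formula f f' a r _ Hf Hz Hr), Cmod_polar in T by lra.
eapply Rle_trans; [right | exact T].
f_equal; f_equal; unfold tpoly.
assert (R0 : RtoC r <> 0%C) by (intros E; apply RtoC_inj in E; lra).
clear T; induction N as [| N IH]; [reflexivity |].
rewrite !csum_S; cbv beta; rewrite IH, <- cis_pow, RtoC_div by lra.
replace (s * cis t / r)%C with (s / r * cis t)%C by (field; exact R0).
rewrite Cpow_mult_l; ring.
Qed.

(** The approximating polynomials have the right-hand side as their coefficient of index n as soon
    as N > n, and a coefficient is bounded by the supremum norm, so the uniform error passes to
    it. *)
Lemma fcoef_radius (f f' : C -> C) (a a' r s : R) (n : nat) :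
  holoC1 f f' -> 0 < s < r -> r < 1 ->
  fcoef a' (fun t => f (s * cis t)%C) n = (fcoef a (fun t => f (r * cis t)%C) n * (s / r)%R ^ n)%C.
Proof.
intros Hf Hs Hr.
assert (Cf : forall z, Cmod z < 1 -> continuous f z) by (intros; now apply (holoC1_continuous f f')).
destruct (circle_expansion f f' a r s Hf Hs Hr) as [B HB].
set (d := fun n => (fcoef a (fun t => f (r * cis t)%C) n * (s / r)%R ^ n)%C) in *.
change (fcoef a' (fun t => f (s * cis t)%C) n = d n).
assert (Hq : 0 <= s / r < 1).
{ split; [apply Rdiv_le_0_compat; lra | apply div_lt_1; lra]. }
assert (L : Cmod (fcoef a' (fun t => f (s * cis t)%C) n - d n)%C <= 0).
{ apply (le_pow_limit _ _ (s / r) B (S n) Hq); intros N HN; rewrite Rplus_0_l.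
  assert (Cs := circle_continuous f s Cf ltac:(lra)).
  assert (Ct : forall t, continuous (tpoly d N) t) by (intros; apply continuous_tpoly).
  assert (E : fcoef a' (fun t => f (s * cis t) - tpoly d N t)%C n
     = (fcoef a' (fun t => f (s * cis t)%C) n - d n)%C).
  { unfold Cminus at 1.
    replace (fcoef a' (fun t => f (s * cis t) + - tpoly d N t)%C n)
      with (fcoef a' (fun t => f (s * cis t) + (- (1)) * tpoly d N t)%C n)
      by (apply cmean_ext; intros; ring).
    rewrite fcoef_plus, fcoef_scal, fcoef_tpoly; auto.
    - destruct (lt_dec n N); [ring | lia].
    - intros t; apply continuous_Cmult; [apply continuous_const | auto]. }
  rewrite <- E; apply Cmod_fcoef.
  - intros t; now apply continuous_Cminus.
  - intros t; apply HB. }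
assert (P := Cmod_ge_0 (fcoef a' (fun t => f (s * cis t)%C) n - d n)%C).
assert (Z : (fcoef a' (fun t => f (s * cis t)%C) n - d n)%C = 0%C) by (apply Cmod_eq_0; lra).
replace (fcoef a' (fun t => f (s * cis t)%C) n)
  with ((fcoef a' (fun t => f (s * cis t)%C) n - d n) + d n)%C by ring.
rewrite Z; ring.
Qed.

Lemma has_coef_exists (f f' : C -> C) : holoC1 f f' -> exists b, has_coef f b.
Proof.
intros Hf.
exists (fun n => fcoef 0 (fun t => f ((1 / 2)%R * cis t)%C) n * 2 ^ n)%C.
intros a r n Hr.
(* Radii can only be compared with a strictly larger one, so r and 1/2 are both compared with a
   third radius. *)
set (s := (1 + Rmax r (1 / 2)) / 2).
assert (X := Rmax_l r (1 / 2)); assert (Y := Rmax_r r (1 / 2)).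
assert (Z : Rmax r (1 / 2) < 1) by (apply Rmax_lub_lt; lra).
assert (Hs : r < s /\ 1 / 2 < s /\ s < 1) by (unfold s; lra).
rewrite (fcoef_radius f f' 0 a s r n Hf ltac:(lra) ltac:(lra)).
rewrite (fcoef_radius f f' 0 0 s (1 / 2) n Hf ltac:(lra) ltac:(lra)).
rewrite <- !Cmult_assoc; f_equal.
rewrite <- !RtoC_pow, <- RtoC_mult, <- RtoC_mult, <- !Rpow_mult_distr.
f_equal; f_equal; field; lra.
Qed.

Lemma has_coef_derive (f f' : C -> C) (b : nat -> C) :
  holoC1 f f' -> has_coef f b -> has_coef f' (fun n => INR (S n) * b (S n))%C.
Proof.
intros Hf Hb a r n Hr.
assert (Cf := circle_continuous f r (fun z => holoC1_continuous f f' z Hf) ltac:(lra)).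
assert (Cf' := circle_continuous f' r (proj2 Hf) ltac:(lra)).
assert (C1 := continuous_mul_cis _ (- INR n) Cf').
assert (C2 := continuous_mul_cis _ (- INR (S n)) Cf).
assert (C3 : forall t, continuous (fun t => Ci * r * (f' (r * cis t) * cis (- INR n * t)))%C t).
{ intros t; apply continuous_Cmult; [apply continuous_const | apply C1]. }
assert (C4 : forall t, continuous (fun t => (- Ci * INR (S n)) * (f (r * cis t) * cis (- INR (S n) * t)))%C t).
{ intros t; apply continuous_Cmult; [apply continuous_const | apply C2]. }
(* Integration by parts: the integrand is the derivative of f(r e^(it)) e^(-i(n+1)t). The frequency
   is n + 1 because differentiating f along the circle brings out a factor e^(it). *)
assert (D : cmean a (fun t => Ci * r * (f' (r * cis t) * cis (- INR n * t))
   + (- Ci * INR (S n)) * (f (r * cis t) * cis (- INR (S n) * t)))%C = 0%C).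
{ apply (cmean_derive a (fun t => f (r * cis t) * cis (- INR (S n) * t))%C).
  - intros t.
    replace (Ci * r * (f' (r * cis t) * cis (- INR n * t))
       + - Ci * INR (S n) * (f (r * cis t) * cis (- INR (S n) * t)))%C
    with ((f' (r * cis t) * (Ci * (r * cis t))) * cis (- INR (S n) * t)
       + f (r * cis t) * (Ci * (- INR (S n))%R * cis (- INR (S n) * t)))%C.
    2: { replace (cis (- INR n * t)) with (cis t * cis (- INR (S n) * t))%C.
         2: { rewrite <- cis_plus; f_equal; rewrite S_INR; ring. }
         rewrite RtoC_opp; ring. }
    apply (cderive_mult (fun t => f (r * cis t)%C) (fun t => cis (- INR (S n) * t))).
    + apply (cdiff_comp_curve f (fun t => r * cis t)%C); [| apply cderive_polar].
      apply (proj1 Hf); rewrite Cmod_polar; lra.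
    + apply cderive_cis.
  - intros t; now apply continuous_Cplus.
  - rewrite polar_2PI; f_equal.
    rewrite <- (cis_2PI (S n)); f_equal; ring. }
rewrite cmean_plus, !cmean_scal in D by assumption.
fold (fcoef a (fun t => f' (r * cis t)%C) n) in D.
fold (fcoef a (fun t => f (r * cis t)%C) (S n)) in D.
rewrite (Hb a r (S n) Hr), Cpow_S in D.
set (x := fcoef a (fun t => f' (r * cis t)%C) n) in *.
assert (R0 : RtoC r <> 0%C) by (intros E; apply RtoC_inj in E; lra).
assert (I0 : Ci <> 0%C) by (intros E; apply (f_equal snd) in E; simpl in E; lra).
replace x with (/ (Ci * r) * ((Ci * r * x + - Ci * INR (S n) * (b (S n) * (r * r ^ n)))
  + Ci * INR (S n) * (b (S n) * (r * r ^ n))))%C by (field; split; assumption).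
rewrite D; field; split; assumption.
Qed.

(** Expanding from a slightly larger circle, f differs on |z| = r by O(q^N) from the polynomial with
    coefficients b_n r^n, whose mean square is at most A by Parseval's identity. *)
Lemma parseval_le (f f' : C -> C) (b : nat -> C) (a r A : R) :
  holoC1 f f' -> has_coef f b -> 0 < r < 1 ->
  (forall N, rsum (fun n => Cmod (b n) ^ 2) N <= A) ->
  rmean a (fun t => Cmod (f (r * cis t)%C) ^ 2) <= A.
Proof.
intros Hf Hb Hr HA.
set (s := (1 + r) / 2).
assert (Hs : r < s < 1) by (unfold s; lra).
destruct (circle_expansion f f' 0 s r Hf ltac:(lra) ltac:(lra)) as [B HB].
assert (Hq : 0 <= r / s < 1).
{ split; [apply Rdiv_le_0_compat; lra | apply div_lt_1; lra]. }
set (q := r / s) in *.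
set (d := fun n => (fcoef 0 (fun t => f (s * cis t)%C) n * q ^ n)%C) in *.
assert (Hd : forall n, Cmod (d n) ^ 2 <= Cmod (b n) ^ 2).
{ intros n; unfold d; rewrite (Hb 0 s n ltac:(lra)), !Cmod_mult, !Cmod_pow, !Cmod_R.
  rewrite !Rabs_pos_eq by lra.
  rewrite Rmult_assoc, <- Rpow_mult_distr.
  replace (s * q) with r by (unfold q; field; lra).
  assert (P := Cmod_ge_0 (b n)); assert (P1 := pow_le r n ltac:(lra)).
  assert (P2 : r ^ n <= 1) by (rewrite <- (pow1 n); apply pow_incr; lra).
  apply pow_incr; split; nra. }
assert (Cf := circle_continuous f r (fun z => holoC1_continuous f f' z Hf) ltac:(lra)).
set (u := fun t => f (r * cis t)%C) in *.
assert (Cu := fun t => continuous_Cmod u t (Cf t)).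
assert (B0 : 0 <= B).
{ assert (X := HB O 0); simpl in X; rewrite Rmult_1_r in X.
  eapply Rle_trans; [apply Cmod_ge_0 | exact X]. }
apply (le_pow_limit _ _ q (B * (2 * rmean a (fun t => Cmod (u t)) + B)) 0 Hq).
intros N _.
assert (Cp : forall t, continuous (tpoly d N) t) by (intros; apply continuous_tpoly).
apply Rle_trans with (rmean a (fun t => Cmod (tpoly d N t) ^ 2 +
   (B * q ^ N) * (2 * Cmod (u t) + B))).
- assert (C2 : forall t, continuous (fun t => B * q ^ N * (2 * Cmod (u t) + B)) t).
  { intros t; apply continuous_Rmult; [apply continuous_const |].
    apply (continuous_plus (V := R_NormedModule)); [| apply continuous_const].
    apply continuous_Rmult; [apply continuous_const | apply Cu]. }
  apply rmean_le.
  + now apply continuous_Cmod_sq.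
  + intros t; apply (continuous_plus (V := R_NormedModule)); [now apply continuous_Cmod_sq | apply C2].
  + intros t.
    change (f (r * cis t)%C) with (u t).
    assert (E := HB N t); change (f (r * cis t)%C) with (u t) in E.
    set (p := tpoly d N t) in *.
    assert (T1 := Cmod_triangle (u t - p)%C p).
    replace (u t - p + p)%C with (u t) in T1 by ring.
    assert (T2 := Cmod_triangle (p - u t)%C (u t)).
    replace (p - u t + u t)%C with p in T2 by ring.
    assert (T3 : Cmod (p - u t)%C = Cmod (u t - p)%C).
    { rewrite <- Cmod_opp; f_equal; ring. }
    rewrite T3 in T2.
    set (e := Cmod (u t - p)%C) in *.
    assert (e0 : 0 <= e) by apply Cmod_ge_0.
    assert (p0 := Cmod_ge_0 p); assert (u0 := Cmod_ge_0 (u t)).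
    assert (Q : 0 <= q ^ N <= 1).
    { split; [apply pow_le; lra | rewrite <- (pow1 N); apply pow_incr; lra]. }
    assert (eB : e <= B) by nra.
    apply Rle_trans with (Cmod p ^ 2 + e * (2 * Cmod (u t) + e)).
    { assert (X1 : (Cmod (u t) - Cmod p) * (Cmod (u t) + Cmod p) <= e * (Cmod (u t) + Cmod p))
        by (apply Rmult_le_compat_r; lra).
      assert (X2 : e * (Cmod (u t) + Cmod p) <= e * (2 * Cmod (u t) + e))
        by (apply Rmult_le_compat_l; lra).
      replace (Cmod (u t) ^ 2) with ((Cmod (u t) - Cmod p) * (Cmod (u t) + Cmod p) + Cmod p ^ 2) by ring.
      lra. }
    apply Rplus_le_compat_l, Rmult_le_compat; lra.
- assert (C1 : forall t, continuous (fun t => 2 * Cmod (u t)) t).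
  { intros t; apply continuous_Rmult; [apply continuous_const | apply Cu]. }
  assert (C2 : forall t, continuous (fun t => 2 * Cmod (u t) + B) t).
  { intros t; apply (continuous_plus (V := R_NormedModule)); [apply C1 | apply continuous_const]. }
  rewrite rmean_plus, rmean_scal, rmean_plus, rmean_scal, rmean_const, tpoly_parseval; auto.
  + assert (X := rsum_le _ _ N (fun n _ => Hd n)); assert (Y := HA N); simpl in *; lra.
  + intros; apply continuous_const.
  + now apply continuous_Cmod_sq.
  + intros t; apply continuous_Rmult; [apply continuous_const | apply C2].
Qed.

Lemma fcoef_pairing (a : R) (u : R -> C) (d : nat -> C) (N : nat) :
  (forall t, continuous u t) ->
  cmean a (fun t => u t * Cconj (tpoly d N t))%C = csum (fun n => Cconj (d n) * fcoef a u n)%C N.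
Proof.
intros Hu; induction N as [| N IH].
- rewrite <- (cmean_const a 0%C) at 1; apply cmean_ext; intros t; unfold tpoly; simpl.
  apply injective_projections; simpl; ring.
- rewrite csum_S; cbv beta; rewrite <- IH; unfold fcoef.
  rewrite <- cmean_scal by (now apply continuous_mul_cis).
  rewrite <- cmean_plus.
  + apply cmean_ext; intros t; unfold tpoly; rewrite csum_S; cbv beta.
    rewrite Cplus_conj, Cmult_conj, cis_conj.
    replace (- (INR N * t)) with (- INR N * t) by ring; ring.
  + intros t; apply continuous_Cmult; [apply Hu | apply continuous_Cconj, continuous_tpoly].
  + intros t; apply continuous_Cmult; [apply continuous_const | now apply continuous_mul_cis].
Qed.

(** The left side is the mean of f times the conjugate of its own partial sum. The power r^n occurs
    once, not twice, because only f is taken on the circle of radius r while the polynomial stays on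
    the unit circle. *)
Lemma pairing_lower_bound (f : C -> C) (b : nat -> C) (a r : R) (N : nat) :
  (forall z, Cmod z < 1 -> continuous f z) -> has_coef f b -> 0 < r < 1 ->
  rsum (fun n => Cmod (b n) ^ 2 * r ^ n) N <=
  rmean a (fun t => Cmod (f (r * cis t)%C) * Cmod (tpoly b N t)).
Proof.
intros Cf Hb Hr.
assert (Cu := circle_continuous f r Cf ltac:(lra)).
assert (E : cmean a (fun t => f (r * cis t) * Cconj (tpoly b N t))%C
   = RtoC (rsum (fun n => Cmod (b n) ^ 2 * r ^ n) N)).
{ rewrite (fcoef_pairing a (fun t => f (r * cis t)%C) b N Cu).
  induction N as [| N IH]; [reflexivity |].
  rewrite csum_S, rsum_S; cbv beta; rewrite IH, (Hb a r N Hr), RtoC_plus, RtoC_mult, <- RtoC_pow.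
  f_equal. change (Cmod (b N) * (Cmod (b N) * 1)) with (Cmod (b N) ^ 2).
  rewrite Cmod2_conj; ring. }
assert (Cc : forall t, continuous (fun t => f (r * cis t) * Cconj (tpoly b N t))%C t).
{ intros t; apply continuous_Cmult; [apply Cu | apply continuous_Cconj, continuous_tpoly]. }
assert (L : Cmod (cmean a (fun t => f (r * cis t) * Cconj (tpoly b N t))%C) <=
  rmean a (fun t => Cmod (f (r * cis t) * Cconj (tpoly b N t))%C)) by exact (Cmod_cmean a _ Cc).
rewrite E, Cmod_R in L.
eapply Rle_trans; [apply Rle_abs |].
eapply Rle_trans; [exact L | right].
apply rmean_ext; intros t; now rewrite Cmod_mult, Cmod_conj.
Qed.

(** * The amplifier of an arc *)

Definition is_holoC1 (f : C -> C) : Prop := exists f', holoC1 f f'.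

Lemma is_holoC1_const (c : C) : is_holoC1 (fun _ => c).
Proof.
exists (fun _ => 0%C); split; intros z _; [apply cdiff_const | apply continuous_const].
Qed.

Lemma is_holoC1_affine (p q : C) : is_holoC1 (fun z => p + q * z)%C.
Proof.
exists (fun _ => q); split; intros z _; [apply cdiff_affine | apply continuous_const].
Qed.

Lemma is_holoC1_plus (f g : C -> C) :
  is_holoC1 f -> is_holoC1 g -> is_holoC1 (fun z => f z + g z)%C.
Proof.
intros [f' [Hf Cf]] [g' [Hg Cg]].
exists (fun z => f' z + g' z)%C; split; intros z Hz.
- apply cdiff_plus; auto.
- apply continuous_Cplus; auto.
Qed.

Lemma is_holoC1_mult (f g : C -> C) :
  is_holoC1 f -> is_holoC1 g -> is_holoC1 (fun z => f z * g z)%C.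
Proof.
intros [f' Hf] [g' Hg].
exists (fun z => f' z * g z + f z * g' z)%C; split; intros z Hz.
- apply cdiff_mult; [now apply Hf | now apply Hg].
- apply continuous_Cplus; apply continuous_Cmult.
  + now apply Hf.
  + now apply (holoC1_continuous g g').
  + now apply (holoC1_continuous f f').
  + now apply Hg.
Qed.

Lemma is_holoC1_inv (f : C -> C) :
  (forall z, Cmod z < 1 -> f z <> 0%C) -> is_holoC1 f -> is_holoC1 (fun z => / f z)%C.
Proof.
intros H0 [f' Hf].
exists (fun z => - f' z * (/ f z * / f z))%C; split; intros z Hz.
- apply cdiff_inv; [now apply H0 | now apply Hf].
- assert (Ci : continuous (fun z => / f z)%C z).
  { apply continuous_Cinv; [now apply H0 | now apply (holoC1_continuous f f')]. }
  apply continuous_Cmult; [now apply continuous_Copp, Hf | now apply continuous_Cmult].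
Qed.

Lemma is_holoC1_pow (f : C -> C) (n : nat) :
  is_holoC1 f -> is_holoC1 (fun z => f z ^ n)%C.
Proof.
intros Hf; induction n as [| n IH]; simpl.
- apply is_holoC1_const.
- now apply is_holoC1_mult.
Qed.

Section Multiplier.

Variables (h c : R).
Hypothesis Hh : 0 < h < 1.

(* [mob] is the half-plane map [w |-> i h / (w + i h)] read through the Cayley
   transform that sends [cis c] to 0. On the circle Re s = |s|^2 for s = mob z,
   whence |1 + s + 2 s^2|^2 = 1 - Re s + 16 (Re s)^2, which is at most 1 as soon
   as Re s <= 1/16. *)
Definition mob (z : C) : C :=
  ((h + h * cis (- c) * z) * / ((1 + h)%R + - ((1 - h)%R * cis (- c)) * z))%C.

(** For Q = 1 + s + q s^2 the expansion of |Q|^2 on the circle has linear term (3 - 2 q) Re s, so q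
    must exceed 3/2. Where s is small on the circle it is nearly imaginary, and the negative s^2
    outweighs the gain from s; near the centre of the disk s is nearly positive, and both terms
    increase |Q|. *)
Definition amplifier (z : C) : C := (1 + (mob z + 2 * (mob z * mob z)))%C.

Let D (z : C) : C := ((1 + h)%R + - ((1 - h)%R * cis (- c)) * z)%C.

Lemma mob_den_bound (z : C) : Cmod z <= 1 -> 2 * h <= Cmod (D z).
Proof.
intros Hz; assert (T := Cmod_triangle (D z) ((1 - h)%R * cis (- c) * z)%C).
replace (D z + (1 - h)%R * cis (- c) * z)%C with (RtoC (1 + h)) in T by (unfold D; ring).
rewrite !Cmod_mult, Cmod_cis, !Cmod_R, !Rabs_pos_eq in T by lra. nra.
Qed.

Lemma mob_den_neq (z : C) : Cmod z <= 1 -> D z <> 0%C.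
Proof.
intros Hz E; assert (B := mob_den_bound z Hz); rewrite E, Cmod_0 in B; lra.
Qed.

Lemma continuous_amplifier (z : C) : Cmod z <= 1 -> continuous amplifier z.
Proof.
intros Hz.
assert (Cm : continuous mob z).
{ apply continuous_Cmult.
  - apply (cdiff_continuous _ _ _ (cdiff_affine h (h * cis (- c))%C z)).
  - apply continuous_Cinv; [now apply mob_den_neq |].
    apply (cdiff_continuous _ _ _ (cdiff_affine (1 + h)%R (- ((1 - h)%R * cis (- c)))%C z)). }
apply continuous_Cplus; [apply continuous_const |].
apply continuous_Cplus; [exact Cm |].
apply continuous_Cmult; [apply continuous_const | now apply continuous_Cmult].
Qed.

Lemma is_holoC1_amplifier : is_holoC1 amplifier.
Proof.
assert (Cm : is_holoC1 mob).
{ apply is_holoC1_mult; [apply is_holoC1_affine |].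
  apply is_holoC1_inv; [| apply is_holoC1_affine].
  intros z Hz; apply mob_den_neq; lra. }
apply is_holoC1_plus; [apply is_holoC1_const |].
apply is_holoC1_plus; [exact Cm |].
apply is_holoC1_mult; [apply is_holoC1_const | now apply is_holoC1_mult].
Qed.

Lemma amplifier_le_4 (z : C) : Cmod z <= 1 -> Cmod (amplifier z) <= 4.
Proof.
intros Hz.
assert (M : Cmod (mob z) <= 1).
{ unfold mob; rewrite Cmod_mult; fold (D z).
  assert (B := mob_den_bound z Hz); assert (N := mob_den_neq z Hz).
  rewrite Cmod_inv by exact N.
  assert (T := Cmod_triangle h (h * cis (- c) * z)%C).
  rewrite !Cmod_mult, Cmod_cis, !Cmod_R, !Rabs_pos_eq in T by lra.
  apply (Rmult_le_reg_r (Cmod (D z))); [lra |].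
  rewrite Rmult_assoc, Rinv_l by lra. nra. }
assert (P := Cmod_ge_0 (mob z)).
unfold amplifier.
eapply Rle_trans; [apply Cmod_triangle |].
eapply Rle_trans; [apply Rplus_le_compat_l, Cmod_triangle |].
rewrite !Cmod_mult, Cmod_1, Cmod_R, Rabs_pos_eq by lra. nra.
Qed.

(** With w = tan(t/2) one has s = i h / (w + i h), of real part h^2 / (w^2 + h^2) and imaginary part
    h w / (w^2 + h^2). Multiplying numerators and denominators by 2 cos(t/2)^2 removes the pole at t
    = PI. *)
Lemma mob_circle (t : R) :
  let x := h ^ 2 * (1 + cos t) / ((1 - cos t) + h ^ 2 * (1 + cos t)) in
  exists y, mob (cis (c + t)) = (x, y) /\ x = x ^ 2 + y ^ 2.
Proof.
intros x.
set (E := (1 - cos t) + h ^ 2 * (1 + cos t)) in *.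
assert (S2 : sin t ^ 2 = 1 - cos t ^ 2).
{ assert (X := sin2_cos2 t); unfold Rsqr in X; simpl; lra. }
assert (B := COS_bound t).
assert (E0 : 0 < E) by (unfold E; destruct (Req_dec (cos t) 1) as [-> |]; nra).
exists (h * sin t / E).
assert (Hz : Cmod (cis (c + t)) <= 1) by (rewrite Cmod_cis; lra).
assert (N := mob_den_neq _ Hz).
assert (Z : (cis (- c) * cis (c + t))%C = cis t) by (rewrite <- cis_plus; f_equal; ring).
split.
- assert (K : ((x, (h * sin t / E)%R) * D (cis (c + t)))%C = (h + h * cis (- c) * cis (c + t))%C).
  { unfold D.
    replace (- ((1 - h)%R * cis (- c)) * cis (c + t))%C with (- ((1 - h)%R * cis t))%C by (rewrite <- Z; ring).
    replace (h + h * cis (- c) * cis (c + t))%C with (h + h * cis t)%C by (rewrite <- Z; ring).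
    apply injective_projections; unfold x; simpl.
    - apply (Rmult_eq_reg_r E); [| lra].
      match goal with |- ?l * E = _ => transitivity
        (h ^ 2 * (1 + cos t) * ((1 + h) - (1 - h) * cos t) + h * (1 - h) * sin t ^ 2) end;
      [field; lra | rewrite S2; unfold E; ring].
    - field_simplify_eq; [| lra]; unfold E; ring. }
  unfold mob; fold (D (cis (c + t))); rewrite <- K.
  field; exact N.
- unfold x; apply (Rmult_eq_reg_r (E ^ 2)); [| apply pow_nonzero; lra].
  transitivity (h ^ 2 * (1 + cos t) * E); [field; lra |].
  transitivity ((h ^ 2 * (1 + cos t)) ^ 2 + h ^ 2 * sin t ^ 2); [| field; lra].
  rewrite S2; unfold E; ring.
Qed.

(** The hypothesis is Re s <= 1/16 with the denominator cleared. *)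
Lemma amplifier_circle_le_1 (t : R) :
  15 * h ^ 2 * (1 + cos t) <= 1 - cos t -> Cmod (amplifier (cis (c + t))) <= 1.
Proof.
intros Ht; destruct (mob_circle t) as [y [E Q]].
set (x := h ^ 2 * (1 + cos t) / ((1 - cos t) + h ^ 2 * (1 + cos t))) in *.
assert (B := COS_bound t).
assert (x0 : 0 <= x <= 1 / 16).
{ assert (E0 : 0 < (1 - cos t) + h ^ 2 * (1 + cos t)) by (destruct (Req_dec (cos t) 1) as [-> |]; nra).
  unfold x; split.
  - apply Rdiv_le_0_compat; [| exact E0]. apply Rmult_le_pos; [apply pow2_ge_0 | lra].
  - apply (Rmult_le_reg_r ((1 - cos t) + h ^ 2 * (1 + cos t))); [exact E0 |].
    unfold Rdiv at 1; rewrite Rmult_assoc, Rinv_l by lra. lra. }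
assert (S : Cmod (amplifier (cis (c + t))) ^ 2 = 1 - x + 16 * x ^ 2).
{ unfold amplifier; rewrite E, Cmod2_alt; unfold Re, Im; simpl.
  assert (Y : y * y = x - x * x) by (simpl in Q; lra).
  match goal with |- ?l = _ => transitivity
    ((1 + x + 2 * (x * x - y * y)) ^ 2 + (y * y) * (1 + 4 * x) ^ 2) end; [ring |].
  rewrite Y; ring. }
assert (P := Cmod_ge_0 (amplifier (cis (c + t)))). nra.
Qed.

(** The radius 1/5 gives |D z| >= 4/5, hence s = s(0) (1 + e) with |e| <= 1/2. So s stays in the
    sector |Im s| <= Re s, where Re s^2 >= 0, and Re Q >= 1 + Re s. Finally s(0) = h / (1 + h) is at
    least h / 2, and 1 + Re e at least 1/2. *)
Lemma amplifier_lower (z : C) : Cmod z <= 1 / 5 -> 1 + h / 4 <= Cmod (amplifier z).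
Proof.
intros Hz.
assert (N : D z <> 0%C) by (apply mob_den_neq; lra).
set (e := (2 * cis (- c) * z * / D z)%C).
assert (He : Cmod e <= 1 / 2).
{ unfold e; rewrite !Cmod_mult, Cmod_inv, Cmod_cis, Cmod_R, Rabs_pos_eq by (exact N || lra).
  assert (T := Cmod_triangle (D z) ((1 - h)%R * cis (- c) * z)%C).
  replace (D z + (1 - h)%R * cis (- c) * z)%C with (RtoC (1 + h)) in T by (unfold D; ring).
  rewrite !Cmod_mult, Cmod_cis, !Cmod_R, !Rabs_pos_eq in T by lra.
  assert (Pz := Cmod_ge_0 z).
  assert (B : 4 / 5 <= Cmod (D z)) by nra.
  apply (Rmult_le_reg_r (Cmod (D z))); [lra |].
  rewrite Rmult_assoc, Rinv_l by lra. lra. }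
set (k := h / (1 + h)).
assert (Hk : h / 2 <= k <= 1).
{ unfold k; split; apply (Rmult_le_reg_r (1 + h)); try lra;
  unfold Rdiv; rewrite ?Rmult_assoc, ?Rinv_l; nra. }
assert (E : mob z = (k * (1 + e))%C).
{ unfold mob; fold (D z).
  replace (RtoC k) with (h / (1 + h))%C by (unfold k; rewrite RtoC_div, RtoC_plus; [reflexivity | lra]).
  assert (H1 : (1 + h)%C <> 0%C).
  { rewrite <- RtoC_plus; intros X; apply RtoC_inj in X; lra. }
  unfold e.
  replace (h / (1 + h) * (1 + 2 * cis (- c) * z * / D z))%C
    with ((h / (1 + h) * (D z + 2 * cis (- c) * z)) * / D z)%C by (field; split; assumption).
  f_equal; unfold D; rewrite RtoC_plus, RtoC_minus; field; exact H1. }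
assert (E1 := abs_fst_le e); assert (E2 := abs_snd_le e).
apply Rabs_le_between in E1; apply Rabs_le_between in E2.
eapply Rle_trans; [| eapply Rle_trans; [apply Rle_abs | apply abs_fst_le]].
unfold amplifier; rewrite E; destruct e as [e1 e2]; simpl in *.
match goal with |- _ <= ?l => replace l with
  (1 + k * (1 + e1) + 2 * k ^ 2 * ((1 + e1) ^ 2 - e2 ^ 2)) by ring end.
assert (X1 : 0 <= (1 + e1) ^ 2 - e2 ^ 2) by nra.
assert (X2 : 0 <= 2 * k ^ 2 * ((1 + e1) ^ 2 - e2 ^ 2)).
{ apply Rmult_le_pos; [| exact X1]. assert (Y := pow2_ge_0 k); lra. }
nra.
Qed.

(** Cauchy's formula for f Q^M; the kernel is at most (4/5) / (4/5 - 1/5) = 4/3. The two moduli are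
    kept apart so that |Q|^M can serve as a weight for the boundary values of f. *)
Lemma interior_bound (f : C -> C) (a r : R) (M : nat) (z : C) :
  is_holoC1 f -> Cmod z <= 1 / 5 -> 4 / 5 <= r < 1 ->
  Cmod (f z) * (1 + h / 4) ^ M <=
  4 / 3 * rmean a (fun t => Cmod (f (r * cis t)%C) * Cmod (amplifier (r * cis t)%C) ^ M).
Proof.
intros Hf Hz Hr.
destruct (is_holoC1_mult f (fun z => amplifier z ^ M)%C Hf (is_holoC1_pow amplifier M is_holoC1_amplifier)) as [g' Hg].
assert (Hzr : Cmod z < r) by lra.
assert (Cg := circle_continuous _ r (fun z => holoC1_continuous _ g' z Hg) ltac:(lra)).
assert (F := cauchy_formula _ g' a r z Hg Hzr ltac:(lra)).
assert (CK := fun t => continuous_Cmult _ _ t (Cg t) (continuous_cauchy_kernel r z Hzr t)).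
apply Rle_trans with (Cmod (f z * amplifier z ^ M)%C).
{ rewrite Cmod_mult, Cmod_pow; apply Rmult_le_compat_l; [apply Cmod_ge_0 |].
  apply pow_incr; split; [lra | now apply amplifier_lower]. }
rewrite F.
eapply Rle_trans; [apply Cmod_cmean, CK |].
rewrite <- rmean_scal.
2: { intros t. apply (continuous_ext (fun t => Cmod (f (r * cis t) * amplifier (r * cis t) ^ M)%C)).
     - intros u; now rewrite Cmod_mult, Cmod_pow.
     - apply continuous_Cmod, Cg. }
apply rmean_le.
- intros t; apply continuous_Cmod, CK.
- intros t; apply continuous_Rmult; [apply continuous_const |].
  apply (continuous_ext (fun t => Cmod (f (r * cis t) * amplifier (r * cis t) ^ M)%C)).
  + intros u; now rewrite Cmod_mult, Cmod_pow.
  + apply continuous_Cmod, Cg.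
- intros t; rewrite !(Cmod_mult _ (_ / _)%C), Cmod_mult, Cmod_pow, Rmult_comm.
  apply Rmult_le_compat_r.
  { apply Rmult_le_pos; [apply Cmod_ge_0 | apply pow_le, Cmod_ge_0]. }
  eapply Rle_trans; [now apply Cmod_cauchy_kernel |].
  assert (X := Cmod_ge_0 z).
  apply (Rmult_le_reg_r (r - Cmod z)); [lra |].
  unfold Rdiv at 1; rewrite Rmult_assoc, Rinv_l by lra. lra.
Qed.

End Multiplier.

(** * Size of the amplifier off the arc, and Cauchy's estimate *)

Lemma sin_half_lower (lam : R) : 0 <= lam <= 1 -> lam / 2 <= sin (PI * lam / 2).
Proof.
intros Hl; assert (P1 := PI_4); assert (P2 := PI2_3_2); assert (P3 := PI_RGT_0).
assert (X : 0 <= PI * lam / 2 <= 2) by (split; nra).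
destruct (pre_sin_bound (PI * lam / 2) 0 ltac:(lra) ltac:(lra)) as [L _].
eapply Rle_trans; [| exact L].
unfold sin_approx, sin_term; simpl.
set (x := PI * lam / 2) in *.
assert (Y : 3 / 2 * lam <= x) by (unfold x; nra).
(* On [0, 2] this cubic is at least x / 3, and x is at least 3 lam / 2. *)
match goal with |- _ <= ?l => replace l with (x - x ^ 3 / 6) by field end.
nra.
Qed.

(** Origin of h = lam / 8: off the arc 1 - cos t >= lam^2 / 2, while the left side is at most 30 h^2
    = (30/64) lam^2. *)
Lemma off_arc_cos (lam t : R) : 0 < lam < 1 -> PI * lam <= t <= 2 * PI - PI * lam ->
  15 * (lam / 8) ^ 2 * (1 + cos t) <= 1 - cos t.
Proof.
intros Hl Ht; assert (P3 := PI_RGT_0).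
assert (L := sin_half_lower lam ltac:(lra)).
assert (C1 : cos (PI * lam) <= 1 - lam ^ 2 / 2).
{ replace (PI * lam) with (2 * (PI * lam / 2)) by field.
  rewrite cos_2a_sin; nra. }
assert (C2 : cos t <= cos (PI * lam)).
{ destruct (Rle_lt_dec t PI) as [A | A].
  - apply cos_decr_1; nra.
  - replace (cos t) with (cos (2 * PI - t)).
    + apply cos_decr_1; nra.
    + rewrite <- (cos_neg t), <- (cos_period (- t) 1); f_equal; simpl; ring. }
assert (B := COS_bound t). nra.
Qed.

Lemma amplifier_off_arc (a lam t : R) : 0 < lam < 1 ->
  a + 2 * PI * lam <= t <= a + 2 * PI ->
  Cmod (amplifier (lam / 8) (a + PI * lam) (cis t)) <= 1.
Proof.
intros Hl Ht.
replace t with ((a + PI * lam) + (t - (a + PI * lam))) by ring.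
apply amplifier_circle_le_1; [lra |].
apply off_arc_cos; [exact Hl | lra].
Qed.

Lemma coef_bound (f : C -> C) (b : nat -> C) (K : R) (n : nat) :
  (forall z, Cmod z < 1 -> continuous f z) -> has_coef f b ->
  (forall z, Cmod z <= 1 / 5 -> Cmod (f z) <= K) -> Cmod (b n) <= K * 5 ^ n.
Proof.
intros Cf Hb HK.
assert (E := Hb 0 (1 / 5) n ltac:(lra)).
assert (L : Cmod (fcoef 0 (fun t => f ((1 / 5)%R * cis t)%C) n) <= K).
{ apply Cmod_fcoef.
  - apply circle_continuous; [exact Cf | lra].
  - intros t; apply HK; rewrite Cmod_polar; lra. }
rewrite E, Cmod_mult, Cmod_pow, Cmod_R, Rabs_pos_eq in L by lra.
apply Rle_trans with ((Cmod (b n) * (1 / 5) ^ n) * 5 ^ n).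
- rewrite Rmult_assoc, <- Rpow_mult_distr.
  replace (1 / 5 * 5) with 1 by field. rewrite pow1; lra.
- apply Rmult_le_compat_r; [apply pow_le; lra | exact L].
Qed.

(** * Radial limits *)

(** The limit theorems for integrals concern sequences, so r -> 1 is sampled; the summand 2 starts
    the sequence at 1/2, inside (0, 1). *)
Definition rad_seq (n : nat) : R := 1 - / (INR n + 2).

Lemma rad_bounds (n : nat) : 0 < rad_seq n < 1.
Proof.
unfold rad_seq; assert (P := pos_INR n).
assert (I : 0 < / (INR n + 2) <= / 2).
{ split; [apply Rinv_0_lt_compat | apply Rinv_le_contravar]; lra. }
lra.
Qed.

Lemma rad_near (d : R) : 0 < d -> exists N, forall n, (N <= n)%nat -> 1 - d < rad_seq n.
Proof.
intros Hd; destruct (INR_unbounded (/ d)) as [N HN].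
exists N; intros n Hn; unfold rad_seq.
apply le_INR in Hn; assert (P : 0 < / d) by now apply Rinv_0_lt_compat.
assert (I : / (INR n + 2) < / / d) by (apply Rinv_lt_contravar; [apply Rmult_lt_0_compat |]; lra).
rewrite Rinv_inv in I; lra.
Qed.

(** A left limit in the shape of [radial_limit], so that boundary limits of f and limits of
    continuous weights can be multiplied before sampling along [rad_seq]. *)
Definition tends_at_1 (phi : R -> R) (l : R) : Prop :=
  forall eps, 0 < eps -> exists d, 0 < d /\
    forall r, 1 - d < r -> r < 1 -> Rabs (phi r - l) < eps.

Lemma tends_at_1_const (c : R) : tends_at_1 (fun _ => c) c.
Proof.
intros eps He; exists 1; split; [lra |]; intros; rewrite Rminus_diag, Rabs_R0; exact He.
Qed.

Lemma tends_at_1_continuous (phi : R -> R) : continuous phi 1 -> tends_at_1 phi (phi 1).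
Proof.
intros H eps He.
destruct (H _ (locally_ball (phi 1) (mkposreal eps He))) as [d Hd].
exists d; split; [apply cond_pos |].
intros r H1 H2; apply Hd.
change (Rabs (r - 1) < d); rewrite Rabs_left1; lra.
Qed.

Lemma tends_at_1_mult (phi psi : R -> R) (l m : R) :
  tends_at_1 phi l -> tends_at_1 psi m -> tends_at_1 (fun r => phi r * psi r) (l * m).
Proof.
intros H1 H2 eps He.
assert (L := Rabs_pos l); assert (M := Rabs_pos m).
assert (e1 : 0 < eps / 2 / (1 + Rabs m)) by (apply Rdiv_lt_0_compat; lra).
assert (e2 : 0 < Rmin 1 (eps / 2 / (1 + Rabs l))).
{ apply Rmin_pos; [lra | apply Rdiv_lt_0_compat; lra]. }
destruct (H1 _ e1) as [d1 [p1 K1]]; destruct (H2 _ e2) as [d2 [p2 K2]].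
exists (Rmin d1 d2); split; [now apply Rmin_pos |].
intros r A B; assert (X1 := Rmin_l d1 d2); assert (X2 := Rmin_r d1 d2).
specialize (K1 r ltac:(lra) B); specialize (K2 r ltac:(lra) B).
assert (Y1 := Rlt_le_trans _ _ _ K2 (Rmin_l _ _)).
assert (Y2 := Rlt_le_trans _ _ _ K2 (Rmin_r _ _)).
replace (phi r * psi r - l * m) with ((phi r - l) * psi r + l * (psi r - m)) by ring.
eapply Rle_lt_trans; [apply Rabs_triang |]; rewrite !Rabs_mult.
assert (Z : Rabs (psi r) <= 1 + Rabs m).
{ replace (psi r) with ((psi r - m) + m) by ring.
  eapply Rle_trans; [apply Rabs_triang |]; lra. }
apply Rle_lt_trans with (Rabs (phi r - l) * (1 + Rabs m) + Rabs l * (eps / 2 / (1 + Rabs l))).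
- apply Rplus_le_compat; apply Rmult_le_compat_l; try lra; apply Rabs_pos.
- assert (U1 : Rabs (phi r - l) * (1 + Rabs m) < eps / 2 / (1 + Rabs m) * (1 + Rabs m))
    by (apply Rmult_lt_compat_r; lra).
  replace (eps / 2 / (1 + Rabs m) * (1 + Rabs m)) with (eps / 2) in U1 by (field; lra).
  assert (U2 : Rabs l * (eps / 2 / (1 + Rabs l)) <= (1 + Rabs l) * (eps / 2 / (1 + Rabs l))).
  { apply Rmult_le_compat_r; [left; apply Rdiv_lt_0_compat |]; lra. }
  replace ((1 + Rabs l) * (eps / 2 / (1 + Rabs l))) with (eps / 2) in U2 by (field; lra).
  lra.
Qed.

Lemma continuous_radial (F : C -> R) (t : R) : continuous F (cis t) ->
  continuous (fun r : R => F (r * cis t)%C) 1.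
Proof.
intros H; apply (continuous_comp (fun r : R => r * cis t)%C F).
- apply continuous_Cmult; [apply continuous_RtoC, continuous_id | apply continuous_const].
- now rewrite Cmult_1_l.
Qed.

Lemma tends_at_1_pairing (d : nat -> R) (N : nat) :
  tends_at_1 (fun r => rsum (fun n => d n * r ^ n) N) (rsum d N).
Proof.
replace (rsum d N) with (rsum (fun n => d n * 1 ^ n) N).
2: { induction N as [| N IH]; simpl; [reflexivity | now rewrite IH, pow1, Rmult_1_r]. }
apply (tends_at_1_continuous (fun r => rsum (fun n => d n * r ^ n) N)).
induction N as [| N IH]; simpl; [apply continuous_const |].
apply (continuous_plus (V := R_NormedModule)); [exact IH |].
apply continuous_Rmult; [apply continuous_const |].
clear IH; induction N as [| N IH]; simpl; [apply continuous_const |].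
apply continuous_Rmult; [apply continuous_id | exact IH].
Qed.

Lemma polar_pair (r t : R) : (r * cos t, r * sin t) = (r * cis t)%C.
Proof. unfold cis; apply injective_projections; simpl; ring. Qed.

Lemma Rabs_Cmod_minus (x y : C) : Rabs (Cmod x - Cmod y) <= Cmod (x - y)%C.
Proof.
assert (T1 := Cmod_triangle (x - y)%C y); assert (T2 := Cmod_triangle (y - x)%C x).
replace (x - y + y)%C with x in T1 by ring; replace (y - x + x)%C with y in T2 by ring.
replace (y - x)%C with (- (x - y))%C in T2 by ring; rewrite Cmod_opp in T2.
apply Rabs_le; lra.
Qed.

(** * Inequalities used in the limit r -> 1 and in splitting the circle *)

Lemma RInt_rmean (a : R) (u : R -> R) : RInt u a (a + 2 * PI) = 2 * PI * rmean a u.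
Proof.
unfold rmean; set (x := RInt u a (a + 2 * PI) : R).
assert (P := two_PI_pos); change (x = 2 * PI * (x / (2 * PI))); field; lra.
Qed.

Lemma two_PI_minus (m e : R) : 2 * PI * (m - e / (2 * PI)) = 2 * PI * m - e.
Proof. assert (P := two_PI_pos); field; lra. Qed.

Lemma tpoly_bounded (d : nat -> C) (N : nat) :
  exists W, forall t, 0 <= Cmod (tpoly d N t) <= W.
Proof.
induction N as [| N [W IH]].
- exists 0; intros t; unfold tpoly; simpl; rewrite Cmod_0; lra.
- exists (W + Cmod (d N)); intros t; split; [apply Cmod_ge_0 |].
  unfold tpoly; rewrite csum_S; eapply Rle_trans; [apply Cmod_triangle |].
  rewrite Cmod_mult, Cmod_cis; assert (X := IH t); unfold tpoly in X; lra.
Qed.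

Lemma pairing_eventually (f : C -> C) (b : nat -> C) (a : R) (N : nat) :
  (forall z, Cmod z < 1 -> continuous f z) -> has_coef f b ->
  forall e, 0 < e -> exists d, 0 < d /\ forall r, 1 - d < r -> r < 1 ->
  rsum (fun n => Cmod (b n) ^ 2) N - e <=
  rmean a (fun t => Cmod (f (r * cis t)%C) * Cmod (tpoly b N t)).
Proof.
intros Cf Hb e He.
destruct (tends_at_1_pairing (fun n => Cmod (b n) ^ 2) N e He) as [d [d0 Hd]].
exists (Rmin d 1); split; [apply Rmin_pos; lra |].
intros r H1 H2; assert (X := Rmin_l d 1); assert (Y := Rmin_r d 1).
assert (Z := Hd r ltac:(lra) H2); apply Rabs_lt_between in Z.
assert (P := pairing_lower_bound f b a r N Cf Hb ltac:(lra)); lra.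
Qed.

Lemma sqrt_div_le (s A : R) : 0 <= s -> s <= 2 * PI * A -> Rsqr (sqrt (s / (2 * PI))) <= A.
Proof.
intros Hs HA; assert (P := two_PI_pos).
rewrite Rsqr_sqrt by (apply Rdiv_le_0_compat; lra).
apply (Rmult_le_reg_r (2 * PI)); [exact P |].
unfold Rdiv; rewrite Rmult_assoc, Rinv_l; lra.
Qed.

(** Cauchy-Schwarz in disguise: the term PI * A, half of the left side, is absorbed. It comes from
    the AM-GM bound of a product whose second factor has mean square A. *)
Lemma sqrt_div_ge (s A : R) : 0 <= s -> 2 * PI * A <= s / 2 + PI * A ->
  A <= Rsqr (sqrt (s / (2 * PI))).
Proof.
intros Hs HA; assert (P := two_PI_pos).
rewrite Rsqr_sqrt by (apply Rdiv_le_0_compat; lra).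
apply (Rmult_le_reg_r (2 * PI)); [exact P |].
unfold Rdiv; rewrite Rmult_assoc, Rinv_l; lra.
Qed.

Lemma sqrt_arc_le (s lam eta : R) : 0 <= s -> 0 < lam -> 0 < eta ->
  sqrt (s / (2 * PI * lam)) <= eta -> s <= 2 * PI * lam * eta ^ 2.
Proof.
intros Hs Hl He H; assert (P := two_PI_pos).
assert (Q : 0 < 2 * PI * lam) by (apply Rmult_lt_0_compat; lra).
assert (S : 0 <= s / (2 * PI * lam)) by (now apply Rdiv_le_0_compat).
assert (H2 : s / (2 * PI * lam) <= eta ^ 2).
{ rewrite <- (pow2_sqrt (s / (2 * PI * lam))) by exact S.
  apply pow_incr; split; [apply sqrt_pos | exact H]. }
apply (Rmult_le_compat_r (2 * PI * lam)) in H2; [| lra].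
unfold Rdiv in H2; rewrite Rmult_assoc, Rinv_l in H2; lra.
Qed.

Lemma amgm (x p : R) : x * p <= 1 / 2 * Rsqr x + 1 / 2 * p ^ 2.
Proof. unfold Rsqr; assert (H := pow2_ge_0 (x - p)); simpl in *; lra. Qed.

(** Pointwise substitute for Cauchy-Schwarz on the arc; the weight 1 / (2 eta) is the best one when
    the mean of x^2 over the arc equals eta^2. *)
Lemma amgm_weight (x w W eta : R) : 0 <= x -> 0 < eta -> 0 <= w <= W ->
  x * w <= W / (2 * eta) * Rsqr x + W * eta / 2.
Proof.
intros Hx He Hw; unfold Rsqr.
apply Rle_trans with (W * x); [nra |].
assert (H : 0 <= W / (2 * eta) * (x - eta) ^ 2).
{ apply Rmult_le_pos; [apply Rdiv_le_0_compat; lra | apply pow2_ge_0]. }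
replace (W / (2 * eta) * (x - eta) ^ 2)
  with (W / (2 * eta) * (x * x) + W * eta / 2 - W * x) in H by (field; lra).
lra.
Qed.

(** In units of 2 PI the arc contributes lam W eta <= 1, and its complement 1/2 from the mean square
    plus (1 - lam) / 2 from the constant term, again at most 1. *)
Lemma arc_budget (m lam eta W : R) : 0 < lam < 1 -> 0 < eta -> 0 <= W -> W * eta <= 1 ->
  2 * PI * m <= (W / (2 * eta) * (2 * PI * lam * eta ^ 2) + 2 * PI * lam * (W * eta / 2))
    + (1 / 2 * (2 * PI * 1) + (2 * PI - 2 * PI * lam) * (1 / 2)) -> m <= 2.
Proof.
intros Hl He HW H1 H; assert (P := two_PI_pos).
replace (W / (2 * eta) * (2 * PI * lam * eta ^ 2)) with (2 * PI * (lam * (W * eta) / 2)) in H by (field; lra).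
assert (X : lam * (W * eta) <= 1) by nra.
nra.
Qed.

Lemma half_two_PI (s x : R) : 1 / 2 * s + 2 * PI * (1 / 2 * x) = s / 2 + PI * x.
Proof. field. Qed.

Lemma eighth_bounds (lam : R) : 0 < lam -> lam < 1 -> 0 < lam / 8 /\ lam / 8 < 1.
Proof. lra. Qed.

Lemma arc_inside (a lam : R) : 0 < lam -> lam < 1 ->
  a < a + 2 * PI * lam /\ a + 2 * PI * lam < a + 2 * PI.
Proof. intros; assert (P := two_PI_pos); split; nra. Qed.

Lemma continuous_Cmod_pow (f : C -> C) (M : nat) (z : C) :
  continuous f z -> continuous (fun z => Cmod (f z) ^ M) z.
Proof.
intros Hf; apply (continuous_ext (fun z => Cmod (f z ^ M)%C)); [intros; apply Cmod_pow |].
now apply continuous_Cmod, continuous_Cpow.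
Qed.

Lemma continuous_cis_id (t : R) : continuous cis t.
Proof.
apply (continuous_ext (fun u => cis (1 * u))); [intros; now rewrite Rmult_1_l |].
apply continuous_cis.
Qed.

Lemma tends_radial (F : C -> R) (t : R) : continuous F (cis t) ->
  tends_at_1 (fun r => F (r * cis t)%C) (F (cis t)).
Proof.
intros H; assert (X := tends_at_1_continuous _ (continuous_radial F t H)).
cbv beta in X; now rewrite Cmult_1_l in X.
Qed.

Lemma interior_eventually (f : C -> C) (h c a : R) (M : nat) (z : C) :
  0 < h -> h < 1 -> is_holoC1 f -> Cmod z <= 1 / 5 ->
  forall e, 0 < e -> exists d, 0 < d /\ forall r, 1 - d < r -> r < 1 ->
  3 / 4 * (Cmod (f z) * (1 + h / 4) ^ M) - e <=
  rmean a (fun t => Cmod (f (r * cis t)%C) * Cmod (amplifier h c (r * cis t)%C) ^ M).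
Proof.
intros H0 H1 Hf Hz e He; exists (1 / 5); split; [lra |]; intros r R0 R1.
assert (X := interior_bound h c (conj H0 H1) f a r M z Hf Hz ltac:(lra)); lra.
Qed.

Lemma RInt_const_mul (x y c : R) : RInt (fun _ => c) x y = (y - x) * c.
Proof. rewrite RInt_const; reflexivity. Qed.

Lemma budget_final (x : R) : 3 / 4 * x <= 2 -> x <= 8 / 3.
Proof. lra. Qed.

Lemma amgm_one (x w : R) : 0 <= x -> 0 <= w <= 1 -> x * w <= 1 / 2 * Rsqr x + 1 / 2.
Proof.
intros Hx Hw; apply Rle_trans with (x * 1); [apply Rmult_le_compat_l; lra |].
assert (X := amgm x 1); simpl in X; lra.
Qed.

Lemma pow_le_1 (x : R) (M : nat) : 0 <= x <= 1 -> x ^ M <= 1.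
Proof. intros Hx; rewrite <- (pow1 M); now apply pow_incr. Qed.

Lemma double_pos (x : R) : 0 < x -> 0 < 2 * x.
Proof. lra. Qed.

Lemma weight_pos (W eta : R) : 0 <= W -> 0 < eta -> 0 <= W * eta / 2.
Proof. intros; apply Rdiv_le_0_compat; [apply Rmult_le_pos|]; lra. Qed.

Lemma arc_lengths (a lam A B C D : R) :
  A + (a + 2 * PI * lam - a) * B + (C + (a + 2 * PI - (a + 2 * PI * lam)) * D) =
  A + 2 * PI * lam * B + (C + (2 * PI - 2 * PI * lam) * D).
Proof. ring. Qed.

Lemma half_ge0 : 0 <= 1 / 2.
Proof. lra. Qed.

Lemma continuous_on_circle (F : C -> R) (r t : R) : continuous F (r * cis t)%C ->
  continuous (fun t => F (r * cis t)%C) t.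
Proof. intros H; apply (continuous_comp (fun t => r * cis t)%C F); [apply continuous_polar | exact H]. Qed.

Lemma continuous_on_unit_circle (F : C -> R) (t : R) : continuous F (cis t) ->
  continuous (fun t => F (cis t)) t.
Proof. intros H; apply (continuous_comp cis F); [apply continuous_cis_id | exact H]. Qed.

Lemma pow4_ge0 (M : nat) : 0 <= 4 ^ M.
Proof. apply pow_le; lra. Qed.

(** * Choice of the parameters *)

Definition coef_derive (b : nat -> C) (n : nat) : C := (INR (S n) * b (S n))%C.

(** The exact factor is (m + 1) ... (m + k), here bounded below by the k-th power of its smallest
    term. *)
Lemma coef_derive_iter (b : nat -> C) (k m : nat) :
  INR (S m) ^ k * Cmod (b (m + k)%nat) <= Cmod (Nat.iter k coef_derive b m).
Proof.
revert m; induction k as [| k IH]; intros m.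
- simpl; rewrite Nat.add_0_r; lra.
- simpl Nat.iter; unfold coef_derive at 1.
  rewrite Cmod_mult, Cmod_R, Rabs_pos_eq by apply pos_INR.
  replace (m + S k)%nat with (S m + k)%nat by lia.
  rewrite <- tech_pow_Rmult, Rmult_assoc.
  apply Rmult_le_compat_l; [apply pos_INR |].
  eapply Rle_trans; [| apply IH].
  apply Rmult_le_compat_r; [apply Cmod_ge_0 |].
  apply pow_incr; split; [apply pos_INR | apply le_INR; lia].
Qed.

Lemma geometric_25 (N : nat) : rsum (fun n => 25 ^ n) N <= 25 ^ N.
Proof.
induction N as [| N IH]; simpl; [lra |].
assert (P := pow_le 25 N ltac:(lra)); lra.
Qed.

Lemma coef_sum_split (b : nat -> C) (k N : nat) (K : R) :
  (1 <= N)%nat -> (forall n, Cmod (b n) <= K * 5 ^ n) ->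
  (forall P, rsum (fun n => Cmod (Nat.iter k coef_derive b n) ^ 2) P <= 1) ->
  forall P, rsum (fun n => Cmod (b n) ^ 2) P <= 25 ^ (N + k) * K ^ 2 + ((/ INR N) ^ k) ^ 2.
Proof.
intros HN HK Hk P.
assert (N0 : 0 < INR N) by (apply lt_0_INR; lia).
(* Lengthening the sum makes the split at N + k possible whatever P is. The split lies k beyond N
   because the coefficient of index n of the k-th derivative controls b (n + k). *)
apply Rle_trans with (rsum (fun n => Cmod (b n) ^ 2) ((N + k) + P)).
{ apply rsum_mono; [intros; apply pow2_ge_0 | lia]. }
rewrite rsum_add; apply Rplus_le_compat.
- apply Rle_trans with (rsum (fun n => K ^ 2 * 25 ^ n) (N + k)).
  + apply rsum_le; intros n _.
    replace (K ^ 2 * 25 ^ n) with ((K * 5 ^ n) ^ 2).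
    * apply pow_incr; split; [apply Cmod_ge_0 | apply HK].
    * replace 25 with (5 * 5) by ring; rewrite (Rpow_mult_distr 5 5); ring.
  + rewrite rsum_scal, Rmult_comm; apply Rmult_le_compat_r; [apply pow2_ge_0 | apply geometric_25].
- apply Rle_trans with (rsum (fun n => ((/ INR N) ^ k) ^ 2 * Cmod (Nat.iter k coef_derive b (N + n)%nat) ^ 2) P).
  + apply rsum_le; intros n _; rewrite <- Rpow_mult_distr.
    apply pow_incr; split; [apply Cmod_ge_0 |].
    assert (X := coef_derive_iter b k (N + n)).
    replace (N + k + n)%nat with (N + n + k)%nat by lia.
    apply Rle_trans with ((/ INR N) ^ k * (INR N ^ k * Cmod (b (N + n + k)%nat))).
    * rewrite <- Rmult_assoc, <- Rpow_mult_distr, Rinv_l, pow1 by lra; lra.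
    * apply Rmult_le_compat_l; [apply pow_le; left; now apply Rinv_0_lt_compat |].
      eapply Rle_trans; [| exact X].
      apply Rmult_le_compat_r; [apply Cmod_ge_0 |].
      apply pow_incr; split; [lra | apply le_INR; lia].
  + rewrite rsum_scal.
    assert (X := Hk (N + P)%nat); rewrite rsum_add in X.
    assert (Y : 0 <= rsum (fun n => Cmod (Nat.iter k coef_derive b n) ^ 2) N).
    { apply (rsum_mono _ 0 N); [intros; apply pow2_ge_0 | lia]. }
    rewrite <- (Rmult_1_r (((/ INR N) ^ k) ^ 2)) at 2.
    apply Rmult_le_compat_l; [apply pow2_ge_0 | lra].
Qed.

Lemma floor_nat (x : R) : 0 <= x -> exists n : nat, INR n <= x < INR n + 1.
Proof.
intros Hx; destruct (archimed x) as [A B].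
assert (U : (0 < up x)%Z) by (apply lt_IZR; lra).
exists (Z.to_nat (up x - 1)).
rewrite INR_IZR_INZ, Z2Nat.id, minus_IZR by lia; lra.
Qed.

Lemma exp_pow_INR (x : R) (n : nat) : exp x ^ n = exp (INR n * x).
Proof.
induction n as [| n IH]; [simpl; now rewrite Rmult_0_l, exp_0 |].
rewrite <- tech_pow_Rmult, IH, <- exp_plus, S_INR; f_equal; ring.
Qed.

(** Used with 4 <= 1 + 3 and 25 <= 1 + 24. These crude bounds for the logarithms fix the divisors of
    [parameter_choice]: M <= T / 3, and N <= X / 9216 with 9216 = 24 * 384. *)
Lemma pow_le_exp (c y : R) (n : nat) : 0 <= c -> c <= 1 + y -> c ^ n <= exp (INR n * y).
Proof.
intros H0 H; rewrite <- exp_pow_INR; apply pow_incr; split; [exact H0 |].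
eapply Rle_trans; [exact H | apply exp_ineq1_le].
Qed.

(** Invert e^(-x/2) >= 1 - x/2 and use (1 - x/2) (1 + x) >= 1 on [0, 1]. *)
Lemma exp_half_le (x : R) : 0 <= x <= 1 -> exp (x / 2) <= 1 + x.
Proof.
intros Hx; assert (E := exp_ineq1_le (- (x / 2))).
rewrite exp_Ropp in E; assert (P := exp_pos (x / 2)).
apply (Rmult_le_compat_r (exp (x / 2))) in E; [| lra].
rewrite Rinv_l in E by lra. nra.
Qed.

(** Since e^y = (e^(y/(2k)))^(2k) >= (y/(2k))^(2k). The exponent 2 k fits the squared norm and
    leaves the power k after the square root. *)
Lemma exp_neg_le (y : R) (k : nat) : (1 <= k)%nat -> 0 < y ->
  exp (- y) <= ((2 * INR k / y) ^ k) ^ 2.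
Proof.
intros Hk Hy.
assert (K0 : 0 < INR k) by (apply lt_0_INR; lia).
assert (Q : 0 < y / (2 * INR k)) by (apply Rdiv_lt_0_compat; lra).
assert (E : (y / (2 * INR k)) ^ (k * 2) <= exp y).
{ replace y with (INR (k * 2) * (y / (2 * INR k))) at 2.
  - apply pow_le_exp; lra.
  - rewrite mult_INR; simpl; field; lra. }
rewrite exp_Ropp, <- pow_mult.
replace (2 * INR k / y) with (/ (y / (2 * INR k))) by (field; lra).
rewrite pow_inv; apply Rinv_le_contravar; [now apply pow_lt | exact E].
Qed.

(* With X = lam T, M = floor(T/3) and N = floor(X/9216), the factor
   (1 + lam/32)^(-2M) is at most e^(-X/192), of which 25^N <= e^(X/384) uses up
   only half. The condition X >= gamma0 ensures M >= T/6 and N >= X/18432. *)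
Definition gamma0 : R := 18432.

(** The first summand accounts for the low coefficients: (8/3)^2 25^k is at most (3 5^k)^2, and
    e^(-X/384) is at most (768 k / X)^(2k). The second is the tail N^(-k) with N >= X / 18432. *)
Definition alpha0 (k : nat) : R := 3 * 5 ^ k * (768 * INR k) ^ k + 18432 ^ k.

Lemma alpha0_pos (k : nat) : 0 < alpha0 k.
Proof.
unfold alpha0; assert (A := pow_lt 18432 k ltac:(lra)).
assert (B := pow_lt 5 k ltac:(lra)).
assert (D : 0 <= (768 * INR k) ^ k) by (apply pow_le; assert (X := pos_INR k); lra).
nra.
Qed.

Lemma parameter_choice (k : nat) (lam T : R) : (1 <= k)%nat -> 0 < lam < 1 -> gamma0 / lam <= T ->
  exists M N : nat, (1 <= N)%nat /\ 4 ^ M * exp (- T) <= 1 /\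
  25 ^ (N + k) * (8 / 3 / (1 + lam / 8 / 4) ^ M) ^ 2 + ((/ INR N) ^ k) ^ 2
    <= (alpha0 k / (lam * T) ^ k) ^ 2.
Proof.
intros Hk Hl HT; unfold gamma0 in HT.
set (X := lam * T).
assert (HX : 18432 <= X).
{ apply (Rmult_le_compat_l lam) in HT; [| lra].
  replace (lam * (18432 / lam)) with 18432 in HT by (field; lra). exact HT. }
assert (T0 : X <= T) by (unfold X in *; nra).
destruct (floor_nat (T / 3) ltac:(lra)) as [M HM].
destruct (floor_nat (X / 9216) ltac:(lra)) as [N HN].
exists M, N.
assert (N1 : (1 <= N)%nat) by (apply INR_le; simpl; destruct N; [simpl in HN; lra | rewrite S_INR; assert (Y := pos_INR N); lra]).
split; [exact N1 |]; split.
{ rewrite exp_Ropp; assert (P := exp_pos T).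
  apply (Rmult_le_reg_r (exp T)); [exact P |].
  rewrite Rmult_assoc, Rinv_l, Rmult_1_r, Rmult_1_l by lra.
  eapply Rle_trans; [apply (pow_le_exp 4 3 M); lra |].
  destruct (Req_dec (INR M * 3) T) as [-> | NE]; [lra | left; apply exp_increasing; lra]. }
assert (K0 : 0 < INR k) by (apply lt_0_INR; lia).
set (G := (1 + lam / 8 / 4) ^ M).
assert (HG : exp (X / 384) <= G).
{ apply Rle_trans with (exp (lam / 64) ^ M).
  - rewrite exp_pow_INR.
    assert (Z : X / 384 <= INR M * (lam / 64)) by (unfold X; nra).
    destruct Z as [Z | <-]; [left; now apply exp_increasing | lra].
  - apply pow_incr; split; [left; apply exp_pos |].
    replace (lam / 64) with (lam / 8 / 4 / 2) by field. apply exp_half_le; lra. }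
assert (E0 := exp_pos (X / 384)).
assert (A1 : 25 ^ (N + k) * (8 / 3 / G) ^ 2 <= (3 * 5 ^ k * (768 * INR k) ^ k / X ^ k) ^ 2).
{ assert (H25 : 25 ^ N <= exp (X / 384)).
  { eapply Rle_trans; [apply (pow_le_exp 25 24 N); lra |].
    assert (Z : INR N * 24 <= X / 384) by lra.
    destruct Z as [Z | ->]; [left; now apply exp_increasing | lra]. }
  assert (HGi : / G <= exp (- (X / 384))).
  { rewrite exp_Ropp; now apply Rinv_le_contravar. }
  assert (G0 : 0 < / G) by (apply Rinv_0_lt_compat; lra).
  assert (Ey := exp_neg_le (X / 384) k Hk ltac:(lra)).
  set (e := exp (- (X / 384))) in *.
  assert (e0 : 0 < e) by apply exp_pos.
  assert (ee : exp (X / 384) * e = 1) by (unfold e; rewrite <- exp_plus, Rplus_opp_r; apply exp_0).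
  replace (2 * INR k / (X / 384)) with (768 * INR k * / X) in Ey by (field; lra).
  rewrite Rpow_mult_distr, pow_inv in Ey.
  assert (S1 : 25 ^ N * (/ G) ^ 2 <= e).
  { apply Rle_trans with (exp (X / 384) * (e * e)).
    - apply Rmult_le_compat; [apply pow_le; lra | apply pow2_ge_0 | exact H25 |].
      simpl; rewrite Rmult_1_r; apply Rmult_le_compat; lra.
    - rewrite <- Rmult_assoc, ee; lra. }
  assert (P5 := pow_le 25 k ltac:(lra)).
  replace (25 ^ (N + k) * (8 / 3 / G) ^ 2) with (25 ^ k * (64 / 9) * (25 ^ N * (/ G) ^ 2))
    by (rewrite pow_add; field; apply Rgt_not_eq; lra).
  replace ((3 * 5 ^ k * (768 * INR k) ^ k / X ^ k) ^ 2)
    with (25 ^ k * 9 * ((768 * INR k) ^ k * / X ^ k) ^ 2).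
  2: { replace 25 with (5 * 5) by ring; rewrite (Rpow_mult_distr 5 5); unfold Rdiv; ring. }
  assert (Q := pow2_ge_0 ((768 * INR k) ^ k * / X ^ k)).
  apply Rmult_le_compat; [lra | | lra | now apply Rle_trans with e].
  apply Rmult_le_pos; [apply pow_le; lra | apply pow2_ge_0]. }
assert (A2 : ((/ INR N) ^ k) ^ 2 <= (18432 ^ k / X ^ k) ^ 2).
{ assert (NX : / INR N <= 18432 * / X).
  { assert (N0 : 0 < INR N) by (apply lt_0_INR; lia).
    replace (18432 * / X) with (/ (X / 18432)) by (field; lra).
    apply Rinv_le_contravar; lra. }
  assert (N0 : 0 <= / INR N) by (left; apply Rinv_0_lt_compat, lt_0_INR; lia).
  apply pow_incr; split; [now apply pow_le |].
  unfold Rdiv; rewrite <- pow_inv, <- Rpow_mult_distr; apply pow_incr; split; assumption. }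
eapply Rle_trans; [apply Rplus_le_compat; [exact A1 | exact A2] |].
unfold alpha0.
set (p := 3 * 5 ^ k * (768 * INR k) ^ k / X ^ k). set (q := 18432 ^ k / X ^ k).
replace ((3 * 5 ^ k * (768 * INR k) ^ k + 18432 ^ k) / X ^ k) with (p + q)
  by (unfold p, q, Rdiv; ring).
assert (XK : 0 < X ^ k) by (apply pow_lt; lra).
assert (p0 : 0 <= p).
{ apply Rdiv_le_0_compat; [| exact XK]; repeat apply Rmult_le_pos; try lra; apply pow_le; lra. }
assert (q0 : 0 <= q) by (apply Rdiv_le_0_compat; [apply pow_le; lra | exact XK]).
nra.
Qed.

Close Scope R_scope.

From mathcomp Require Import all_boot all_order all_algebra.
From mathcomp Require Import all_classical all_reals all_analysis.
From mathcomp Require Import measurable_realfun Rstruct Rstruct_topology ring.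

Set Implicit Arguments.
Unset Strict Implicit.
Unset Printing Implicit Defensive.
Import Order.TTheory GRing.Theory Num.Theory numFieldNormedType.Exports.
Local Open Scope classical_set_scope.
Local Open Scope ring_scope.

(** * Lebesgue integrals *)

Section ae_limits.
Context d (T : measurableType d) (R : realType).
Variables (mu : {measure set T -> \bar R}) (D : set T) (mD : measurable D).
Variables (u_ : nat -> T -> R) (u : T -> R).
Hypothesis mu_ : forall n, measurable_fun D (u_ n).
Hypothesis mu0 : measurable_fun D u.
Hypothesis u_ge0 : forall n x, 0 <= u_ n x.
Hypothesis ge0 : forall x, 0 <= u x.
Hypothesis uu : {ae mu, forall x, D x -> u_ ^~ x @ \oo --> u x}.

(** Fatou's lemma is applied on D minus the exceptional null set, where the lower limit equals u at
    every point. *)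
Lemma ae_fatou_le (B : \bar R) :
  (forall n, \int[mu]_(x in D) (u_ n x)%:E <= B)%E ->
  (\int[mu]_(x in D) (u x)%:E <= B)%E.
Proof.
move=> HB; case: uu => N [mN muN uuN].
have DN : measurable (D `\` N) by exact: measurableD.
rewrite (ge0_negligible_integral _ _ _ _ muN)//; last 2 first.
- exact/measurable_EFinP.
- by move=> x _; rewrite lee_fin.
have -> : (\int[mu]_(x in D `\` N) (u x)%:E =
    \int[mu]_(x in D `\` N) limn_einf (fun n => (u_ n x)%:E))%E.
  apply: eq_integral => x; rewrite inE => -[Dx Nx].
  have ux : (fun n => (u_ n x)%:E) @ \oo --> (u x)%:E.
    apply/cvg_EFin; first exact: nearW.
    apply: contrapT => h; apply: Nx; apply: uuN => /= /(_ Dx); exact: h.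
  rewrite is_cvg_limn_einfE; first exact/esym/cvg_lim.
  by apply/cvg_ex; eexists; exact: ux.
apply: le_trans; first apply: fatou => //.
- by move=> n; apply/measurable_EFinP; apply: measurable_funS (mu_ n).
- by move=> n x _; rewrite lee_fin.
have HBn n : (\int[mu]_(x in D `\` N) (u_ n x)%:E <= B)%E.
  apply: le_trans (HB n); apply: ge0_subset_integral => //.
  - exact/measurable_EFinP.
  - by move=> x _; rewrite lee_fin.
rewrite limn_einf_lim; apply: lime_le.
  by apply: ereal_nondecreasing_is_cvgn; exact: nondecreasing_einfs.
apply: nearW => n; apply: le_trans (HBn n).
(* The infimum over a tail of the sequence of integrals is at most its first term, hence at most
   B. *)
by apply: ereal_inf_lbound; exists n => /=.
Qed.

(* Splitting [u_n <= min(u_n, M) + u_n^2 / M] makes the truncated part amenable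
   to dominated convergence, while the rest is at most [B / M]. *)
Lemma ae_integral_ge (m B : R) : (mu D < +oo)%E ->
  (forall n, \int[mu]_(x in D) (u_ n x ^+ 2)%:E <= B%:E)%E ->
  (forall e, 0 < e ->
     \forall n \near \oo, ((m - e)%:E <= \int[mu]_(x in D) (u_ n x)%:E)%E) ->
  (m%:E <= \int[mu]_(x in D) (u x)%:E)%E.
Proof.
move=> muD HB Hm; apply/lee_addgt0Pr => e e0.
(* The remainder B / M becomes at most e / 2; the added 1 keeps M positive when B = 0. *)
pose M := (`|B| + 1) * 2 / e.
have M0 : 0 < M by rewrite divr_gt0// mulr_gt0// ltr_wpDl.
pose w n x := Num.min (u_ n x) M; pose w0 x := Num.min (u x) M.
have mw n : measurable_fun D (w n) by exact: measurable_minr.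
have mw0 : measurable_fun D w0 by exact: measurable_minr.
have w_ge0 n x : 0 <= w n x by rewrite le_min u_ge0 ltW.
have w0_ge0 x : 0 <= w0 x by rewrite le_min ge0 ltW.
have wcvg : {ae mu, forall x, D x -> (fun n => (w n x)%:E) @ \oo --> (w0 x)%:E}.
  apply: filterS uu => x ux Dx; apply/cvg_EFin; first exact: nearW.
  have cm : {for u x, continuous ((idfun : R -> R^o) \min (cst M : R -> R^o))}.
    by apply: continuous_min; [exact: cvg_id|exact: cvg_cst].
  exact: (cvg_comp _ _ (ux Dx) cm).
have iM : mu.-integrable D (EFin \o cst M).
  apply/integrableP; split; first exact/measurable_EFinP.
  rewrite (eq_integral (fun=> M%:E)); last first.
    by move=> x _; rewrite /= ger0_norm// ltW.
  by rewrite integral_cst// lte_mul_pinfty// lee_fin ltW.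
have Iw : (fun n => \int[mu]_(x in D) (w n x)%:E)%E @ \oo --> (\int[mu]_(x in D) (w0 x)%:E)%E.
  have [//|||_ _ //] := @dominated_convergence _ _ _ mu D mD
    (fun n => EFin \o w n) (EFin \o w0) (EFin \o cst M) _ _ wcvg iM.
  - by move=> n; exact/measurable_EFinP.
  - exact/measurable_EFinP.
  - apply: aeW => x n Dx /=; rewrite lee_fin ger0_norm//.
    by rewrite ge_min lexx orbT.
have w0u : (\int[mu]_(x in D) (w0 x)%:E <= \int[mu]_(x in D) (u x)%:E)%E.
  apply: ge0_le_integral => //.
  - by move=> x _; rewrite lee_fin.
  - exact/measurable_EFinP.
  - exact/measurable_EFinP.
  - by move=> x _; rewrite lee_fin ge_min lexx.
have uw n : (\int[mu]_(x in D) (u_ n x)%:E <=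
    \int[mu]_(x in D) (w n x)%:E + (e / 2)%:E)%E.
  have msq : measurable_fun D (fun x => (M^-1 * u_ n x ^+ 2)%:E).
    apply/measurable_EFinP; apply: measurable_funM => //.
    exact: measurable_funX.
  have -> : (e / 2)%:E = ((M^-1)%:E * ((`|B| + 1)%:E))%E :> \bar R.
    rewrite -EFinM; congr EFin; rewrite /M.
    by field; rewrite gt_eqF//= gt_eqF// ltr_wpDl.
  apply: (@le_trans _ _ (\int[mu]_(x in D) (w n x)%:E +
      \int[mu]_(x in D) (M^-1 * u_ n x ^+ 2)%:E)%E).
    rewrite -ge0_integralD//; last 3 first.
    - by move=> x _; rewrite lee_fin.
    - exact/measurable_EFinP.
    - by move=> x _; rewrite lee_fin mulr_ge0 ?invr_ge0 ?sqr_ge0// ltW.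
    apply: ge0_le_integral => //.
    - by move=> x _; rewrite lee_fin.
    - exact/measurable_EFinP.
    - by apply: emeasurable_funD => //; exact/measurable_EFinP.
    - move=> x _; rewrite -EFinD lee_fin /w minEle; case: ifPn => [_|].
        by rewrite lerDl mulr_ge0 ?invr_ge0 ?sqr_ge0// ltW.
      rewrite -ltNge => /ltW Mu; rewrite -[leLHS]add0r lerD ?(ltW M0)//.
      by rewrite mulrC ler_pdivlMr// expr2 ler_wpM2l.
  rewrite leeD2l//.
  under eq_integral do rewrite EFinM.
  rewrite ge0_integralZl//; last 3 first.
  - by apply/measurable_EFinP; exact: measurable_funX.
  - by move=> x _; rewrite lee_fin sqr_ge0.
  - by rewrite lee_fin invr_ge0 ltW.
  rewrite lee_wpmul2l ?lee_fin ?invr_ge0 ?(ltW M0)//.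
  by apply: le_trans (HB n) _; rewrite lee_fin (le_trans (ler_norm _))// lerDl.
rewrite -leeBlDr//; apply: le_trans w0u.
have e40 : 0 < e / 2 by rewrite divr_gt0.
rewrite -(cvg_lim _ Iw)//; apply: lime_ge.
  by apply/cvg_ex; eexists; exact: Iw.
near=> n.
have : ((m - e / 2)%:E <= \int[mu]_(x in D) (u_ n x)%:E)%E.
  by near: n; exact: Hm.
move=> /le_trans/(_ (uw n)).
rewrite -leeBlDr// -EFinB -addrA -opprD -splitr; exact.
Unshelve. all: by end_near. Qed.

End ae_limits.

(** * Agreement of Riemann and Lebesgue integrals, and of the two cosines and sines *)

Lemma derivable_pt_lim_cvg (F : R -> R) (x l : R) : derivable_pt_lim F x l ->
  (fun h => h^-1 *: ((F : R -> R^o) (h + x) - F x)) @ (0 : R)^' --> (l : R^o).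
Proof.
move=> Fl; apply/cvgrPdist_lt => e e0.
have [[d /RltP d0] /= Hd] := Fl e (elimT RltP e0).
near=> h.
have h0 : h != 0 by near: h; exact: nbhs_dnbhs_neq.
have hd : (Rabs h < d)%coqR.
  apply/RltP; rewrite RabsE; near: h. exact: (@dnbhs0_lt R R^o d d0).
have -> : h^-1 *: ((F : R -> R^o) (h + x) - F x) = ((F (x + h) - F x) / h)%coqR.
  by rewrite RdivE RplusE [x + h]addrC -RminusE mulrC.
by rewrite distrC -RabsE; apply/RltP; apply: Hd => //; exact/eqP.
Unshelve. all: by end_near. Qed.

Lemma is_derive_derivable (F : R -> R) (x l : R) : derivable_pt_lim F x l ->
  @derivable R R^o R^o F x 1 /\ @derive1 R R^o F x = l.
Proof.
move=> /derivable_pt_lim_cvg Fl.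
split; last by rewrite /derive1; apply: cvg_lim.
rewrite /derivable; apply/cvg_ex; exists l.
by under eq_fun do rewrite /= [_ *: (1 : R^o)]mulr1.
Qed.

Lemma continuous_Coquelicot (u : R -> R) :
  (forall t, Coquelicot.Continuity.continuous u t) -> forall t, {for t, continuous u}.
Proof. by move=> cu t; apply/continuity_ptE; apply/continuity_pt_filterlim; exact: cu. Qed.

(** The Riemann integral with variable upper end is differentiable everywhere with derivative u,
    hence a primitive to which the fundamental theorem for the Lebesgue integral applies. *)
Lemma integral_RInt (u : R -> R) (a b : R) :
  (forall t, Coquelicot.Continuity.continuous u t) -> a < b ->
  (\int[@lebesgue_measure R]_(t in `[a, b]) (u t)%:E = (RInt u a b)%:E)%E.
Proof.
move=> cu ab.
pose F (x : R) : R := RInt u a x.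
have dF x : derivable_pt_lim F x (u x).
  have L : Hierarchy.locally x (fun y => is_RInt (V := R_NormedModule) u a y (F y)).
    exists (mkposreal 1 Rlt_0_1) => y _.
    apply: (@RInt_correct R_CompleteNormedModule).
    by apply: (@ex_RInt_continuous R_CompleteNormedModule) => z _; exact: cu.
  apply/is_derive_Reals.
  exact: (@is_derive_RInt R_NormedModule u F a x L (cu x)).
have cF (x : R) : {for x, continuous F}.
  apply/continuity_ptE; apply: derivable_continuous_pt.
  by exists (u x); exact: dF.
rewrite (@continuous_FTC2 _ u F)//.
- by rewrite /F RInt_point sube0.
- by apply: continuous_subspaceT => x; exact: continuous_Coquelicot.
- split => [x _||].
  + exact: (is_derive_derivable (dF x)).1.
  + exact: (cvg_at_right_filter (cF a)).
  + exact: (cvg_at_left_filter (cF b)).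
- by move=> x _; exact: (is_derive_derivable (dF x)).2.
Qed.

Lemma infinite_sum_cvg (s : nat -> R) (l : R) : infinite_sum s l ->
  (series s : nat -> R^o) @ \oo --> (l : R^o).
Proof.
move=> sl; rewrite -cvg_shiftS /=; apply/cvgrPdist_lt => e /RltP /sl[N HN].
near=> n.
have /HN : (n >= N)%coq_nat by apply/ssrnat.leP; near: n; exact: nbhs_infty_ge.
by rewrite RdistE distrC sum_f_R0E => /RltP.
Unshelve. all: by end_near. Qed.

(* [polarC] is built on the [cos] and [sin] of MathComp-Analysis. *)
Lemma RcosE (x : R) : Rtrigo_def.cos x = trigo.cos x.
Proof.
rewrite /Rtrigo_def.cos; case: exist_cos => y /infinite_sum_cvg xy.
have xc := @cvg_cos_coeff' R x.
have E : series (cos_coeff' x) = series (fun i => (cos_n i * Rsqr x ^ i)%coqR).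
  congr series; apply/funext => i.
  rewrite /cos_coeff' /cos_n /Rsqr !RealsE -expr2 -exprM -exprnP.
  by rewrite (_ : IZR (-1) = -1 :> R)// multE mul2n; ring.
by rewrite E in xc; exact: (cvg_unique _ xy xc).
Qed.

Lemma RsinE (x : R) : Rtrigo_def.sin x = trigo.sin x.
Proof.
rewrite /Rtrigo_def.sin; case: exist_sin => y /infinite_sum_cvg xy.
have xs := @cvg_sin_coeff' R x.
have E : series (sin_coeff' x) = (fun n => x * series (fun i => (sin_n i * Rsqr x ^ i)%coqR) n).
  apply/funext => n; rewrite /series /= mulr_sumr; apply: eq_bigr => i _.
  rewrite /sin_coeff' /sin_n /Rsqr !RealsE -expr2 -exprM -exprnP.
  by rewrite (_ : IZR (-1) = -1 :> R)// multE plusE mul2n addn1 exprS; ring.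
have xz : (fun n => x * series (fun i => (sin_n i * Rsqr x ^ i)%coqR) n) @ \oo --> (x * y : R^o).
  by apply: cvgM; [exact: cvg_cst|exact: xy].
by rewrite E in xs; exact: (cvg_unique (@Rhausdorff R) xz xs).
Qed.

(** * Boundary values *)

Lemma polarCE (r t : R) : polarC r t = (r * cis t)%C.
Proof. by rewrite /polarC -RcosE -RsinE; exact: polar_pair. Qed.

Lemma cvg_tends_at_1 (phi : R -> R) (l : R) :
  tends_at_1 phi l -> (fun n => phi (rad_seq n) : R^o) @ \oo --> (l : R^o).
Proof.
move=> H; apply/cvgrPdist_lt => e e0.
have [d [d0 Hd]] := H e (elimT RltP e0).
have [N HN] := rad_near d d0.
exists N => // n /= Nn.
rewrite distrC -RabsE; apply/RltP; apply: Hd.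
- by apply: HN; exact/ssrnat.leP.
- exact: (rad_bounds n).2.
Qed.

Lemma measurable_Coquelicot (D : set (measurableTypeR R)) (u : R -> R) :
  (forall t, Coquelicot.Continuity.continuous u t) ->
  measurable_fun D (fun t : measurableTypeR R => u t : measurableTypeR R).
Proof.
move=> cu; apply: measurable_funTS; apply: (@continuous_measurable_fun R).
exact: continuous_Coquelicot.
Qed.

Lemma measurable_Cmod (f : C -> C) (g : R -> C) : boundary_fun f g ->
  measurable_fun [set: measurableTypeR R]
    (fun t : measurableTypeR R => Cmod (g t) : measurableTypeR R).
Proof.
move=> [m1 [m2 _]]; rewrite /Cmod.
apply: (measurableT_comp (f := fun x : measurableTypeR R => sqrt x : measurableTypeR R)).
  exact: (measurable_Coquelicot (D := setT) continuous_sqrt).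
have -> : (fun t : measurableTypeR R => (fst (g t) ^ 2 + snd (g t) ^ 2)%coqR) =
   ((fun t => fst (g t)) \* (fun t => fst (g t))) \+ ((fun t => snd (g t)) \* (fun t => snd (g t))).
  by apply/funext => t; rewrite !RpowE RplusE !expr2.
exact: measurable_funD (measurable_funM m1 m1) (measurable_funM m2 m2).
Qed.

Lemma integral_rmean (a : R) (u : R -> R) :
  (forall t, Coquelicot.Continuity.continuous u t) ->
  (\int[@lebesgue_measure R]_(t in `[a, (a + 2 * PI)%coqR]) (u t)%:E = (2 * PI * rmean a u)%coqR%:E)%E.
Proof.
move=> cu; have P := two_PI_pos.
rewrite integral_RInt//; last by rewrite RplusE ltrDl; exact/RltP.
by rewrite RInt_rmean.
Qed.

Lemma boundary_cvg (f : C -> C) (g : R -> C) (D : set R) : boundary_fun f g ->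
  {ae @lebesgue_measure R, forall t, D t -> tends_at_1 (fun r => Cmod (f (r * cis t)%C)) (Cmod (g t))}.
Proof.
move=> [_ [_ [N [mN N0 sN]]]]; exists N; split=> // t /= nt; apply: sN => /= Ht.
apply: nt => _ eps eps0; have [d [d0 Hd]] := Ht eps eps0.
exists d; split => // r r1 r2; have := Hd r r1 r2.
by rewrite polarCE; apply: Rle_lt_trans; exact: Rabs_Cmod_minus.
Qed.

Section boundary.
Variables (f : C -> C) (g : R -> C) (a A : R).
Hypothesis cf : forall z, Rlt (Cmod z) 1 -> Coquelicot.Continuity.continuous f z.
Hypothesis fg : boundary_fun f g.
Hypothesis fA : forall r, Rlt 0 r -> Rlt r 1 ->
  Rle (rmean a (fun t => (Cmod (f (r * cis t)%C) ^ 2)%coqR)) A.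

Let D : set (measurableTypeR R) := `[a, (a + 2 * PI)%coqR]%classic.

Let mD : measurable D. Proof. exact: measurable_itv. Qed.

Let D_fin : (@lebesgue_measure R D < +oo)%E.
Proof. by rewrite /D lebesgue_measure_itv/=; case: ifPn => _; rewrite -?EFinB ltry. Qed.

Let c_rad n t : Coquelicot.Continuity.continuous (fun t => f (rad_seq n * cis t)%C) t.
Proof.
apply: (circle_continuous _ _ cf); have [h1 h2] := rad_bounds n.
by split => //; exact: Rlt_le.
Qed.

Lemma boundary_sq_int_le : (sq_int g a (a + 2 * PI)%coqR <= (2 * PI * A)%coqR%:E)%E.
Proof.
have cn n t : Coquelicot.Continuity.continuous (fun t => (Cmod (f (rad_seq n * cis t)%C) ^ 2)%coqR) t.
  exact: continuous_Cmod_sq.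
rewrite /sq_int.
under eq_integral do rewrite Rsqr_pow2.
have mg := measurable_funTS (D := D) (measurable_Cmod fg).
apply: (@ae_fatou_le _ (measurableTypeR R) R lebesgue_measure D mD
  (fun n t => (Cmod (f (rad_seq n * cis t)%C) ^ 2)%coqR) (fun t => (Cmod (g t) ^ 2)%coqR)).
- by move=> n; exact: (measurable_Coquelicot (cn n)).
- have -> : (fun t : measurableTypeR R => (Cmod (g t) ^ 2)%coqR) =
    (fun t => Cmod (g t)) \* (fun t => Cmod (g t)).
    by apply/funext => t; rewrite RpowE expr2.
  exact: measurable_funM.
- by move=> n t; apply/RleP; exact: pow2_ge_0.
- by move=> t; apply/RleP; exact: pow2_ge_0.
- have [N [mN N0 sN]] := boundary_cvg D fg.
  exists N; split=> // t /= nt; apply: sN => /= Ht; apply: nt => Dt.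
  have := cvg_tends_at_1 (tends_at_1_mult _ _ _ _ (Ht Dt) (Ht Dt)).
  by under eq_fun do rewrite -[(_ * _)%coqR]/(Rsqr _) Rsqr_pow2; rewrite -[(_ * _)%coqR]/(Rsqr _) Rsqr_pow2.
- move=> n; rewrite integral_rmean; last exact: cn.
  rewrite lee_fin; apply/RleP; apply: Rmult_le_compat_l; first exact/Rlt_le/two_PI_pos.
  by have [? ?] := rad_bounds n; exact: fA.
Qed.

(** Serves twice: with the modulus of a Taylor polynomial as a weight constant in r, and with |Q|^M,
    which varies with r. The bound W turns the mean square bound A for f into W^2 A for the
    products, as [ae_integral_ge] requires. *)
Lemma boundary_integral_ge (w : R -> R -> R) (w1 : R -> R) (W m : R) :
  (forall r, Rlt 0 r -> Rlt r 1 -> forall t, Coquelicot.Continuity.continuous (w r) t) ->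
  (forall t, Coquelicot.Continuity.continuous w1 t) ->
  (forall r t, Rlt 0 r -> Rlt r 1 -> Rle 0 (w r t) /\ Rle (w r t) W) ->
  (forall t, Rle 0 (w1 t)) ->
  (forall t, tends_at_1 (fun r => w r t) (w1 t)) ->
  (forall e, Rlt 0 e -> exists d, Rlt 0 d /\ forall r, Rlt (Rminus 1 d) r -> Rlt r 1 ->
     Rle (Rminus m e) (rmean a (fun t => Rmult (Cmod (f (r * cis t)%C)) (w r t)))) ->
  ((2 * PI * m)%coqR%:E <=
    \int[@lebesgue_measure R]_(t in `[a, (a + 2 * PI)%coqR]) (Cmod (g t) * w1 t)%coqR%:E)%E.
Proof.
move=> cw cw1 wW w1_ge0 ww1 Hm.
have P := two_PI_pos.
pose v n t := (Cmod (f (rad_seq n * cis t)%C) * w (rad_seq n) t)%coqR.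
have rb n : Rlt 0 (rad_seq n) /\ Rlt (rad_seq n) 1 by exact: rad_bounds.
have cv n t : Coquelicot.Continuity.continuous (v n) t.
  apply: continuous_Rmult; first exact: continuous_Cmod.
  by have [? ?] := rb n; exact: cw.
have cv2 n t : Coquelicot.Continuity.continuous (fun t => (v n t ^ 2)%coqR) t.
  by rewrite /=; apply: continuous_Rmult => //; apply: continuous_Rmult => //; exact: continuous_const.
have mg := measurable_funTS (D := D) (measurable_Cmod fg).
apply: (@ae_integral_ge _ (measurableTypeR R) R lebesgue_measure D mD v
  (fun t => (Cmod (g t) * w1 t)%coqR) _ _ _ _ _ _ (2 * PI * (W ^ 2 * A))%coqR D_fin).
- by move=> n; exact: (measurable_Coquelicot (cv n)).
- exact: (measurable_funM mg (measurable_Coquelicot cw1)).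
- move=> n t; apply/RleP; apply: Rmult_le_pos; first exact: Cmod_ge_0.
  by have [? ?] := rb n; exact: (wW _ _ _ _).1.
- by move=> t; apply/RleP; apply: Rmult_le_pos => //; exact: Cmod_ge_0.
- have [N [mN N0 sN]] := boundary_cvg D fg.
  exists N; split=> // t /= nt; apply: sN => /= Ht; apply: nt => Dt.
  exact: cvg_tends_at_1 (tends_at_1_mult _ _ _ _ (Ht Dt) (ww1 t)).
- move=> n; under eq_integral do rewrite -RpowE.
  rewrite integral_rmean; last exact: cv2.
  rewrite lee_fin; apply/RleP; apply: Rmult_le_compat_l; first exact/Rlt_le.
  have [r0 r1] := rb n.
  apply: Rle_trans (Rmult_le_compat_l _ _ _ (pow2_ge_0 W) (fA r0 r1)).
  rewrite -rmean_scal; last exact: continuous_Cmod_sq.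
  apply: rmean_le => //.
  - by move=> t; apply: continuous_Rmult; [exact: continuous_const|exact: continuous_Cmod_sq].
  - move=> t; rewrite /v Rpow_mult_distr Rmult_comm.
    apply: Rmult_le_compat_r; first exact: pow2_ge_0.
    by have [w0 wW'] := wW _ t r0 r1; apply: pow_incr.
- move=> e /RltP e0.
  have e1 : Rlt 0 (e / (2 * PI)) by exact: Rdiv_lt_0_compat.
  have [d [d0 Hd]] := Hm _ e1.
  have [N HN] := rad_near d d0.
  exists N => // n /= /ssrnat.leP Nn.
  rewrite integral_rmean; last exact: cv.
  rewrite lee_fin; apply/RleP; have [r0 r1] := rb n.
  apply: Rle_trans (Rmult_le_compat_l _ _ _ (Rlt_le _ _ P) (Hd _ (HN n Nn) r1)).
  by rewrite two_PI_minus; exact: Rle_refl.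
Qed.

End boundary.

Lemma measurable_Cmod_sq (f : C -> C) (g : R -> C) (D : set (measurableTypeR R)) :
  boundary_fun f g ->
  measurable_fun D (fun t : measurableTypeR R => Rsqr (Cmod (g t)) : measurableTypeR R).
Proof.
move=> fg; have mg := measurable_funTS (D := D) (measurable_Cmod fg).
exact: measurable_funM.
Qed.

Lemma sq_int_ge0 (g : R -> C) (x y : R) : (0 <= sq_int g x y)%E.
Proof.
by apply: integral_ge0 => t _; rewrite lee_fin; apply/RleP; exact: Rle_0_sqr.
Qed.

Lemma sq_int_subset (f : C -> C) (g : R -> C) (x y x' y' : R) : boundary_fun f g ->
  Rle x' x -> Rle y y' -> (sq_int g x y <= sq_int g x' y')%E.
Proof.
move=> fg /RleP xx /RleP yy; apply: ge0_subset_integral.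
- exact: measurable_itv.
- exact: measurable_itv.
- by apply/measurable_EFinP; exact: (measurable_Cmod_sq fg).
- by move=> t _; rewrite lee_fin; apply/RleP; exact: Rle_0_sqr.
- by apply: subset_itv; rewrite bnd_simp.
Qed.

(** [fine] sends infinite values to 0, so [H2_norm] and [arc_norm] carry information only once the
    integral is known to be finite. *)
Lemma sq_int_fine (g : R -> C) (x y s : R) : (sq_int g x y <= s%:E)%E ->
  sq_int g x y = (fine (sq_int g x y))%:E /\
  Rle 0 (fine (sq_int g x y)) /\ Rle (fine (sq_int g x y)) s.
Proof.
move=> gs; have fin : sq_int g x y \is a fin_num.
  rewrite ge0_fin_numE; last exact: sq_int_ge0.
  exact: le_lt_trans gs (ltry _).
rewrite fineK//; split=> //; split; apply/RleP; first exact/fine_ge0/sq_int_ge0.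
by rewrite -lee_fin fineK.
Qed.

(** Common integrated form of the three AM-GM bounds: the square of |g| is integrated in the sense
    of Lebesgue, the continuous remainder q in that of Riemann. *)
Lemma integral_le_sq (f : C -> C) (g : R -> C) (x y s al : R) (w q : R -> R) :
  boundary_fun f g -> Rlt x y -> (sq_int g x y <= s%:E)%E -> Rle 0 al ->
  (forall t, Coquelicot.Continuity.continuous q t) -> (forall t, Rle 0 (q t)) ->
  (forall t, Coquelicot.Continuity.continuous w t) -> (forall t, Rle 0 (w t)) ->
  (forall t, Rle x t -> Rle t y ->
     Rle (Rmult (Cmod (g t)) (w t)) (Rplus (Rmult al (Rsqr (Cmod (g t)))) (q t))) ->
  (\int[@lebesgue_measure R]_(t in `[x, y]) (Cmod (g t) * w t)%coqR%:E <=
   (al * s + RInt q x y)%coqR%:E)%E.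
Proof.
move=> fg /RltP xy gs /RleP al0 cq q0 cw w0 H.
pose D : set (measurableTypeR R) := `[x, y]%classic.
have mD : measurable D by exact: measurable_itv.
have mg := measurable_funTS (D := D) (measurable_Cmod fg).
have mg2 := measurable_Cmod_sq (D := D) fg.
have mq := measurable_Coquelicot (D := D) cq.
have malg : measurable_fun D (fun t : measurableTypeR R => (al * Rsqr (Cmod (g t)))%coqR : measurableTypeR R).
  by apply: measurable_funM => //; exact: measurable_cst.
apply: (@le_trans _ _ (\int[@lebesgue_measure R]_(t in D) ((al * Rsqr (Cmod (g t)))%coqR%:E + (q t)%:E))%E).
  apply: ge0_le_integral => //.
  - move=> t _; rewrite lee_fin; apply/RleP; apply: Rmult_le_pos => //; exact: Cmod_ge_0.
  - apply/measurable_EFinP; exact: (measurable_funM mg (measurable_Coquelicot cw)).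
  - by apply: emeasurable_funD; exact/measurable_EFinP.
  - move=> t; rewrite /D/= in_itv/= => /andP[/RleP h1 /RleP h2].
    by rewrite -EFinD lee_fin; apply/RleP; exact: H.
rewrite ge0_integralD//; last 4 first.
- move=> t _; rewrite lee_fin; apply/RleP; apply: Rmult_le_pos; [exact/RleP|exact: Rle_0_sqr].
- exact/measurable_EFinP.
- by move=> t _; rewrite lee_fin; exact/RleP.
- exact/measurable_EFinP.
rewrite (integral_RInt cq xy) [X in (_ <= X)%E]EFinD leeD2r//.
under eq_integral do rewrite RmultE EFinM.
rewrite ge0_integralZl//; last 2 first.
- exact/measurable_EFinP.
- by move=> t _; rewrite lee_fin; apply/RleP; exact: Rle_0_sqr.
by rewrite [X in (_ <= X)%E]EFinM lee_wpmul2l// lee_fin.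
Qed.

Lemma circ_mean_le (f : C -> C) (B : R) :
  (forall z, Rlt (Cmod z) 1 -> Coquelicot.Continuity.continuous f z) ->
  (forall r, Rle 0 r -> Rlt r 1 -> (circ_int f r <= B%:E)%E) ->
  forall r, Rlt 0 r -> Rlt r 1 ->
  Rle (rmean 0 (fun t => (Cmod (f (r * cis t)%C) ^ 2)%coqR)) (B / (2 * PI)).
Proof.
move=> cf HB r r0 r1; have := HB r (Rlt_le _ _ r0) r1.
rewrite /circ_int /sq_int; under eq_integral do rewrite polarCE Rsqr_pow2.
have E : (2 * PI)%coqR = (0 + 2 * PI)%coqR by rewrite Rplus_0_l.
rewrite {1}E integral_rmean; last first.
  apply: continuous_Cmod_sq; apply: (circle_continuous _ _ cf).
  by split=> //; exact: Rlt_le.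
rewrite lee_fin => /RleP h; apply: (Rmult_le_reg_l _ _ _ two_PI_pos).
apply: Rle_trans h _; right; rewrite /Rdiv Rmult_comm Rmult_assoc Rinv_l ?Rmult_1_r//.
exact/Rgt_not_eq/two_PI_pos.
Qed.

(** Bessel's inequality for the boundary function. Let S be the sum on the left, p the Taylor
    polynomial and s the integral of |g|^2. Since |p|^2 has mean S, the pairing gives 2 PI S <= s /
    2 + PI S. *)
Lemma coef_le_H2_norm (f : C -> C) (g : R -> C) (b : nat -> C) :
  (forall z, Rlt (Cmod z) 1 -> Coquelicot.Continuity.continuous f z) ->
  has_coef f b -> in_H2 f -> boundary_fun f g ->
  forall N, Rle (rsum (fun n => (Cmod (b n) ^ 2)%coqR) N) (Rsqr (H2_norm g)).
Proof.
move=> cf fb [_ [B HB]] fg N.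
have fA := circ_mean_le cf HB.
have := boundary_sq_int_le cf fg fA.
have E : (0 + 2 * PI)%coqR = (2 * PI)%coqR by rewrite Rplus_0_l.
rewrite E => /sq_int_fine[gE [s0 _]].
rewrite /H2_norm; set s := fine _ in gE s0 *.
apply: sqrt_div_ge => //.
have [W HW] := tpoly_bounded b N.
have ct t := continuous_Cmod _ _ (continuous_tpoly b N t).
have Hm := @boundary_integral_ge f g 0 _ cf fg fA (fun _ t => Cmod (tpoly b N t))
  (fun t => Cmod (tpoly b N t)) W (rsum (fun n => (Cmod (b n) ^ 2)%coqR) N)
  (fun _ _ _ => ct) ct (fun _ t _ _ => HW t) (fun t => (HW t).1)
  (fun t => tends_at_1_const _) (pairing_eventually f b 0 N cf fb).
rewrite E in Hm.
have csq t : Coquelicot.Continuity.continuous (fun t => (Cmod (tpoly b N t) ^ 2)%coqR) t.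
  by apply: continuous_Cmod_sq; exact: continuous_tpoly.
have cq t : Coquelicot.Continuity.continuous (fun t => (1 / 2 * Cmod (tpoly b N t) ^ 2)%coqR) t.
  by apply: continuous_Rmult; [exact: continuous_const|exact: csq].
have q0 t : Rle 0 (1 / 2 * Cmod (tpoly b N t) ^ 2)%coqR.
  by apply: Rmult_le_pos; [exact: half_ge0|exact: pow2_ge_0].
have gs : (sq_int g 0 (2 * PI)%coqR <= s%:E)%E by rewrite gE.
have BI := integral_le_sq fg two_PI_pos gs half_ge0 cq q0 ct (fun t => (HW t).1)
  (fun t _ _ => amgm _ _).
have := le_trans Hm BI; rewrite lee_fin => /RleP.
by rewrite -{2}E RInt_rmean rmean_scal// tpoly_parseval half_two_PI.
Qed.

Lemma H2_norm_le (f f' : C -> C) (g : R -> C) (b : nat -> C) (A : R) :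
  holoC1 f f' -> has_coef f b -> boundary_fun f g ->
  (forall N, Rle (rsum (fun n => (Cmod (b n) ^ 2)%coqR) N) A) ->
  Rle (Rsqr (H2_norm g)) A.
Proof.
move=> ff' fb fg HA.
have cf z := holoC1_continuous f f' z ff'.
have := boundary_sq_int_le cf fg (fun r r0 r1 => parseval_le f f' b 0 r A ff' fb (conj r0 r1) HA).
rewrite Rplus_0_l => /sq_int_fine[gE [s0 sA]].
exact: sqrt_div_le.
Qed.

(** The weight |Q|^M is at most 4^M on the arc, where the small mean eta of g compensates it, and at
    most 1 on the rest of the circle, where the bound 1 for the mean square of g is enough. *)
Lemma small_inside (f f' : C -> C) (g : R -> C) (b : nat -> C) (a lam eta : R) (M : nat) (z : C) :
  holoC1 f f' -> has_coef f b -> boundary_fun f g ->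
  (forall N, Rle (rsum (fun n => (Cmod (b n) ^ 2)%coqR) N) 1) ->
  Rlt 0 lam -> Rlt lam 1 -> Rlt 0 eta -> Rle (arc_norm g a lam) eta ->
  Rle (4 ^ M * eta)%coqR 1 -> Rle (Cmod z) (1 / 5) ->
  Rle (Cmod (f z) * (1 + lam / 8 / 4) ^ M)%coqR (8 / 3)%coqR.
Proof.
move=> ff' fb fg HA l0 l1 e0 ge Me z5.
have P := two_PI_pos.
have cf z' := holoC1_continuous f f' z' ff'.
have fA r (r0 : Rlt 0 r) (r1 : Rlt r 1) := parseval_le f f' b a r 1 ff' fb (conj r0 r1) HA.
have gA := boundary_sq_int_le cf fg fA.
(* The amplifier is centred at the midpoint of the arc. The period starts at [a], so that the arc is
   its initial segment and the complement a single interval. *)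
pose c := (a + PI * lam)%coqR; pose h := (lam / 8)%coqR.
have [h0 h1] : Rlt 0 h /\ Rlt h 1 by exact: eighth_bounds.
pose y := (a + 2 * PI * lam)%coqR.
have [ay ye] : Rlt a y /\ Rlt y (a + 2 * PI) by exact: arc_inside.
pose w r t := (Cmod (amplifier h c (r * cis t)%C) ^ M)%coqR.
pose w1 t := (Cmod (amplifier h c (cis t)) ^ M)%coqR.
have Hp r t : Rlt 0 r -> Rlt r 1 -> Rle (Cmod (r * cis t)%C) 1.
  by move=> r0 r1; rewrite Cmod_polar; exact: Rlt_le.
have Hc t : Rle (Cmod (cis t)) 1 by rewrite Cmod_cis; exact: Rle_refl.
have amp_ge0 z' : Rle 0 (Cmod (amplifier h c z') ^ M)%coqR by apply: pow_le; exact: Cmod_ge_0.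
have amp_le z' : Rle (Cmod z') 1 -> Rle (Cmod (amplifier h c z') ^ M)%coqR (4 ^ M)%coqR.
  move=> z1; apply: pow_incr; split; first exact: Cmod_ge_0.
  by apply: amplifier_le_4.
have camp z' : Rle (Cmod z') 1 -> Coquelicot.Continuity.continuous (fun z => (Cmod (amplifier h c z) ^ M)%coqR) z'.
  by move=> z1; apply: continuous_Cmod_pow; apply: continuous_amplifier.
have cw r : Rlt 0 r -> Rlt r 1 -> forall t, Coquelicot.Continuity.continuous (w r) t.
  move=> r0 r1 t; apply: (continuous_on_circle (fun z => (Cmod (amplifier h c z) ^ M)%coqR)).
  by apply: camp; exact: Hp.
have cw1 t : Coquelicot.Continuity.continuous w1 t.
  by apply: (continuous_on_unit_circle (fun z => (Cmod (amplifier h c z) ^ M)%coqR)); exact: camp.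
have H1 r t (r0 : Rlt 0 r) (r1 : Rlt r 1) : Rle 0 (w r t) /\ Rle (w r t) (4 ^ M)%coqR.
  by split; [exact: amp_ge0|apply: amp_le; exact: Hp].
have H2 t : tends_at_1 (fun r => w r t) (w1 t).
  exact: tends_radial (camp _ (Hc t)).
have H3 e : Rlt 0 e -> exists d, Rlt 0 d /\ forall r, Rlt (Rminus 1 d) r -> Rlt r 1 ->
     Rle (Rminus (3 / 4 * (Cmod (f z) * (1 + h / 4) ^ M))%coqR e)
      (rmean a (fun t => Rmult (Cmod (f (r * cis t)%C)) (w r t))).
  by apply: interior_eventually => //; exists f'.
have Hm := boundary_integral_ge cf fg fA cw cw1 H1 (fun t => amp_ge0 _) H2 H3.
have gI : (sq_int g a y <= (2 * PI * lam * eta ^ 2)%coqR%:E)%E.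
  (* The bound over the whole period shows first that the integral over the arc is finite; otherwise
     its [fine] would be 0 and the bound on [arc_norm] void. *)
  have := le_trans (sq_int_subset fg (Rle_refl a) (Rlt_le _ _ ye)) gA.
  move=> /sq_int_fine[-> [s0 _]]; rewrite lee_fin; apply/RleP.
  exact: sqrt_arc_le.
have gJ := le_trans (sq_int_subset fg (Rlt_le _ _ ay) (Rle_refl _)) gA.
have W0 := pow4_ge0 M.
(* As an inequality is enough, the half-open second piece may be closed at y; both pieces then have
   the form that [integral_le_sq] handles. *)
have IJ : (\int[@lebesgue_measure R]_(t in `[a, (a + 2 * PI)%coqR]) (Cmod (g t) * w1 t)%coqR%:E <=
   \int[@lebesgue_measure R]_(t in `[a, y]) (Cmod (g t) * w1 t)%coqR%:E +
   \int[@lebesgue_measure R]_(t in `[y, (a + 2 * PI)%coqR]) (Cmod (g t) * w1 t)%coqR%:E)%E.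
  have mgw D : measurable_fun (D : set (measurableTypeR R)) (fun t : measurableTypeR R => (Cmod (g t) * w1 t)%coqR%:E).
    apply/measurable_EFinP.
    exact: (measurable_funM (measurable_funTS (measurable_Cmod fg)) (measurable_Coquelicot cw1)).
  have gw0 t : (0 <= (Cmod (g t) * w1 t)%coqR%:E)%E.
    by rewrite lee_fin; apply/RleP; apply: Rmult_le_pos; [exact: Cmod_ge_0|exact: amp_ge0].
  have -> : `[a, (a + 2 * PI)%coqR]%classic = `[a, y]%classic `|` `]y, (a + 2 * PI)%coqR]%classic.
    by rewrite -itv_bndbnd_setU// bnd_simp; apply/RleP; exact: Rlt_le.
  rewrite ge0_integral_setU//=; last first.
  - apply/disj_setPS => t /= [].
    by rewrite !in_itv/= => /andP[_ ty] /andP[yt _]; move: ty; rewrite leNgt yt.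
  apply: leeD2l; apply: ge0_subset_integral => //.
  by apply: subset_itv; rewrite bnd_simp.
have cc (x : R) : forall t, Coquelicot.Continuity.continuous (fun _ : R => x) t.
  by move=> t; exact: continuous_const.
have al0 : Rle 0 (4 ^ M / (2 * eta))%coqR by apply: Rdiv_le_0_compat => //; exact: double_pos.
have BI := integral_le_sq fg ay gI al0 (cc _) (fun _ => weight_pos _ _ W0 e0) cw1
  (fun t => amp_ge0 _)
  (fun t _ _ => amgm_weight _ _ _ _ (Cmod_ge_0 _) e0 (conj (amp_ge0 _) (amp_le _ (Hc t)))).
have w1_le1 t : Rle y t -> Rle t (a + 2 * PI)%coqR -> Rle (w1 t) 1.
  move=> yt te; apply: pow_le_1; split; first exact: Cmod_ge_0.
  by apply: amplifier_off_arc; split.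
have BJ := integral_le_sq fg ye gJ half_ge0 (cc _) (fun _ => half_ge0) cw1
  (fun t => amp_ge0 _)
  (fun t yt te => amgm_one _ _ (Cmod_ge_0 _) (conj (amp_ge0 _) (w1_le1 t yt te))).
have := le_trans Hm (le_trans IJ (leeD BI BJ)).
rewrite !RInt_const_mul -EFinD lee_fin => /RleP; rewrite -RplusE arc_lengths => H.
apply: budget_final; exact: (arc_budget _ lam eta (4 ^ M)%coqR (conj l0 l1) e0 W0 Me).
Qed.

Close Scope ring_scope.
Close Scope classical_set_scope.
Unset Implicit Arguments.

From Stdlib Require Import Reals Lra Lia.
From Coquelicot Require Import Coquelicot.

Local Open Scope R_scope.

(** * Conclusion *)

Lemma in_H2_continuous (f : C -> C) (z : C) :
  in_H2 f -> Cmod z < 1 -> Continuity.continuous f z.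
Proof.
intros [Hf _] Hz; destruct (Hf z Hz) as [l Hl].
exact (cdiff_continuous f z l (is_derive_cdiff f z l Hl)).
Qed.

Lemma H2_norm_ge0 (g : R -> C) : 0 <= H2_norm g.
Proof. apply sqrt_pos. Qed.

Lemma Hk2_norm_component (k j : nat) (gs : nat -> R -> C) :
  (j <= k)%coq_nat -> Hk2_norm k gs <= 1 -> Rsqr (H2_norm (gs j)) <= 1.
Proof.
intros Hj Hk; unfold Hk2_norm in Hk.
assert (P : forall n, 0 <= sum_f_R0 (fun j => Rsqr (H2_norm (gs j))) n).
{ intros n; apply cond_pos_sum; intros m; apply Rle_0_sqr. }
assert (S : sum_f_R0 (fun j => Rsqr (H2_norm (gs j))) k <= 1).
{ rewrite <- (Rsqr_sqrt _ (P k)); rewrite <- Rsqr_1; apply Rsqr_incr_1; [exact Hk | apply sqrt_pos | lra]. }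
apply Rle_trans with (sum_f_R0 (fun j => Rsqr (H2_norm (gs j))) k); [| exact S].
clear Hk S; induction Hj as [| k Hj IH].
- destruct j as [| j]; simpl; [lra |]; assert (X := P j); lra.
- simpl; assert (X := Rle_0_sqr (H2_norm (gs k.+1))); lra.
Qed.

(* Quantifying over [T] instead of taking [exp (- T)] to be the arc norm leaves
   room for the arc norm to vanish. *)
Lemma H2_norm_decay (k : nat) (lam a T : R) (F : nat -> C -> C) (gs : nat -> R -> C) :
  (1 <= k)%coq_nat -> 0 < lam < 1 ->
  (forall j : nat, (j < k)%coq_nat -> forall z : C, Cmod z < 1 ->
     is_derive (K := C_AbsRing) (V := C_NormedModule) (F j) z (F (S j) z)) ->
  (forall j : nat, (j <= k)%coq_nat -> in_H2 (F j) /\ boundary_fun (F j) (gs j)) ->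
  Hk2_norm k gs <= 1 ->
  gamma0 / lam <= T -> arc_norm (gs O) a lam <= Rtrigo_def.exp (- T) ->
  H2_norm (gs O) <= alpha0 k / (lam * T) ^ k.
Proof.
intros Hk Hl HF HH Hn HT Ha.
assert (HC : forall j, (j < k)%coq_nat -> holoC1 (F j) (F (S j))).
{ intros j Hj; split; intros z Hz.
  - exact (is_derive_cdiff _ _ _ (HF j Hj z Hz)).
  (* For j + 1 <= k the function [F (S j)] belongs to H^2, so it is holomorphic and therefore
     continuous. *)
  - apply in_H2_continuous; [apply (HH (S j)); lia | exact Hz]. }
destruct (has_coef_exists _ _ (HC O ltac:(lia))) as [b Hb].
assert (Hbj : forall j, (j <= k)%coq_nat -> has_coef (F j) (Nat.iter j coef_derive b)).
{ induction j as [| j IH]; intros Hj; [exact Hb |].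
  exact (has_coef_derive _ _ _ (HC j ltac:(lia)) (IH ltac:(lia))). }
assert (B1 : forall j, (j <= k)%coq_nat -> forall N,
  rsum (fun n => Cmod (Nat.iter j coef_derive b n) ^ 2) N <= 1).
{ intros j Hj N; destruct (HH j Hj) as [H1 H2].
  apply Rle_trans with (Rsqr (H2_norm (gs j))); [| now apply (Hk2_norm_component k)].
  refine (coef_le_H2_norm _ (Hbj j Hj) H1 H2 N).
  intros z Hz; now apply in_H2_continuous. }
destruct (parameter_choice k lam T Hk Hl HT) as [M [N [HN [HM HA]]]].
set (G := (1 + lam / 8 / 4) ^ M) in *.
assert (G0 : 0 < G) by (apply pow_lt; lra).
assert (HK : forall z, Cmod z <= 1 / 5 -> Cmod (F O z) <= 8 / 3 / G).
{ intros z Hz.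
  (* Here eta = exp (- T), which is positive even if the arc norm vanishes. *)
  assert (X := small_inside (HC O ltac:(lia)) Hb (proj2 (HH O ltac:(lia))) (B1 O ltac:(lia))
    (proj1 Hl) (proj2 Hl) (exp_pos (- T)) Ha HM Hz).
  apply (Rmult_le_reg_r G); [exact G0 |].
  replace (8 / 3 / G * G) with (8 / 3) by (field; lra); exact X. }
assert (HB := fun n => coef_bound (F O) b (8 / 3 / G) n
  (fun z => in_H2_continuous (F O) z (proj1 (HH O ltac:(lia)))) Hb HK).
assert (S := coef_sum_split b k N (8 / 3 / G) HN HB (B1 k ltac:(lia))).
assert (Q := H2_norm_le (HC O ltac:(lia)) Hb (proj2 (HH O ltac:(lia))) S).
assert (L0 : 0 < T).
{ apply Rlt_le_trans with (gamma0 / lam); [apply Rdiv_lt_0_compat; unfold gamma0; lra | exact HT]. }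
assert (A0 := alpha0_pos k).
apply Rsqr_incr_0.
- eapply Rle_trans; [exact Q |]. rewrite -> Rsqr_pow2; exact HA.
- apply H2_norm_ge0.
- apply Rdiv_le_0_compat; [lra |]. apply pow_lt, Rmult_lt_0_compat; lra.
Qed.

Theorem theorem1 :
  forall k : nat, (1 <= k)%coq_nat ->
  exists alpha gamma : R, 0 < alpha /\ 0 < gamma /\
  forall (lam a : R) (F : nat -> C -> C) (gs : nat -> R -> C),
    0 < lam < 1 ->
    (* F j is the j-th complex derivative of f := F 0 on the disk *)
    (forall j : nat, (j < k)%coq_nat -> forall z : C, Cmod z < 1 ->
       is_derive (K := C_AbsRing) (V := C_NormedModule) (F j) z (F (S j) z)) ->
    (* f^(j) in H^2 with boundary function gs j, for j = 0..k *)
    (forall j : nat, (j <= k)%coq_nat -> in_H2 (F j) /\ boundary_fun (F j) (gs j)) ->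
    Hk2_norm k gs <= 1 ->
    arc_norm (gs O) a lam <= Rtrigo_def.exp (- gamma / lam) ->
    H2_norm (gs O) <=
      alpha / (lam * Rpower.ln (1 / arc_norm (gs O) a lam)) ^ k.
Proof.
intros k Hk; exists (alpha0 k), gamma0.
split; [apply alpha0_pos |]; split; [unfold gamma0; lra |].
intros lam a F gs Hl HF HH Hn Ha.
assert (D := fun T => H2_norm_decay k lam a T F gs Hk Hl HF HH Hn).
set (s := arc_norm (gs O) a lam) in *.
assert (G : 0 < gamma0) by (unfold gamma0; lra).
assert (GE : - gamma0 / lam = - (gamma0 / lam)) by (unfold Rdiv; ring).
rewrite -> GE in Ha.
assert (S0 : 0 <= s) by apply sqrt_pos.
destruct S0 as [s0 | s0].
(* With T = - ln s the bound exp (- T) on the arc norm is attained, and the decay estimate is the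
   claim. *)
- replace (Rpower.ln (1 / s)) with (- Rpower.ln s)
    by (unfold Rdiv; rewrite -> Rmult_1_l, ln_Rinv; [reflexivity | exact s0]).
  apply D.
  + rewrite <- (Ropp_involutive (gamma0 / lam)), <- (ln_exp (- (gamma0 / lam))).
    apply Ropp_le_contravar.
    destruct Ha as [Ha | Ha]; [left; now apply ln_increasing | rewrite -> Ha; lra].
  + rewrite -> Ropp_involutive, exp_ln; [lra | exact s0].
- (* The right-hand side is 0 here, by [/ 0 = 0] and [ln 0 = 0]. *)
  assert (Z : Rpower.ln (1 / s) = 0).
  { rewrite <- s0; unfold Rdiv; rewrite -> Rinv_0, Rmult_0_r.
    unfold Rpower.ln; destruct (Rlt_dec 0 0) as [H | _]; [| reflexivity].
    exact (False_ind _ (Rlt_irrefl 0 H)). }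
  rewrite -> Z, Rmult_0_r, (pow_i k Hk).
  unfold Rdiv; rewrite -> Rinv_0, Rmult_0_r.
  destruct (Rle_lt_dec (H2_norm (gs O)) 0) as [H | H]; [exact H |].
  assert (A0 := alpha0_pos k).
  (* The decay estimate holds for every large T, which contradicts a positive norm: the middle term
     makes the bound at most half the norm, and the last one gives lam T >= 1, so that (lam T)^k >=
     lam T. *)
  set (T := gamma0 / lam + 2 * alpha0 k / (lam * H2_norm (gs O)) + 1 / lam).
  assert (P1 : 0 < gamma0 / lam) by (apply Rdiv_lt_0_compat; lra).
  assert (P2 : 0 < 2 * alpha0 k / (lam * H2_norm (gs O))).
  { apply Rdiv_lt_0_compat; [lra | apply Rmult_lt_0_compat; lra]. }
  assert (P3 : 0 < 1 / lam) by (apply Rdiv_lt_0_compat; lra).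
  assert (X := D T ltac:(unfold T; lra) ltac:(rewrite <- s0; left; apply exp_pos)).
  assert (Y : 1 <= lam * T /\ 2 * alpha0 k / H2_norm (gs O) <= lam * T).
  { assert (E : lam * T = gamma0 + 2 * alpha0 k / H2_norm (gs O) + 1)
      by (unfold T; field; lra).
    assert (P4 : 0 < 2 * alpha0 k / H2_norm (gs O)) by (apply Rdiv_lt_0_compat; lra).
    rewrite -> E; lra. }
  assert (W : lam * T <= (lam * T) ^ k).
  { rewrite <- (pow_1 (lam * T)) at 1; apply Rle_pow; [lra | exact Hk]. }
  assert (V : alpha0 k / (lam * T) ^ k <= alpha0 k / (2 * alpha0 k / H2_norm (gs O))).
  { apply Rmult_le_compat_l; [lra |]; apply Rinv_le_contravar; [apply Rdiv_lt_0_compat |]; lra. }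
  replace (alpha0 k / (2 * alpha0 k / H2_norm (gs O))) with (H2_norm (gs O) / 2) in V
    by (field; lra).
  lra.
Qed.
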